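(* Let $n\ge 1$, $0\le k\le n$, and let $(\sigma,\eta,\rho)$ be Blaschke interpolation data with $n$ interpolation nodes of which $k$ lie in $\mathbb T$. The following two statements are equivalent. (1) The royal $\Gamma$-interpolation problem with data $(\sigma,\eta,\rho)$ is solvable by a rational $\Gamma$-inner function $h$ such that $h(\mathbb D)\not\subset\mathcal R$. (2) The Blaschke interpolation problem with data $(\sigma,\eta,\rho)$ is solvable and there exist $s_0,p_0\in\mathbb C$ such that $$|s_0|<2,\qquad |p_0|=1,\qquad s_0=\overline{s_0}\,p_0,$$ $$s_0a-2b+2p_0c-s_0d=0,$$ where $a,b,c,d$ are the polynomials in the normalised linear fractional parametrization $\varphi=\frac{a\zeta+b}{c\zeta+d}$ ($\zeta\in\mathbb T$) of the solutions of the Blaschke interpolation problem with data $(\sigma,\eta,\rho)$.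
   Context: $\mathbb D$ is the open unit disc, $\mathbb D^-$ its closure, $\mathbb T$ the unit circle. Phasar derivative: for differentiable $f:\mathbb T\to\mathbb C\setminus\{0\}$, $Af(e^{i\theta})=\frac{d}{d\theta}\arg f(e^{i\theta})$; for a rational inner function $\varphi$, $A\varphi(z)=z\varphi'(z)/\varphi(z)$ on $\mathbb T$. A rational inner function is the same as a finite Blaschke product. Blaschke interpolation data: a triple $(\sigma,\eta,\rho)$ where $\sigma=(\sigma_1,\dots,\sigma_n)$ are distinct points with $\sigma_j\in\mathbb T$ for $j\le k$ and $\sigma_j\in\mathbb D$ for $k<j\le n$; $\eta=(\eta_1,\dots,\eta_n)$ with $\eta_j\in\mathbb T$ for $j\le k$ and $\eta_j\in\mathbb D$ for $k<j\le n$; and $\rho=(\rho_1,\dots,\rho_k)$ with all $\rho_j>0$. Blaschke interpolation problem with data $(\sigma,\eta,\rho)$: find a rational inner function $\varphi$ of degree (exactly) $n$ such that $\varphi(\sigma_j)=\eta_j$ for $j=1,\dots,n$ and $A\varphi(\sigma_j)=\rho_j$ for $j=1,\dots,k$. Normalised linear fractional parametrization of the solutions of a (solvable) Blaschke interpolation problem: an expression $\varphi=\frac{a\zeta+b}{c\zeta+d}$ such that (1) $a,b,c,d$ are polynomials of degree at most $n$; (2) for all but at most $k$ values of $\zeta\in\mathbb T$ the function $\varphi(\lambda)=\frac{a(\lambda)\zeta+b(\lambda)}{c(\lambda)\zeta+d(\lambda)}$ is a solution of the problem; (3) for some $\tau\in\mathbb T\setminus\{\sigma_1,\dots,\sigma_k\}$,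 $a(\tau)=d(\tau)=1$ and $b(\tau)=c(\tau)=0$; (4) every solution has the form in (2) for some $\zeta\in\mathbb T$. (If the problem is solvable, such a parametrization exists.) $\Gamma=\{(z+w,zw):|z|\le1,|w|\le1\}\subset\mathbb C^2$, with distinguished boundary $b\Gamma=\{(z+w,zw):|z|=|w|=1\}$. A $\Gamma$-inner function is a holomorphic map $h:\mathbb D\to\Gamma$ whose boundary values at almost all points of $\mathbb T$ lie in $b\Gamma$; it is rational if its two components are. The degree of a rational $\Gamma$-inner function $h=(s,p)$ is the topological degree of $h|_{\mathbb T}:\mathbb T\to b\Gamma$ (the fundamental group of $b\Gamma$, a M\''obius band, is $\mathbb Z$); it is known to equal the degree of the finite Blaschke product $p$. The royal variety is $\mathcal R=\{(2z,z^2):z\in\mathbb C\}$. Royal $\Gamma$-interpolation problem with data $(\sigma,\eta,\rho)$: find a rational $\Gamma$-inner function $h=(s,p)$ of degree $n$ such that $h(\sigma_j)=(-2\eta_j,\eta_j^2)$ for $j=1,\dots,n$ and $Ap(\sigma_j)=2\rho_j$ for $j=1,\dots,k$. *)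

(* Defs.v *)
From HB Require Import structures.
From mathcomp Require Import all_boot all_order all_algebra.
From mathcomp Require Import complex.
From mathcomp Require Import all_classical all_reals all_analysis.

Set Implicit Arguments.
Unset Strict Implicit.
Unset Printing Implicit Defensive.

Import Order.TTheory GRing.Theory Num.Theory.
Import numFieldNormedType.Exports.

Local Open Scope classical_set_scope.
Local Open Scope ring_scope.

(* R[i] packed as a numClosedFieldType, so that it inherits the norm topology
   that numFieldNormedType puts on every numeric field. *)
Definition Cx (R : realType) : numClosedFieldType := R[i].

Section Defs.
Variable R : realType.
Local Notation C := (Cx R).

Definition toC (x : R) : C := (x%:C)%C.
Definition expi (t : R) : C := (cos t +i* sin t)%C.

Definition disc : set C := [set z | `|z| < 1].
Definition cdisc : set C := [set z | `|z| <= 1].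
Definition circle : set C := [set z | `|z| = 1].

(* A rational function is a total function C -> C that agrees with a reduced
   quotient of polynomials off its poles; its values at the poles are
   irrelevant. In particular a rational function that is bounded on the disc
   has no pole on the circle, and its values there are the boundary values. *)
Definition reduced_quotient (f : C -> C) (N M : {poly C}) : Prop :=
  [/\ coprimep N M, M != 0 & forall z, M.[z] != 0 -> f z = N.[z] / M.[z]].

Definition rational (f : C -> C) : Prop :=
  exists N M : {poly C}, reduced_quotient f N M.

Definition rational_of_degree (f : C -> C) (n : nat) : Prop :=
  exists N M : {poly C},
    reduced_quotient f N M /\ maxn (size N).-1 (size M).-1 = n.

Definition holomorphic_on_disc (f : C -> C) : Prop :=
  forall z, disc z -> derivable f z 1.

(* Almost every point of the circle, for arc length, is almost every expi t,
   for Lebesgue measure in t. *)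
Definition inner (f : C -> C) : Prop :=
  [/\ holomorphic_on_disc f,
      forall z, disc z -> cdisc (f z)
    & {ae (@lebesgue_measure R), forall t : R,
        exists2 l : C, circle l & f (toC r * expi t) @[r --> 1^'-] --> l}].

Definition Gamma : set (C * C) :=
  [set x | exists z w, [/\ cdisc z, cdisc w & x = (z + w, z * w)]].

Definition bGamma : set (C * C) :=
  [set x | exists z w, [/\ circle z, circle w & x = (z + w, z * w)]].

Definition royal : set (C * C) :=
  [set x | exists z, x = (2 * z, z ^+ 2)].

Definition Gamma_inner (h : C -> C * C) : Prop :=
  [/\ holomorphic_on_disc (fun z => (h z).1),
      holomorphic_on_disc (fun z => (h z).2),
      forall z, disc z -> Gamma (h z)
    & {ae (@lebesgue_measure R), forall t : R,
        exists2 l : C * C, bGamma l &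
          h (toC r * expi t) @[r --> 1^'-] --> l}].

Definition rational_Gamma_inner (h : C -> C * C) : Prop :=
  [/\ Gamma_inner h, rational (fun z => (h z).1)
    & rational (fun z => (h z).2)].

Definition homotopic_in_bGamma (f g : C -> C * C) : Prop :=
  exists H : R * C -> C * C,
    [/\ {within [set x : R * C | 0 <= x.1 <= 1 /\ circle x.2], continuous H},
        forall t z, 0 <= t <= 1 -> circle z -> bGamma (H (t, z)),
        forall z, circle z -> H (0, z) = f z
      & forall z, circle z -> H (1, z) = g z].

(* bGamma is the symmetric square of the circle; its fundamental group is
   infinite cyclic, generated by the class of the loop z |-> (z + 1, z * 1).
   As the group is abelian, a loop represents n times the generator iff it is
   freely homotopic to that loop precomposed with z |-> z ^+ n. *)
Definition Gamma_degree (h : C -> C * C) (n : nat) : Prop :=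
  homotopic_in_bGamma h (fun z => (z ^+ n + 1, z ^+ n)).

(* The phasar derivative of f at z = expi t is r: some local choice psi of
   arg (f (expi _)) near t has derivative r at t. *)
Definition has_phasar_derivative (f : C -> C) (z : C) (r : R) : Prop :=
  exists (t : R) (psi : R -> R),
    [/\ z = expi t,
        \forall u \near t,
          f (expi u) != 0 /\ f (expi u) = `|f (expi u)| * expi (psi u)
      & is_derive t (1 : R) psi r].

Section Interpolation.
Variables (n k : nat) (hk : (k <= n)%N).
Variables (sigma eta : 'I_n -> C) (rho : 'I_k -> R).

Definition Blaschke_data : Prop :=
  [/\ injective sigma,
      forall j : 'I_n, (j < k)%N -> circle (sigma j) /\ circle (eta j),
      forall j : 'I_n, (k <= j)%N -> disc (sigma j) /\ disc (eta j)
    & forall j : 'I_k, 0 < rho j].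

Definition Blaschke_solution (phi : C -> C) : Prop :=
  [/\ inner phi, rational_of_degree phi n,
      forall j : 'I_n, phi (sigma j) = eta j
    & forall j : 'I_k,
        has_phasar_derivative phi (sigma (widen_ord hk j)) (rho j)].

Definition Blaschke_solvable : Prop := exists phi, Blaschke_solution phi.

Definition linear_fractional (a b c d : {poly C}) (zeta : C) : C -> C :=
  fun z => (a.[z] * zeta + b.[z]) / (c.[z] * zeta + d.[z]).

(* In the second clause a solution has degree exactly n, so a zeta + b and
   c zeta + d have no common zero; hence evaluating the quotient pointwise
   agrees with evaluating the rational function. *)
Definition normalised_parametrization (tau : C) (a b c d : {poly C}) : Prop :=
  [/\ [/\ (size a <= n.+1)%N, (size b <= n.+1)%N, (size c <= n.+1)%N
        & (size d <= n.+1)%N],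
      exists2 E : seq C, (size E <= k)%N &
        forall zeta, circle zeta -> zeta \notin E ->
          Blaschke_solution (linear_fractional a b c d zeta),
      [/\ a.[tau] = 1, d.[tau] = 1, b.[tau] = 0 & c.[tau] = 0]
    & forall phi, Blaschke_solution phi ->
        exists2 zeta, circle zeta &
          forall z, cdisc z -> phi z = linear_fractional a b c d zeta z].

Definition royal_solution (h : C -> C * C) : Prop :=
  [/\ rational_Gamma_inner h, Gamma_degree h n,
      forall j : 'I_n, h (sigma j) = (- (2 * eta j), eta j ^+ 2)
    & forall j : 'I_k,
        has_phasar_derivative (fun z => (h z).2)
          (sigma (widen_ord hk j)) (2 * rho j)].

End Interpolation.
End Defs.

(* Main.v *)
Require Import Defs.
From HB Require Import structures.
From mathcomp Require Import all_boot all_order all_algebra.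
From mathcomp Require Import complex.
From mathcomp Require Import all_classical all_reals all_analysis.
From mathcomp Require Import ring lra.
Import Order.TTheory GRing.Theory Num.Theory.
Import numFieldNormedType.Exports.
Local Open Scope classical_set_scope.
Local Open Scope ring_scope.

(** A rational inner function h = (s, p) into the symmetrized bidisc is turned
    into a family of inner functions (2 w p - s) / (2 - w s), one for each w on
    the circle. At a royal node, where s = - 2 eta and p = eta ^+ 2, all of them
    have the value eta, and at a node on the circle half the phasar derivative
    of p. So a royal interpolant yields a one-parameter family of solutions of
    the Blaschke problem, and the theorem says which families arise in this way.

    Everything is reduced to identities between polynomials by means of the
    reflection [star n P] in the circle. Inner functions of degree n are the
    quotients u *: star n M / M ([inner_rep]), and h has the form s = E / D,
    p = P / D, where P is a multiple of the reflection of D and E is a multiple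
    of its own reflection ([Gamma_inner_rep]). The interpolation conditions,
    cleared of denominators, are linear ([interp]). The main tool is a count of
    zeros ([selfinv_eq0]): a polynomial that is a multiple of its reflection of
    degree 2 n and vanishes at the n nodes, doubly at those on the circle, has
    no further zeros besides mirror images of nodes, or is zero. Applied to
    N1 * M2 - N2 * M1 it shows that a solution of the Blaschke problem is
    determined by its value at one further point of the circle
    ([interp_unique]); applied to 4 D P - E^2 it shows that the nodes are the
    only royal nodes in the closed disc ([royal_poly_eq0]).

    Given h, this implies that the fraction (2 w P - E) / (2 D - w E) is reduced
    except when w = - conj (eta j) for one of the k nodes on the circle. A
    linear fractional change of w, given by the values s0, p0 of s, p at tau,
    normalises the family at tau, and the linear relation between a, b, c, d
    holds by direct computation. The family contains all solutions because some
    member has the same value at tau ([blaschke_of_royal]).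

    Conversely, D, E, P are linear combinations of a, b, c, d. That almost all
    parameters give inner functions makes d the reflection of a, and c that of
    b, up to a common factor, and the linear relation then makes E a multiple of
    its reflection. The point (s, p) is in the symmetrized bidisc as soon as
    |2 w p - s| <= |2 - w s| for all w on the circle and |s| <= 2
    ([pencil_le_GammaP]). The second condition is the delicate one: it is true
    at tau as |s0| < 2, and it propagates over the disc because otherwise some
    2 D - w E would have a zero there ([pencil_bound]).

    The degree of h is tied to the degree of p by homotopies. If p is a quotient
    u *: star m D / D with no zero of D in the closed disc, it is deformed to a
    multiple of z ^+ m by replacing D (z) with D (t z), and m is recovered from
    a loop homotopic to z ^+ m by a discrete winding number
    ([loop_degree_unique]). *)

Set Implicit Arguments.
Unset Strict Implicit.
Unset Printing Implicit Defensive.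

(** * Polynomials reflected in the unit circle *)

Section Star.
Variable C : numClosedFieldType.
Implicit Types (P Q F G : {poly C}) (z w u : C).

(** The reflection z ^+ n * conj (P (1 / conj z)) of P in the circle. The
    number n is a parameter because the reflection of a polynomial of degree
    less than n has zeros at 0, the mirror images of zeros at infinity. *)
Definition star n P : {poly C} := \poly_(i < n.+1) (P`_(n - i))^*.

Lemma size_star n P : (size (star n P) <= n.+1)%N.
Proof. exact: size_poly. Qed.

Lemma coef_star n P i :
  (star n P)`_i = if (i <= n)%N then (P`_(n - i))^* else 0.
Proof. by rewrite coef_poly ltnS. Qed.

Lemma starD n P Q : star n (P + Q) = star n P + star n Q.
Proof.
apply/polyP => i; rewrite coefD !coef_star; case: ifP => _; last by rewrite addr0.
by rewrite coefD rmorphD.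
Qed.

Lemma starZ n u P : star n (u *: P) = u^* *: star n P.
Proof.
apply/polyP => i; rewrite coefZ !coef_star; case: ifP => _; last by rewrite mulr0.
by rewrite coefZ rmorphM.
Qed.

Lemma star0 n : star n 0 = 0.
Proof. by apply/polyP => i; rewrite coef_star !coef0 conjC0 if_same. Qed.

Lemma starK n P : (size P <= n.+1)%N -> star n (star n P) = P.
Proof.
move=> sP; apply/polyP => i; rewrite !coef_star.
case: (leqP i n) => hi; last by rewrite nth_default // (leq_trans sP).
by rewrite leq_subr subKn // conjCK.
Qed.

Lemma horner_star n P z : (size P <= n.+1)%N -> z != 0 ->
  (star n P).[z] = z ^+ n * (P.[(z^*)^-1])^*.
Proof.
move=> sP z0; rewrite horner_poly (horner_coef_wide _ sP) rmorph_sum mulr_sumr.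
rewrite (reindex_inj rev_ord_inj); apply: eq_bigr => i _ /=.
have hi : (i <= n)%N by rewrite -ltnS.
rewrite subSS subKn // rmorphM rmorphXn /= fmorphV /= conjCK exprVn.
by rewrite -[in X in _ = X * _](subnK hi) exprD mulrCA -mulrA mulfV ?mulr1 ?expf_neq0.
Qed.

Lemma conjV_circle z : `|z| = 1 -> (z^*)^-1 = z.
Proof.
move=> hz; have := invC_norm z; rewrite hz expr1n invr1 mul1r => <-.
by rewrite invrK.
Qed.

Lemma circle_neq0 z : `|z| = 1 -> z != 0.
Proof. by move=> hz; rewrite -normr_eq0 hz oner_eq0. Qed.

Lemma circle_mulJ z : `|z| = 1 -> z * z^* = 1.
Proof. by move=> hz; rewrite -normCK hz expr1n. Qed.

Lemma star_circle n P z : (size P <= n.+1)%N -> `|z| = 1 ->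
  (star n P).[z] = z ^+ n * (P.[z])^*.
Proof. by move=> sP hz; rewrite horner_star ?circle_neq0 // conjV_circle. Qed.

Lemma poly_ext_neq0 P Q : (forall z, z != 0 -> P.[z] = Q.[z]) -> P = Q.
Proof.
move=> h; apply/eqP; rewrite -subr_eq0; apply: contraT => nz.
pose s := [seq i.+1%:R : C | i <- iota 0 (size (P - Q))].
have := @max_poly_roots _ (P - Q) s nz.
rewrite size_map size_iota ltnn => -> //.
  apply/allP => _ /mapP[i _ ->]; apply/rootP.
  by rewrite hornerD hornerN h ?subrr ?pnatr_eq0.
by rewrite map_inj_uniq ?iota_uniq // => i j /eqP; rewrite eqr_nat eqSS => /eqP.
Qed.

Lemma size_mul_le m n P Q : (size P <= m.+1)%N -> (size Q <= n.+1)%N ->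
  (size (P * Q)%R <= (m + n).+1)%N.
Proof.
move=> sP sQ; apply: leq_trans (size_polyMleq _ _) _.
by have := leq_add sP sQ; rewrite addSn addnS; case: (_ + _)%N.
Qed.

Lemma starM m n P Q : (size P <= m.+1)%N -> (size Q <= n.+1)%N ->
  star (m + n) (P * Q) = star m P * star n Q.
Proof.
move=> sP sQ; apply: poly_ext_neq0 => z z0.
have sPQ := size_mul_le sP sQ.
rewrite hornerM !horner_star // hornerM rmorphM exprD; ring.
Qed.

(** A quadratic, equal to its own reflection, that vanishes at x and at the
    mirror image 1 / conj x: a multiple of ('X - x%:P) ^+ 2 when x is on the
    circle, and 'X when x = 0. *)
Definition blaschke_quad x : {poly C} := ('X - x%:P) * (1 - x^* *: 'X).

Lemma blaschke_quad_neq0 x : blaschke_quad x != 0.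
Proof.
rewrite mulf_neq0 ?polyXsubC_eq0 //; apply/eqP => /(congr1 (coefp 0)).
by rewrite /= coefB coefZ coefX coef1 coef0 mulr0 subr0 => /eqP; rewrite oner_eq0.
Qed.

Lemma size_blaschke_quad x : (size (blaschke_quad x) <= 3)%N.
Proof.
apply: (@size_mul_le 1 1); first by rewrite size_XsubC.
rewrite (leq_trans (size_polyD _ _)) // geq_max size_poly1 size_polyN /=.
by rewrite (leq_trans (size_scale_leq _ _)) // size_polyX.
Qed.

Lemma horner_blaschke_quad x z : (blaschke_quad x).[z] = (z - x) * (1 - x^* * z).
Proof. by rewrite !hornerE. Qed.

Lemma star_blaschke_quad x : star 2 (blaschke_quad x) = blaschke_quad x.
Proof.
apply: poly_ext_neq0 => z z0; rewrite horner_star ?size_blaschke_quad //.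
rewrite !horner_blaschke_quad !(rmorphM, rmorphB, fmorphV, rmorph1) /= !conjCK.
field.
exact: z0.
Qed.

(** A polynomial that is a multiple of its reflection vanishes at x and at the
    mirror image of x together. For x = 0 the image is infinity, and vanishing
    there is a drop of the degree. *)
Lemma div_blaschke_quad m u F x : `|x| <= 1 -> (size F <= m.*2.+3)%N ->
  F = u *: star m.+1.*2 F -> F.[x] = 0 -> (`|x| = 1 -> F^`().[x] = 0) ->
  exists2 G : {poly C}, F = blaschke_quad x * G & (size G <= m.*2.+1)%N.
Proof.
move=> hx sF eF Fx F'x.
have [->|F0] := eqVneq F 0; first by exists 0; rewrite ?mulr0 ?size_poly0.
have [G1 eG1] := factor_theorem _ _ (introT rootP Fx).
have G10 : G1 != 0 by apply: contraNneq F0; rewrite eG1 => ->; rewrite mul0r.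
have [x0|x0] := eqVneq x 0.
  exists G1; first by rewrite /blaschke_quad eG1 x0 conjC0 scale0r (subr0 (1 :
    {poly C})) mulr1 mulrC.
  have : (size F <= m.*2.+2)%N.
    apply/leq_sizeP => i; rewrite leq_eqVlt => /predU1P[<-|hi].
      rewrite eF coefZ coef_star leqnn subnn -horner_coef0.
      by move: Fx; rewrite x0 => ->; rewrite conjC0 mulr0.
    by rewrite nth_default // (leq_trans sF).
  by rewrite eG1 size_Mmonic ?monicXsubC // size_XsubC addn2.
pose y := (x^*)^-1.
have xJ0 : x^* != 0 by rewrite conjC_eq0.
have G1y : G1.[y] = 0.
  have [x1|x1] := eqVneq `|x| 1.
    move: (F'x x1); rewrite eG1 derivM derivXsubC mulr1 !hornerE subrr mulr0 add0r.
    by rewrite /y conjV_circle.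
  have yx : y - x != 0.
    rewrite subr_eq0; apply: contra x1 => /eqP yx.
    rewrite -(pexpr_eq1 (n := 2)) // normCK -{1}yx /y mulVf //.
  apply/(mulIf yx); rewrite mul0r -[y - x](_ : ('X - x%:P).[y] = _) ?hornerE //.
  rewrite -hornerXsubC -hornerM -eG1 eF hornerZ horner_star ?invr_eq0 //.
  by rewrite /y fmorphV /= conjCK invrK Fx conjC0 !mulr0.
have [G2 eG2] := factor_theorem _ _ (introT rootP G1y).
exists ((- x^*)^-1 *: G2).
  rewrite eG1 eG2 /blaschke_quad.
  have -> : 1 - x^* *: 'X = (- x^*) *: ('X - y%:P).
    rewrite scalerBr scaleNr [LHS]addrC; congr (_ + _).
    by rewrite scaleNr opprK -mul_polyC -polyCM mulfV.
  rewrite -scalerAr -(scalerAr (- x^*)) -scalerAl scalerA mulVf ?oppr_eq0 // scale1r.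
  by rewrite -mulrA mulrC; congr (_ * _); rewrite mulrC.
apply: leq_trans (size_scale_leq _ _) _.
have G20 : G2 != 0 by apply: contraNneq G10; rewrite eG2 => ->; rewrite mul0r.
move: sF; rewrite eG1 size_Mmonic ?monicXsubC // size_XsubC addn2 /=.
by rewrite eG2 size_Mmonic ?monicXsubC // size_XsubC addn2.
Qed.

(** Counted with mirror images, and twice on the circle, the zeros in s
    already number twice the size of s, which bounds the degree of F; so one
    more zero forces F = 0. The induction splits off one quadratic for each
    element of s, and the quotient is again a multiple of its reflection. *)
Lemma selfinv_eq0 (s : seq C) u F w :
  uniq s -> all (fun x => `|x| <= 1) s ->
  (size F <= (size s).*2.+1)%N -> F = u *: star (size s).*2 F ->
  {in s, forall x, F.[x] = 0} ->
  {in s, forall x, `|x| = 1 -> F^`().[x] = 0} ->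
  {in s, forall x, w != x /\ x^* * w != 1} ->
  F.[w] = 0 -> F = 0.
Proof.
elim: s F => [|x s IH] F /=.
  move=> _ _ sF _ _ _ _; rewrite (size1_polyC sF) hornerC => ->.
  by rewrite polyC0.
case/andP=> xs us /andP[hx hs] sF eF Fs F's hw Fw.
have [||G eG sG] := @div_blaschke_quad (size s) u F x hx sF eF.
- by rewrite Fs ?mem_head.
- by move=> x1; rewrite F's ?mem_head.
have B0 := blaschke_quad_neq0 x.
have nB z : z != x -> x^* * z != 1 -> (blaschke_quad x).[z] != 0.
  by move=> zx zx'; rewrite horner_blaschke_quad mulf_neq0 // subr_eq0 // eq_sym.
have ns z : z \in s -> (blaschke_quad x).[z] != 0.
  move=> zs; have zx : z != x by apply: contraNneq xs => <-.
  apply: nB => //; apply/eqP => e1.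
  have z1 : `|z| <= 1 by move/allP: hs => /(_ z zs).
  have nx : `|x| = 1.
    apply/eqP; rewrite eq_le hx /=.
    have : `|x^*| * `|z| = 1 by rewrite -normrM e1 normr1.
    rewrite norm_conjC => <-; rewrite ler_piMr //.
  move/eqP: zx; apply; move: e1 => /(congr1 ( *%R x)).
  by rewrite mulrA circle_mulJ // mul1r mulr1.
have Gs z : z \in s -> G.[z] = 0.
  move=> zs; have := Fs z; rewrite inE zs orbT => /(_ isT) /eqP.
  by rewrite eG hornerM mulf_eq0 (negPf (ns _ zs)) /= => /eqP.
rewrite eG (IH G) ?mulr0 //.
- apply: (mulfI B0); rewrite -{1}eG eF [in X in _ *: X]eG doubleS.
  by rewrite -[X in star X]/(2 + _)%N starM ?size_blaschke_quad //
    star_blaschke_quad scalerAr.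
- move=> z zs z1; have := F's z; rewrite inE zs orbT => /(_ isT z1) /eqP.
  rewrite eG derivM hornerD (hornerM _ G) (hornerM (blaschke_quad x)) (Gs z zs)
    mulr0 add0r mulf_eq0.
  by rewrite (negPf (ns _ zs)) /= => /eqP.
- by move=> z zs; apply: hw; rewrite inE zs orbT.
- have [wx wx'] := hw x (mem_head _ _).
  by move: Fw => /eqP; rewrite eG hornerM mulf_eq0 (negPf (nB _ wx wx')) /= => /eqP.
Qed.

End Star.

(** * The symmetrized bidisc and its boundary *)

Section GammaAlgebra.
Variable C : numClosedFieldType.
Implicit Types (s p z w u x : C).

(** After a rotation of z and w by u, the difference of the squared moduli is
    2 (1 - |z|^2) |1 - w|^2 + 2 (1 - |w|^2) |1 - z|^2. *)
Lemma Gamma_pencil_le z w u : `|z| <= 1 -> `|w| <= 1 -> `|u| = 1 ->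
  `|2 * u * (z * w) - (z + w)| <= `|2 - u * (z + w)|.
Proof.
move=> hz hw hu.
have key (a b : C) : `|a| <= 1 -> `|b| <= 1 -> `|2 * (a * b) - (a + b)| <= `|2
  - (a + b)|.
  move=> ha hb; rewrite -(ler_pXn2r (n := 2)) // -?topredE //= ?normr_ge0 //.
  rewrite -subr_ge0.
  have -> : `|2 - (a + b)| ^+ 2 - `|2 * (a * b) - (a + b)| ^+ 2 =
     2 * ((1 - `|a| ^+ 2) * `|1 - b| ^+ 2) + 2 * ((1 - `|b| ^+ 2) * `|1 - a| ^+ 2).
    rewrite !normCK !(rmorphD, rmorphN, rmorphM, rmorph1) /=; ring.
  by rewrite addr_ge0 // mulr_ge0 // mulr_ge0 ?sqr_ge0 ?exprn_ge0 // subr_ge0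
    exprn_ile1.
have -> : `|2 * u * (z * w) - (z + w)| = `|2 * ((u * z) * (u * w)) - (u * z + u * w)|.
  rewrite -[LHS]mul1r -hu -normrM; congr `|_|; ring.
rewrite mulrDr; apply: key; by rewrite normrM hu mul1r.
Qed.

Lemma quad_roots s p : exists z w, s = z + w /\ p = z * w.
Proof.
pose r := sqrtC (s ^+ 2 - 4 * p).
have h2 : (2 : C) != 0 by rewrite pnatr_eq0.
exists ((s + r) / 2), ((s - r) / 2); split; first by field.
have -> : (s + r) / 2 * ((s - r) / 2) = (s ^+ 2 - r ^+ 2) / 4 by field.
by rewrite sqrtCK; field.
Qed.

(** Let z, w be the roots of X^2 - s X + p. The relation s = conj s * p makes
    1 / conj z a root as well. If it is z, then |z| = 1; if it is w, then |s|
    = |z| + 1 / |z|, which exceeds 2 unless |z| = 1. *)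
Lemma bGammaP s p : `|p| = 1 -> s = s^* * p -> `|s| <= 2 ->
  exists z w, [/\ `|z| = 1, `|w| = 1, s = z + w & p = z * w].
Proof.
move=> hp hs hs2; have [z [w [es ep]]] := quad_roots s p.
have p0 : p != 0 by rewrite circle_neq0.
have z0 : z != 0 by apply: contraNneq p0 => z0; rewrite ep z0 mul0r.
have zJ0 : z^* != 0 by rewrite conjC_eq0.
have hzw : `|z| * `|w| = 1 by rewrite -normrM -ep.
suff nz : `|z| = 1 by exists z, w; split=> //; move: hzw; rewrite nz mul1r.
have e1 : z + w = (z^* + w^*) * (z * w) by rewrite -rmorphD -es -ep.
have e2 : z * w * (z^* * w^*) = 1 by rewrite -rmorphM -ep -normCK hp expr1n.
(* Up to a unit this is the value at 1 / conj z of X^2 - s X + p. *)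
have : (1 - z * z^*) * (1 - w * z^*) = 0.
  have -> : (1 - z * z^*) * (1 - w * z^*) =
    1 - z^* * (z + w) + z * w * z^* ^+ 2 by ring.
  by rewrite e1 mulrDl mulrDr -[X in X - _]e2; ring.
move/eqP; rewrite mulf_eq0 !subr_eq0 => /orP[/eqP h|/eqP h].
  by apply/eqP; rewrite -(pexpr_eq1 (n := 2)) // normCK -h.
have ew : w = (z^*)^-1 by rewrite -[LHS](mulfK zJ0) -h mul1r.
have es' : s * z^* = `|z| ^+ 2 + 1 by rewrite es ew mulrDl mulVf // normCK.
have := hs2; rewrite -(ler_pM2r (_ : 0 < `|z|)) ?normr_gt0 //.
have -> : `|s| * `|z| = `|z| ^+ 2 + 1.
  by rewrite -[`|z| in LHS]norm_conjC -normrM es' ger0_norm // addr_ge0 ?exprn_ge0.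
rewrite -subr_ge0 => hh.
have h0 : 0 <= (`|z| - 1) ^+ 2.
  by rewrite real_exprn_even_ge0 // rpredB ?normr_real ?rpred1.
have : (`|z| - 1) ^+ 2 = 0.
  apply/eqP; rewrite eq_le h0 andbT -oppr_ge0.
  by have -> : - (`|z| - 1) ^+ 2 = 2 * `|z| - (`|z| ^+ 2 + 1) by ring.
by move/eqP; rewrite expf_eq0 /= subr_eq0 => /eqP.
Qed.

Lemma bGamma_char z w : `|z| = 1 -> `|w| = 1 ->
  [/\ `|z * w| = 1, z + w = (z + w)^* * (z * w) & `|z + w| <= 2].
Proof.
move=> hz hw; split.
- by rewrite normrM hz hw mulr1.
- rewrite rmorphD /= mulrDl mulrA (mulrC z^*) circle_mulJ // mul1r.
  by rewrite mulrCA mulrA -mulrA (mulrC w^*) circle_mulJ // mulr1 addrC.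
- by rewrite (le_trans (ler_normD _ _)) // hz hw.
Qed.

(** Together the inequalities say |s - conj s * p| <= 1 - |p|^2. If |p| < 1 it
    follows that s = b + conj b * p with |b| <= 1, and a root x of X^2 - s X +
    p satisfies x (x - b) = p (conj b * x - 1), so that |x| > 1 would lead to
    |x| <= |p|. If |p| = 1 then s = conj s * p, and the point lies on the
    distinguished boundary. *)
Lemma pencil_le_GammaP s p : `|s| <= 2 ->
  (forall u, `|u| = 1 -> `|2 * u * p - s| <= `|2 - u * s|) ->
  exists z w, [/\ `|z| <= 1, `|w| <= 1, s = z + w & p = z * w].
Proof.
move=> hs2 H.
(* The squared inequality for u is 1 - |p|^2 >= re (u * q). *)
pose q := s - s^* * p.
have sq u : `|u| = 1 -> 0 <= 1 - `|p| ^+ 2 - (u * q + (u * q)^*) / 2.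
  move=> hu; have := H u hu.
  rewrite -(ler_pXn2r (n := 2)) // -?topredE //= ?normr_ge0 // -subr_ge0.
  have -> : `|2 - u * s| ^+ 2 - `|2 * u * p - s| ^+ 2 =
     4 * (1 - `|p| ^+ 2 - (u * q + (u * q)^*) / 2)
     + (u * u^* - 1) * (s * s^* - 4 * (p * p^*)).
    rewrite /q !normCK !(rmorphD, rmorphN, rmorphM, rmorph1) /= !conjCK.
    by field.
  by rewrite circle_mulJ // subrr mul0r addr0 pmulr_rge0.
have hq : `|q| <= 1 - `|p| ^+ 2.
  have [q0|q0] := eqVneq q 0.
    have := sq 1 (normr1 _); rewrite q0 mulr0 rmorph0 addr0 mul0r subr0.
    by rewrite normr0.
  (* This u makes u * q = |q|, the extreme case. *)
  pose u := `|q| / q.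
  have uq : u * q = `|q| by rewrite mulfVK.
  have hu : `|u| = 1 by rewrite normf_div normr_id divff // normr_eq0.
  have := sq u hu; rewrite uq conj_Creal ?normr_real //.
  have -> : (`|q| + `|q|) / 2 = `|q| by field.
  by rewrite subr_ge0.
have hp : `|p| <= 1.
  rewrite -(expr_le1 (n := 2)) // -subr_ge0; exact: le_trans (normr_ge0 _) hq.
have [p1|p1] := eqVneq `|p| 1.
  have q0 : q = 0.
    by apply: normr0_eq0; apply/eqP; rewrite eq_le normr_ge0 andbT; move: hq;
      rewrite p1 expr1n subrr.
  have [|z [w [h1 h2 h3 h4]]] := bGammaP p1 _ hs2.
    by move/eqP: q0; rewrite subr_eq0 => /eqP.
  by exists z, w; rewrite h1 h2 lexx.
have plt : `|p| < 1 by rewrite lt_neqAle p1.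
have dpos : 0 < 1 - `|p| ^+ 2 by rewrite subr_gt0 exprn_ilt1.
pose b := q / (1 - `|p| ^+ 2).
have dJ : (1 - `|p| ^+ 2)^* = 1 - `|p| ^+ 2 by rewrite conj_Creal // gtr0_real.
have hb : `|b| <= 1.
  by rewrite normf_div (ger0_norm (ltW dpos)) ler_pdivrMr // mul1r.
have es : s = b + b^* * p.
  rewrite /b rmorphM fmorphV /= dJ /q normCK !(rmorphD, rmorphN, rmorphM) /= conjCK.
  field; by rewrite -normCK gt_eqF.
clearbody b.
have root_le x : x ^+ 2 - s * x + p = 0 -> `|x| <= 1.
  move=> ex; have hx0 : `|x| \is Num.real by rewrite normr_real.
  have : x * (x - b) = p * (b^* * x - 1).
    by apply/eqP; rewrite -subr_eq0 -ex es; apply/eqP; ring.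
  move/(congr1 Num.norm); rewrite !normrM => e.
  case: (real_leP hx0 (rpred1 _)) => // hx.
  have le1 : `|b^* * x - 1| <= `|x - b|.
    rewrite -(ler_pXn2r (n := 2)) // -?topredE //= ?normr_ge0 // -subr_ge0.
    have -> : `|x - b| ^+ 2 - `|b^* * x - 1| ^+ 2 = (`|x| ^+ 2 - 1) * (1 - `|b| ^+ 2).
      rewrite !normCK !(rmorphD, rmorphN, rmorphM, rmorph1) /= conjCK; ring.
    by rewrite mulr_ge0 // subr_ge0 ?exprn_ile1 // exprn_ege1 // ltW.
  have [xb|xb] := eqVneq x b; first by have := lt_le_trans hx (eq_ind_r (fun y
    => `|y| <= 1) hb xb); rewrite ltxx.
  have xb0 : 0 < `|x - b| by rewrite normr_gt0 subr_eq0.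
  have : `|x| * `|x - b| <= `|p| * `|x - b| by rewrite e ler_wpM2l.
  by rewrite ler_pM2r // => hxp; have := lt_trans (lt_le_trans hx hxp) plt;
    rewrite ltxx.
have [z [w [ez ew]]] := quad_roots s p.
exists z, w; split => //; apply: root_le; rewrite ez ew; ring.
Qed.

End GammaAlgebra.

(** * Interpolation conditions, pencils and the royal polynomial *)

Section Nodes.
Variables (C : numClosedFieldType) (n k : nat) (hk : (k <= n)%N).
Variables (sigma eta : 'I_n -> C) (rho : 'I_k -> C).
Implicit Types (D E P N M F : {poly C}) (u w x : C).

(** The interpolation conditions for the fraction N / M, cleared of
    denominators. In this form they are linear in the pair (N, M), including
    those on the phasar derivative. *)
Definition interp N M : Prop :=
  (forall j, N.[sigma j] = eta j * M.[sigma j]) /\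
  forall j : 'I_k, let i := widen_ord hk j in
    sigma i * (N^`().[sigma i] - eta i * M^`().[sigma i]) =
    rho j * eta i * M.[sigma i].

Lemma interp_lin u w N1 M1 N2 M2 : interp N1 M1 -> interp N2 M2 ->
  interp (u *: N1 + w *: N2) (u *: M1 + w *: M2).
Proof.
move=> [h1 d1] [h2 d2]; split=> j /=; rewrite ?(derivD, derivN, derivZ, derivM)
  !(hornerD, hornerN, hornerZ, hornerM) ?h1 ?h2; first by ring.
have := d1 j; have := d2 j => /= {}d2 {}d1.
transitivity (u * (rho j * eta (widen_ord hk j) * M1.[sigma (widen_ord hk j)]) +
   w * (rho j * eta (widen_ord hk j) * M2.[sigma (widen_ord hk j)])); last by ring.
by rewrite -d1 -d2; ring.
Qed.

Hypothesis sigma_inj : injective sigma.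
Hypothesis on_circle :
  forall j : 'I_n, (j < k)%N -> `|sigma j| = 1 /\ `|eta j| = 1.
Hypothesis in_disc :
  forall j : 'I_n, (k <= j)%N -> `|sigma j| < 1 /\ `|eta j| < 1.

Lemma node_le1 j : `|sigma j| <= 1.
Proof.
case: (ltnP j k) => [/on_circle[->]|/in_disc[/ltW]] //.
Qed.

Definition away w := forall j, w != sigma j /\ (sigma j)^* * w != 1.

Lemma selfinv_nodes_eq0 u F w : (size F <= n.*2.+1)%N -> F = u *: star n.*2 F ->
  (forall j, F.[sigma j] = 0) ->
  (forall j : 'I_k, F^`().[sigma (widen_ord hk j)] = 0) ->
  away w -> F.[w] = 0 -> F = 0.
Proof.
move=> sF eF F0 F'0 aw Fw.
have sz : size (codom sigma) = n by rewrite size_codom card_ord.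
apply: (@selfinv_eq0 C (codom sigma) u F w); rewrite ?sz //.
- exact/injectiveP.
- by apply/allP => _ /codomP[j ->]; exact: node_le1.
- by move=> _ /codomP[j ->].
- move=> _ /codomP[j ->] s1.
  case: (ltnP j k) => [jk|/in_disc[]]; last by rewrite s1 ltxx.
  by have := F'0 (Ordinal jk); congr (_.[sigma _] = 0); apply: val_inj.
- by move=> _ /codomP[j ->].
Qed.

(** N1 * M2 - N2 * M1 is a multiple of its own reflection of degree 2 n and
    vanishes at all nodes, doubly at those on the circle; the additional zero
    w makes it vanish identically. *)
Lemma interp_unique u1 u2 N1 M1 N2 M2 w :
  `|u1| = 1 -> `|u2| = 1 ->
  (size N1 <= n.+1)%N -> (size M1 <= n.+1)%N ->
  (size N2 <= n.+1)%N -> (size M2 <= n.+1)%N ->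
  N1 = u1 *: star n M1 -> N2 = u2 *: star n M2 ->
  interp N1 M1 -> interp N2 M2 ->
  away w -> N1.[w] * M2.[w] = N2.[w] * M1.[w] -> N1 * M2 = N2 * M1.
Proof.
move=> hu1 hu2 sN1 sM1 sN2 sM2 e1 e2 [h1 d1] [h2 d2] aw ew.
have eM (u : C) (N M : {poly C}) : `|u| = 1 -> (size M <= n.+1)%N ->
    N = u *: star n M -> star n N = u^* *: M.
  by move=> hu sM ->; rewrite starZ starK.
apply/eqP; rewrite -subr_eq0; apply/eqP.
have sz (P Q : {poly C}) : (size P <= n.+1)%N -> (size Q <= n.+1)%N ->
  (size (P * Q)%R <= n.*2.+1)%N by rewrite -addnn; exact: size_mul_le.
apply: (@selfinv_nodes_eq0 (- (u1 * u2)) _ w) => //.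
- rewrite (leq_trans (size_polyD _ _)) // geq_max size_polyN.
  by rewrite !sz.
- rewrite -addnn -[- (N2 * M1)]scaleN1r starD starZ !starM //.
  rewrite (eM _ _ _ hu1 sM1 e1) (eM _ _ _ hu2 sM2 e2).
  rewrite {1}e1 {1}e2 rmorphN rmorph1 -!mul_polyC.
  have c1 : (u1%:P : {poly C}) * (u1^*)%:P = 1 by rewrite -polyCM circle_mulJ.
  have c2 : (u2%:P : {poly C}) * (u2^*)%:P = 1 by rewrite -polyCM circle_mulJ.
  rewrite !polyCN polyCM polyC1.
  transitivity (u1%:P * star n M1 * M2 * (u2%:P * (u2^*)%:P) +
                -1 * (u2%:P * star n M2 * M1 * (u1%:P * (u1^*)%:P))); last by ring.
  by rewrite c1 c2 !mulr1.
- by move=> j; rewrite !(hornerD, hornerN, hornerZ, hornerM) h1 h2; ring.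
- move=> j; have := d1 j; have := d2 j => /= {}d2 {}d1.
  set s := sigma _ in d1 d2 *; have s0 : s != 0.
    by rewrite circle_neq0 //; case: (on_circle (j := widen_ord hk j)) => //=.
  apply: (mulfI s0); rewrite ?(derivD, derivN, derivZ, derivM) !(hornerD,
    hornerN, hornerZ, hornerM) (h1 (widen_ord hk j)) (h2 (widen_ord hk j)) -/s.
  transitivity (M2.[s] * (s * (N1^`().[s] - eta (widen_ord hk j) * M1^`().[s])) -
     M1.[s] * (s * (N2^`().[s] - eta (widen_ord hk j) * M2^`().[s]))); first by ring.
  by rewrite d1 d2; ring.
- by rewrite !(hornerD, hornerN, hornerZ, hornerM) ew subrr.
Qed.

(** The shape of a rational inner function into the symmetrized bidisc, of
    degree n, with components s = E / D and p = P / D: on the circle the two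
    reflection conditions say |p| = 1 and s = conj s * p. *)
Definition triple u D E P : Prop :=
  [/\ [/\ (size D <= n.+1)%N, (size E <= n.+1)%N & (size P <= n.+1)%N],
      `|u| = 1, P = u *: star n D & E = u *: star n E].

(** Together with pencilM, the numerator and denominator of (2 w p - s) / (2 -
    w s), which for |w| = 1 maps the symmetrized bidisc into the disc. *)
Definition pencilN E P w : {poly C} := (2 * w) *: P - E.
Definition pencilM D E w : {poly C} := 2 *: D - w *: E.

Lemma size_pencilN E P w : (size E <= n.+1)%N -> (size P <= n.+1)%N ->
  (size (pencilN E P w) <= n.+1)%N.
Proof.
move=> sE sP; rewrite (leq_trans (size_polyD _ _)) // geq_max size_polyN sE andbT.
by rewrite (leq_trans (size_scale_leq _ _)).
Qed.

Lemma size_pencilM D E w : (size D <= n.+1)%N -> (size E <= n.+1)%N ->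
  (size (pencilM D E w) <= n.+1)%N.
Proof.
move=> sD sE; rewrite (leq_trans (size_polyD _ _)) // geq_max size_polyN.
by rewrite !(leq_trans (size_scale_leq _ _)).
Qed.

Lemma star_pencil u D E P w : triple u D E P -> `|w| = 1 ->
  pencilN E P w = (u * w) *: star n (pencilM D E w).
Proof.
move=> [_ hu eP eE] hw.
rewrite /pencilN /pencilM -scaleNr starD !starZ scalerDr !scalerA.
have -> : u * w * (- w)^* = - u by rewrite rmorphN mulrN -mulrA circle_mulJ // mulr1.
have -> : u * w * 2^* = 2 * w * u by rewrite rmorph_nat; ring.
by rewrite scaleNr -eE [in LHS]eP scalerA.
Qed.

(** 4 p - s^2 cleared of denominators: its zeros are the royal nodes. *)
Definition royal_poly D E P : {poly C} := 4 *: (D * P) - E * E.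

Definition pencil_interp D E P : Prop :=
  interp (- E) (2 *: D) /\ interp (2 *: P) (- E).

Lemma pencil_interpW D E P w : pencil_interp D E P ->
  interp (pencilN E P w) (pencilM D E w).
Proof.
move=> [h1 h2]; have := interp_lin 1 w h1 h2.
by rewrite !scale1r scalerA addrC [w * 2]mulrC scalerN.
Qed.

Lemma pencil_interp_val D E P : pencil_interp D E P -> forall j,
  E.[sigma j] = - 2 * eta j * D.[sigma j] /\ P.[sigma j] = eta j ^+ 2 * D.[sigma j].
Proof.
move=> [[h1 _] [h2 _]] j; have := h1 j; have := h2 j; rewrite !(hornerD,
  hornerN, hornerZ, hornerM) => e2 e1.
have eE : E.[sigma j] = - 2 * eta j * D.[sigma j] by apply: oppr_inj; rewrite
  e1; ring.
split => //; apply: (@mulfI _ 2); first by rewrite pnatr_eq0.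
by rewrite e2 eE; ring.
Qed.

(** The royal polynomial is a multiple of its reflection of degree 2 n and
    vanishes at all nodes, doubly at those on the circle; a zero elsewhere is
    one too many. *)
Lemma royal_poly_eq0 u D E P w : triple u D E P -> pencil_interp D E P ->
  away w -> (royal_poly D E P).[w] = 0 -> royal_poly D E P = 0.
Proof.
move=> [[sD sE sP] hu eP eE] hi aw Rw.
have sz (p q : {poly C}) : (size p <= n.+1)%N -> (size q <= n.+1)%N ->
  (size (p * q)%R <= n.*2.+1)%N by rewrite -addnn; exact: size_mul_le.
have sP' : star n P = u^* *: D by rewrite eP starZ starK.
apply: (@selfinv_nodes_eq0 (u * u) _ w) => //.
- rewrite (leq_trans (size_polyD _ _)) // geq_max size_polyN.
  by rewrite (leq_trans (size_scale_leq _ _)) !sz.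
- rewrite /royal_poly -addnn -[- (E * E)]scaleN1r starD !starZ !starM // sP'.
  rewrite {1}eP {1 2}eE rmorphN rmorph1 rmorph_nat -!mul_polyC.
  have c1 : (u%:P : {poly C}) * (u^*)%:P = 1 by rewrite -polyCM circle_mulJ.
  rewrite !polyCN polyCM polyC1.
  transitivity (4%:P * (D * (u%:P * star n D)) * (u%:P * (u^*)%:P)
     + -1 * (u%:P * star n E * (u%:P * star n E))); last by ring.
  by rewrite c1 mulr1.
- move=> j; have [eE' eP'] := pencil_interp_val hi j; rewrite !(hornerD,
    hornerN, hornerZ, hornerM) eE' eP'; ring.
- move=> j; have [eE' eP'] := pencil_interp_val hi (widen_ord hk j).
  case: hi => [[_ d1] [_ d2]]; have := d1 j; have := d2 j => /= {}d2 {}d1.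
  move: d1 d2; rewrite ?(derivD, derivN, derivZ, derivM) !(hornerD, hornerN,
    hornerZ, hornerM) eE' eP'; set s := sigma _; set e := eta _ => d1 d2.
  have s0 : s != 0.
    by rewrite circle_neq0 //; case: (on_circle (j := widen_ord hk j)) => //=.
  apply: (mulfI s0).
  transitivity (4 * D.[s] * (s * (2 * P^`().[s] - e * - E^`().[s]) -
     e * (s * (- E^`().[s] - e * (2 * D^`().[s])))) / 2 ); first by field.
  by rewrite d1 d2; field.
Qed.

(** A common zero of numerator and denominator is a zero of the royal
    polynomial, hence a node or the mirror image of one. By reflection the
    denominator then vanishes at the node itself, where it is 2 D * (1 + w *
    eta j), so that |eta j| = 1. *)
Lemma common_zero u D E P w x : triple u D E P -> pencil_interp D E P ->
  royal_poly D E P != 0 -> (forall j, D.[sigma j] != 0) -> `|w| = 1 ->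
  (pencilN E P w).[x] = 0 -> (pencilM D E w).[x] = 0 ->
  exists j, [/\ x = sigma j \/ (sigma j)^* * x = 1, (j < k)%N & w = - (eta j)^*].
Proof.
move=> ht hi R0 D0 hw hN hM.
have w0 := circle_neq0 hw.
have Rx : (royal_poly D E P).[x] = 0.
  apply: (mulfI w0); move: hN hM; rewrite !(hornerD, hornerN, hornerZ, hornerM)
    => /eqP; rewrite subr_eq0 => /eqP eN.
  move=> /eqP; rewrite subr_eq0 => /eqP eM.
  transitivity ((2 * D.[x]) * (2 * w * P.[x]) - w * E.[x] * E.[x]); first by ring.
  by rewrite eN eM; ring.
have [j hj] : exists j, x = sigma j \/ (sigma j)^* * x = 1.
  apply: contrapT => nj; move/eqP: R0; apply; apply: (royal_poly_eq0 ht hi _ Rx) => j.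
  by split; apply/eqP => e; apply: nj; exists j; [left|right].
have Mj : (pencilM D E w).[sigma j] = 0.
  case: hj => [<- //|hj].
  have s0 : sigma j != 0.
    by apply: contra_eq_neq hj => ->; rewrite conjC0 mul0r eq_sym oner_eq0.
  have [[sD sE sP] hu eP eE] := ht.
  have eM : pencilM D E w = (u * w) *: star n (pencilN E P w).
    rewrite (star_pencil ht hw) starZ starK ?size_pencilM // scalerA rmorphM.
    by rewrite mulrACA !circle_mulJ // mulr1 scale1r.
  rewrite eM hornerZ horner_star ?size_pencilN //.
  have -> : ((sigma j)^*)^-1 = x.
    by apply: (mulfI (_ : (sigma j)^* != 0)); rewrite ?conjC_eq0 // hj mulfV //
      conjC_eq0.
  by rewrite hN conjC0 !mulr0.
exists j.
have [eE eP] := pencil_interp_val hi j.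
have : 2 * D.[sigma j] * (1 + w * eta j) = 0.
  by rewrite -[RHS]Mj !(hornerD, hornerN, hornerZ, hornerM) eE; ring.
move/eqP; rewrite !mulf_eq0 pnatr_eq0 (negPf (D0 j)) /= addrC addr_eq0 => /eqP e1.
have n1 : `|eta j| = 1.
  by have := congr1 Num.norm e1; rewrite normrM hw mul1r normrN1.
have jk : (j < k)%N.
  by case: (ltnP j k) => // /in_disc[_]; rewrite n1 ltxx.
split => //.
by rewrite -[LHS]mulr1 -(circle_mulJ n1) mulrA e1 mulN1r.
Qed.

End Nodes.

(** N2 / M2 arises from the reduced fraction N1 / M1 by a common factor, which
    is constant because N1 / M1 already has degree n. *)
Lemma proportional (C : closedFieldType) n (N1 M1 N2 M2 : {poly C}) :
  coprimep N1 M1 -> maxn (size N1).-1 (size M1).-1 = n ->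
  (size N2 <= n.+1)%N -> (size M2 <= n.+1)%N -> M2 != 0 ->
  N1 * M2 = N2 * M1 -> exists2 q, q != 0 & N2 = q *: N1 /\ M2 = q *: M1.
Proof.
move=> cop smax sN2 sM2 M20 e.
have M10 : M1 != 0.
  apply: contraTneq cop => M10; move: e; rewrite M10 mulr0 => /eqP.
  rewrite mulf_eq0 (negPf M20) orbF => /eqP ->.
  by rewrite coprimep0 -size_poly_eq1 size_poly0.
have : M1 %| M2.
  have cs : coprimep M1 N1 by rewrite coprimep_sym.
  by rewrite -(Gauss_dvdpr _ cs) e dvdp_mull.
case/dvdpP => K eK.
have eN : N2 = K * N1.
  by apply: (mulIf M10); rewrite -e eK mulrA [N1 * K]mulrC.
have K0 : K != 0 by apply: contraNneq M20; rewrite eK => ->; rewrite mul0r.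
have sK : (size K <= 1)%N.
  have aux (A : {poly C}) : A != 0 -> (size A).-1 = n -> (size (K * A)%R <=
    n.+1)%N -> (size K <= 1)%N.
    move=> A0 <-; rewrite prednK ?size_poly_gt0 // size_mul //.
    by case: (size K) => // m; rewrite addSn /= -{2}[size A]add0n leq_add2r.
  case: (leqP (size N1).-1 (size M1).-1) smax => [h|h].
    by move=> hM; apply: (aux M1); rewrite -?eK.
  move=> hN; apply: (aux N1); rewrite -?eN //.
  by apply: contraTneq h => ->; rewrite size_poly0.
have eKc := size1_polyC sK; exists K`_0.
  by apply: contraNneq K0; rewrite {2}eKc => ->.
by rewrite -!mul_polyC -eKc.
Qed.

(** * Change of parameter in a pencil *)

Section Moebius.
Variable C : numClosedFieldType.
Variables (s0 p0 : C).
Hypothesis s0_lt : `|s0| < 2.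
Hypothesis p0_1 : `|p0| = 1.
Hypothesis s0E : s0 = s0^* * p0.
Implicit Types (z w kap : C) (D E P a b c d : {poly C}).

(** A point of the royal variety with |p0| = 1 would have |s0| = 2. *)
Lemma discr_neq0 : 4 * p0 - s0 ^+ 2 != 0.
Proof.
rewrite subr_eq0; apply/eqP => /(congr1 Num.norm).
rewrite normrM normr_nat p0_1 mulr1 normrX => h.
have : `|s0| ^+ 2 < 2 ^+ 2 by rewrite ltr_pXn2r // -?topredE //= ?normr_ge0 ?ler0n.
rewrite -h (_ : 2 ^+ 2 = 4 :> C) ?ltxx //.
by rewrite expr2 -natrM.
Qed.

Lemma two_sub_neq0 w : `|w| = 1 -> 2 - w * s0 != 0.
Proof.
move=> hw; rewrite subr_eq0; apply/eqP => /(congr1 Num.norm).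
by rewrite normr_nat normrM hw mul1r => h; move: s0_lt; rewrite -h ltxx.
Qed.

Lemma s0_mobius_neq0 z : `|z| = 1 -> s0 * z + 2 * p0 != 0.
Proof.
move=> hz; rewrite addr_eq0; apply/eqP => /(congr1 Num.norm).
by rewrite normrN !normrM hz p0_1 !mulr1 normr_nat => h; move: s0_lt; rewrite h ltxx.
Qed.

(** The equation says z = (2 w p0 - s0) / (2 - w s0), the value of the member
    w of the pencil at a point where s = s0 and p = p0. This is the change of
    parameter that normalises the pencil at such a point; it preserves the
    circle as s0 = conj s0 * p0. *)
Lemma param_of_pencil w : `|w| = 1 ->
  exists2 z, `|z| = 1 & w * (s0 * z + 2 * p0) = 2 * z + s0.
Proof.
move=> hw; have n0 := two_sub_neq0 hw.
have e : 2 * w * p0 - s0 = p0 * w * (2 - w * s0)^*.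
  rewrite rmorphD rmorphN rmorphM rmorph_nat /= [in LHS]s0E.
  transitivity (p0 * (2 * w - s0^* * (w * w^*))); last by ring.
  by rewrite circle_mulJ //; ring.
exists ((2 * w * p0 - s0) / (2 - w * s0)); last by field.
by rewrite normf_div e !normrM p0_1 hw !mul1r norm_conjC divff // normr_eq0.
Qed.

Lemma pencil_of_param z : `|z| = 1 ->
  exists2 w, `|w| = 1 & w * (s0 * z + 2 * p0) = 2 * z + s0.
Proof.
move=> hz; have n0 := s0_mobius_neq0 hz.
have e : s0 * z + 2 * p0 = p0 * z * (2 * z + s0)^*.
  rewrite rmorphD rmorphM rmorph_nat /= [in LHS]s0E.
  transitivity (p0 * (s0^* * z + 2 * (z * z^*))); last by ring.
  by rewrite circle_mulJ //; ring.
exists ((2 * z + s0) / (s0 * z + 2 * p0)); last by field.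
rewrite normf_div e !normrM p0_1 hz !mul1r norm_conjC divff // normr_eq0.
by apply: contraNneq n0 => h; rewrite e h conjC0 mulr0.
Qed.

(** The coefficients of the pencil with respect to the new parameter, up to
    the common factor kap that the normalisation determines. *)
Definition par_a kap E P : {poly C} := kap *: (4 *: P - s0 *: E).
Definition par_b kap E P : {poly C} := kap *: ((2 * s0) *: P - (2 * p0) *: E).
Definition par_c kap D E : {poly C} := kap *: ((2 * s0) *: D - 2 *: E).
Definition par_d kap D E : {poly C} := kap *: ((4 * p0) *: D - s0 *: E).

Lemma par_num kap E P z w : w * (s0 * z + 2 * p0) = 2 * z + s0 ->
  z *: par_a kap E P + par_b kap E P = (kap * (s0 * z + 2 * p0)) *: pencilN E P w.
Proof.
move=> h; apply/polyP => i; rewrite !(coefD, coefN, coefZ).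
transitivity (kap * (2 * P`_i * (2 * z + s0) - E`_i * (s0 * z + 2 * p0)));
  first by ring.
by rewrite -h; ring.
Qed.

Lemma par_den kap D E z w : w * (s0 * z + 2 * p0) = 2 * z + s0 ->
  z *: par_c kap D E + par_d kap D E = (kap * (s0 * z + 2 * p0)) *: pencilM D E w.
Proof.
move=> h; apply/polyP => i; rewrite !(coefD, coefN, coefZ).
transitivity (kap * (2 * D`_i * (s0 * z + 2 * p0) - E`_i * (2 * z + s0)));
  first by ring.
by rewrite -h; ring.
Qed.

Lemma par_relation kap D E P :
  s0 *: par_a kap E P - 2 *: par_b kap E P + (2 * p0) *: par_c kap D E
    - s0 *: par_d kap D E = 0.
Proof. by apply/polyP => i; rewrite !(coefD, coefN, coefZ) coef0; ring. Qed.

(** Up to a scalar factor, this and the next two definitions invert par_a,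
    par_b, par_c and par_d. *)
Definition inv_D c d : {poly C} := 2 *: d - s0 *: c.
Definition inv_E c d : {poly C} := 2 *: (s0 *: d - (2 * p0) *: c).
Definition inv_P a b : {poly C} := (2 * p0) *: a - s0 *: b.

(** The linear relation identifies s0 a - 2 b with s0 d - 2 p0 c, so that the
    same E occurs in the numerator and in the denominator of the pencil. *)
Lemma inv_num a b c d z w : w * (s0 * z + 2 * p0) = 2 * z + s0 ->
  s0 *: a - 2 *: b + (2 * p0) *: c - s0 *: d = 0 ->
  pencilN (inv_E c d) (inv_P a b) w = (2 * (2 - w * s0)) *: (z *: a + b).
Proof.
move=> h hrel; apply/polyP => i; have := congr1 (fun F : {poly C} => F`_i) hrel.
rewrite !(coefD, coefN, coefZ) coef0 => hi.
transitivity (2 * a`_i * (2 * w * p0 - s0) + 2 * b`_i * (2 - w * s0)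
   + 2 * (s0 * a`_i - 2 * b`_i + 2 * p0 * c`_i - s0 * d`_i)); first by ring.
have -> : 2 * w * p0 - s0 = z * (2 - w * s0).
  apply/eqP; rewrite -subr_eq0; apply/eqP.
  transitivity (w * (s0 * z + 2 * p0) - (2 * z + s0)); first by ring.
  by rewrite h subrr.
by rewrite hi; ring.
Qed.

Lemma inv_den c d z w : w * (s0 * z + 2 * p0) = 2 * z + s0 ->
  pencilM (inv_D c d) (inv_E c d) w = (2 * (2 - w * s0)) *: (z *: c + d).
Proof.
move=> h; apply/polyP => i; rewrite !(coefD, coefN, coefZ).
transitivity (2 * c`_i * (2 * w * p0 - s0) + 2 * d`_i * (2 - w * s0)); first by ring.
have -> : 2 * w * p0 - s0 = z * (2 - w * s0).
  apply/eqP; rewrite -subr_eq0; apply/eqP.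
  transitivity (w * (s0 * z + 2 * p0) - (2 * z + s0)); first by ring.
  by rewrite h subrr.
by ring.
Qed.

(** Reflection exchanges a with d and b with c. Thus the reflection of E is a
    combination of a and b, and the linear relation turns it back into E. *)
Lemma inv_triple n t a b c d : `|t| = 1 ->
  (size a <= n.+1)%N -> (size b <= n.+1)%N -> (size c <= n.+1)%N -> (size d <=
    n.+1)%N ->
  a = t *: star n d -> b = t *: star n c ->
  s0 *: a - 2 *: b + (2 * p0) *: c - s0 *: d = 0 ->
  triple n (p0 * t) (inv_D c d) (inv_E c d) (inv_P a b).
Proof.
move=> t1 sa sb sc sd ea eb hrel.
have szl (x y : C) (F G : {poly C}) : (size F <= n.+1)%N -> (size G <= n.+1)%N ->
    (size (x *: F - y *: G)%R <= n.+1)%N.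
  move=> sF sG; rewrite (leq_trans (size_polyD _ _)) // geq_max size_polyN.
  by rewrite !(leq_trans (size_scale_leq _ _)).
have ps : p0 * s0^* = s0 by rewrite mulrC -s0E.
split.
- by split; rewrite ?(leq_trans (size_scale_leq _ _)) ?szl.
- by rewrite normrM p0_1 t1 mulr1.
- rewrite /inv_D /inv_P -!scaleNr starD !starZ scalerDr ea eb !scalerA.
  have -> : p0 * t * 2^* = 2 * p0 * t by rewrite rmorph_nat; ring.
  have -> : p0 * t * (- s0)^* = - (p0 * s0^*) * t by rewrite rmorphN; ring.
  by rewrite ps !mulNr.
- have hE' : inv_E c d = 2 *: (s0 *: a - 2 *: b).
    apply/eqP; rewrite -subr_eq0; apply/eqP; rewrite -(scaler0 _ (- 2)) -hrel.
    by apply/polyP => i; rewrite /inv_E !(coefD, coefN, coefZ); ring.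
  rewrite {1}hE' /inv_E -!scaleNr !(starD, starZ) ea eb !(scalerDr, scalerN) !scalerA.
  rewrite !(rmorphN, rmorphM, rmorph_nat) /=.
  have -> : p0 * t * 2 * s0^* = 2 * (p0 * s0^*) * t by ring.
  have -> : p0 * t * 2 * (- 2 * p0^*) = - (2 * 2 * t * (p0 * p0^*)) by ring.
  by rewrite ps circle_mulJ // mulr1; congr (_ *: _ + _ *: _); ring.
Qed.

End Moebius.

(** * Continuity and differentiability in the complex plane *)

Section Topology.
Variable R : realType.
Local Notation C := (Cx R).
Implicit Types (z w : C) (P Q M N F : {poly C}) (r t u : R).

Definition re (z : C) : R := complex.Re z.
Definition im (z : C) : R := complex.Im z.

Lemma lt_toC r t : (toC r < toC t) = (r < t). Proof. exact: ltcR. Qed.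
Lemma le_toC r t : (toC r <= toC t) = (r <= t). Proof. exact: lecR. Qed.
Lemma toC0 : toC 0 = 0 :> C. Proof. by []. Qed.
Lemma toC1 : toC 1 = 1 :> C. Proof. by []. Qed.
Lemma toC_ge0 r : (0 <= toC r) = (0 <= r). Proof. exact: lecR. Qed.
Lemma toC_gt0 r : (0 < toC r) = (0 < r). Proof. exact: ltcR. Qed.
Lemma toC_real r : toC r \is Num.real. Proof. by rewrite realE !lecE /= eqxx;
  exact: num_real. Qed.
Lemma toC2 : toC 2 = 2 :> C. Proof. exact: rmorph_nat. Qed.
Lemma toC_inj : injective (@toC R). Proof. exact: complexI. Qed.
Lemma toCM r t : toC (r * t) = toC r * toC t. Proof. exact: rmorphM. Qed.
Lemma toCD r t : toC (r + t) = toC r + toC t. Proof. exact: rmorphD. Qed.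
Lemma toCN r : toC (- r) = - toC r. Proof. exact: rmorphN. Qed.
Lemma toC_gt0E (e : C) : 0 < e -> exists2 r, 0 < r & e = toC r.
Proof.
case: e => a b; rewrite ltcE /= => /andP[/eqP -> ha]; exists a => //.
Qed.

Lemma norm_toC r : `|toC r : C| = toC `|r|.
Proof. by rewrite /toC normc_def /= expr0n addr0 sqrtr_sqr. Qed.

Lemma Re_norm_le z : toC `|re z| <= `|z|.
Proof. exact: normc_ge_Re. Qed.

Lemma Im_norm_le z : toC `|im z| <= `|z|.
Proof.
have n1 : `|Complex 0 1 : C| = 1.
  by rewrite [LHS]normc_def /= expr0n expr1n add0r sqrtr1.
rewrite -[`|z|]mulr1 -n1 -normrM -[im z]opprK -(ReiNIm z) normrN.
exact: Re_norm_le.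
Qed.

Lemma near_dist (K : numFieldType) (z e : K) : 0 < e -> \forall w \near z, `|z
  - w| < e.
Proof. by move=> e0; apply/nbhs_normP; exists e. Qed.

Lemma continuous_Re : continuous (fun z : C => re z).
Proof.
move=> z; have FF : Filter (nbhs z) := nbhs_filter z; apply/cvgrPdist_lt => e e0.
have : \forall w \near z, `|z - w| < toC e.
  by apply: near_dist; rewrite -toC0 lt_toC.
apply: filterS => w h; rewrite -lt_toC.
by apply: le_lt_trans h; rewrite -raddfB; exact: Re_norm_le.
Qed.

Lemma continuous_Im : continuous (fun z : C => im z).
Proof.
move=> z; have FF : Filter (nbhs z) := nbhs_filter z; apply/cvgrPdist_lt => e e0.
have : \forall w \near z, `|z - w| < toC e.
  by apply: near_dist; rewrite -toC0 lt_toC.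
apply: filterS => w h; rewrite -lt_toC.
by apply: le_lt_trans h; rewrite -raddfB; exact: Im_norm_le.
Qed.

Lemma continuous_toC : continuous (fun r : R => toC r).
Proof.
move=> z; apply/cvgrPdist_lt => e /toC_gt0E[r r0 ->].
have : \forall w \near z, `|z - w| < r by apply: near_dist.
by apply: filterS => w h; rewrite -toCN -toCD norm_toC lt_toC.
Qed.

Lemma toC_ReIm z : z = toC (re z) + (Complex 0 1 : C) * toC (im z).
Proof. exact: complexE. Qed.

Lemma cvg_ReIm (T : Type) (F : set_system T) {FF : Filter F} (f : T -> C) (l : C) :
  re (f x) @[x --> F] --> re l ->
  im (f x) @[x --> F] --> im l ->
  f x @[x --> F] --> l.
Proof.
move=> hR hI; rewrite [l]toC_ReIm.
have -> : f = fun x => toC (re (f x)) + (Complex 0 1 : C) * toC (im (f x)).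
  by apply/funext => x; rewrite -toC_ReIm.
apply: cvgD; first by apply: continuous_cvg; [exact: continuous_toC|].
by apply: cvgMr; apply: continuous_cvg; [exact: continuous_toC|].
Qed.

Lemma continuous_ReIm (T : topologicalType) (f : T -> C) :
  continuous (fun x => re (f x)) -> continuous (fun x => im (f x)) -> continuous f.
Proof. by move=> hr hi x; apply: (@cvg_ReIm _ _ (nbhs_filter x)); [exact:
  hr|exact: hi]. Qed.

Lemma continuous_conj : continuous (fun z : C => z^*).
Proof.
apply: continuous_ReIm.
  by rewrite (_ : (fun x : C => re x^*) = re); [exact:
    continuous_Re|apply/funext; case].
rewrite (_ : (fun x : C => im x^*) = (fun x => - im x)); last by apply/funext; case.
by move=> z; exact: (cvgN (@continuous_Im z)).
Qed.

Lemma continuous_expi : continuous (@expi R).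
Proof.
apply: continuous_ReIm => t; [exact: continuous_cos|exact: continuous_sin].
Qed.

Lemma continuous_poly P : continuous (fun z : C => P.[z]).
Proof.
elim/poly_ind: P => [|P c IH] z.
  rewrite (_ : (fun z => _) = fun=> 0); last by apply/funext => x; rewrite horner0.
  exact: cst_continuous.
rewrite (_ : (fun z => _) = fun z => P.[z] * z + c); last first.
  by apply/funext => x; rewrite !hornerE.
exact: (cvgD (cvgM (IH z) cvg_id) (cvg_cst c)).
Qed.

Definition normsq z : R := re z ^+ 2 + im z ^+ 2.

Lemma normsqE z : toC (normsq z) = `|z| ^+ 2.
Proof. exact: add_Re2_Im2. Qed.

Lemma continuous_normsq : continuous normsq.
Proof.
move=> z; rewrite (_ : normsq = (fun z => re z * re z + im z * im z)).
  exact: (cvgD (cvgM (@continuous_Re z) (@continuous_Re z))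
               (cvgM (@continuous_Im z) (@continuous_Im z))).
by apply/funext => w; rewrite /normsq !expr2.
Qed.

Lemma is_derive_horner P z : is_derive z (1 : C) (fun w : C => P.[w]) P^`().[z].
Proof.
elim/poly_ind: P => [|P c IH].
  rewrite (_ : (fun z => _) = cst 0); last by apply/funext => x; rewrite horner0.
  by rewrite deriv0 horner0; exact: is_derive_cst.
rewrite (_ : (fun z => _) = (fun z => P.[z]) * id + cst c); last first.
  by apply/funext => x; rewrite !hornerE.
apply: is_derive_eq.
rewrite derivD derivC !addr0 derivM derivX mulr1 hornerD hornerMX.
by rewrite /GRing.scale /= mulr1 addrC mulrC.
Qed.

Lemma derivable_quotient N M z : M.[z] != 0 ->
  derivable (fun w : C => N.[w] / M.[w]) z 1.
Proof.
move=> hM; apply: derivableM; first by case: (is_derive_horner N z).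
by apply: derivableV => //; case: (is_derive_horner M z).
Qed.

End Topology.

(** * The unit circle, limits along segments and arcs *)

Section Circle.
Variable R : realType.
Local Notation C := (Cx R).
Implicit Types (z w : C) (P Q M N F : {poly C}) (r t u e : R).

Lemma expi0 : expi 0 = 1 :> C.
Proof. by rewrite /expi cos0 sin0. Qed.

Lemma expiD t u : expi (t + u) = expi t * expi u :> C.
Proof. by rewrite /expi cosD sinD; congr Complex; rewrite addrC. Qed.

Lemma conj_expi t : (expi t : C)^* = expi (- t).
Proof. by rewrite /expi cosN sinN. Qed.

Lemma norm_expi t : `|expi t : C| = 1.
Proof. by rewrite /expi [LHS]normc_def /= cos2Dsin2 sqrtr1. Qed.

Lemma normsq_circle z : `|z| = 1 -> re z ^+ 2 + im z ^+ 2 = 1.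
Proof. by move=> hz; apply: toC_inj; rewrite [toC _]normsqE hz expr1n. Qed.

Lemma circle_expi z : `|z| = 1 -> exists t, z = expi t.
Proof.
move=> /normsq_circle; case: z => x y; rewrite /re /im /= => h.
have hx : -1 <= x <= 1.
  by rewrite -ler_norml -(expr_le1 (n := 2)) // real_normK ?num_real // -h
    lerDl sqr_ge0.
have ey : 1 - x ^+ 2 = y ^+ 2 by rewrite -h; ring.
have hx' : x \in `[-1, 1] by rewrite in_itv /= hx.
have [y0|y0] := leP 0 y.
  by exists (acos x); rewrite /expi acosK // sin_acos // ey sqrtr_sqr ger0_norm.
exists (- acos x); rewrite /expi cosN sinN acosK // sin_acos // ey sqrtr_sqr.
by rewrite ltr0_norm // opprK.
Qed.

Lemma near_right_neq (a : R) : \forall e \near 0^'+, e != a.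
Proof.
have [a0|a0] := ltP 0 a.
  by near=> e; apply/eqP => ea; have : e < a by []; rewrite ea ltxx.
by near=> e; apply/eqP => ea; have : 0 < e by []; rewrite ea ltNge a0.
Unshelve. all: by end_near. Qed.

Lemma near_expi_neq w z : `|w| = 1 -> \forall e \near (0 : R)^'+, w * expi e != z.
Proof.
move=> hw; have w0 := circle_neq0 hw.
near=> e; apply/eqP => ez.
have e_neq : e != acos (re (w^-1 * z)) by near: e; exact: near_right_neq.
move/eqP: e_neq; apply; rewrite -ez mulKf // /expi /re /= cosK // in_itv /=.
have -> : 0 <= e by [].
by rewrite andTb ltW //; near: e; apply: nbhs_right_lt; exact: pi_gt0.
Unshelve. all: by end_near. Qed.

Definition segment z q e : C := z + toC e * (q - z).

Lemma near_segment_neq z q y : q != z -> \forall e \near (0 : R)^'+, segment z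
  q e != y.
Proof.
move=> qz; near=> e; apply/eqP => ez.
have e_neq : e != re ((y - z) * (q - z)^-1) by near: e; exact: near_right_neq.
move/eqP: e_neq; apply; rewrite -ez /segment addrAC subrr add0r mulfK //.
by rewrite subr_eq0.
Unshelve. all: by end_near. Qed.

Lemma near_notin (g : R -> C) (s : seq C) :
  (forall y, \forall e \near (0 : R)^'+, g e != y) -> \forall e \near (0 :
    R)^'+, g e \notin s.
Proof.
move=> h; elim: s => [|y s IH]; first by near=> e; rewrite in_nil.
near=> e; rewrite inE negb_or; apply/andP; split; near: e; [exact: h|exact: IH].
Unshelve. all: by end_near. Qed.

Lemma poly_roots F : F != 0 -> exists s : seq C, forall x, F.[x] = 0 -> x \in s.
Proof.
move=> F0; have [s eF] := closed_field_poly_normal F.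
exists s => x Fx; have : root F x by exact/rootP.
by rewrite eF rootZ ?lead_coef_eq0 // root_prod_XsubC.
Qed.

Lemma near_poly_neq0 (g : R -> C) F : F != 0 ->
  (forall y, \forall e \near (0 : R)^'+, g e != y) -> \forall e \near (0 :
    R)^'+, F.[g e] != 0.
Proof.
move=> /poly_roots[s hs] /(near_notin s) h; near=> e.
have : g e \notin s by near: e.
by apply: contraNneq; exact: hs.
Unshelve. all: by end_near. Qed.

Lemma near_poly_expi_neq0 F : F != 0 -> \forall e \near (0 : R)^'+, F.[expi e] != 0.
Proof.
move=> F0; apply: near_poly_neq0 => // y.
have := near_expi_neq y (normr1 C); apply: filterS => e.
by rewrite mul1r.
Qed.

Lemma poly_circle_eq0 F : (forall z, `|z| = 1 -> F.[z] = 0) -> F = 0.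
Proof.
move=> h; apply/eqP; apply: contraT => F0.
have [e] := @filter_ex _ _ (at_right_proper_filter _) _ (near_poly_expi_neq0 F0).
by rewrite h ?norm_expi // eqxx.
Qed.

Lemma right_limit_ge0 (g : R -> R) : {for 0, continuous g} ->
  (\forall e \near 0^'+, 0 <= g e) -> 0 <= g 0.
Proof.
move=> cg hg; rewrite leNgt; apply/negP => g0.
have h : \forall e \near 0^'+, g e < 0.
  have h0 : \forall e \near nbhs 0, g e < 0.
    exact: (@cvgr_lt _ _ _ (nbhs_filter 0) g (g 0) cg).
  exact: (@cvg_within _ (nbhs 0) (nbhs_filter 0) _ _ h0).
have [e []] := @filter_ex _ _ (at_right_proper_filter _) _ (filterI hg h).
by rewrite leNgt => /negP.
Qed.

(** A point of the closed disc is approached along the segment to some other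
    point of the open disc, and this segment contains only finitely many zeros
    of M. *)
Lemma disc_closure_ge0 (g : C -> R) M : continuous g -> M != 0 ->
  (forall z, `|z| < 1 -> M.[z] != 0 -> 0 <= g z) -> forall z, `|z| <= 1 -> 0 <= g z.
Proof.
move=> cg M0 hg z hz.
have [q qz hq] : exists2 q : C, q != z & `|q| < 1.
  have [->|z0] := eqVneq z 0; last by exists 0; rewrite ?normr0 ?ltr01 // eq_sym.
  exists (2^-1); first by rewrite invr_eq0 pnatr_eq0.
  by rewrite normfV normr_nat invf_lt1 ?ltr1n ?ltr0n.
have -> : z = segment z q 0 by rewrite /segment toC0 mul0r addr0.
apply: (@right_limit_ge0 (fun e => g (segment z q e))).
  apply: continuous_comp; last exact: cg.
  by apply: (cvgD (cvg_cst _)); apply: (cvgM (@continuous_toC R 0) (cvg_cst _)).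
have := near_poly_neq0 M0 (fun y => near_segment_neq y qz); move=> hM.
near=> e; apply: hg; last by near: e.
have e0 : 0 < e by [].
have e1 : e < 1 by near: e; exact: nbhs_right_lt.
rewrite /segment (_ : _ + _ = toC (1 - e) * z + toC e * q); last first.
  by rewrite toCD toCN toC1; ring.
apply: le_lt_trans (ler_normD _ _) _; rewrite !normrM !norm_toC.
have e1' : 0 < 1 - e by rewrite subr_gt0.
rewrite (gtr0_norm e0) (gtr0_norm e1').
have -> : (1 : C) = toC (1 - e) * 1 + toC e * 1 by rewrite toCD toCN toC1; ring.
apply: ler_ltD; first by rewrite ler_wpM2l // toC_ge0 subr_ge0 ltW.
by rewrite ltr_pM2l // toC_gt0.
Unshelve. all: by end_near. Qed.

Lemma circle_closure_ge0 (g : C -> R) (L : seq C) : continuous g ->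
  (forall w, `|w| = 1 -> w \notin L -> 0 <= g w) -> forall w, `|w| = 1 -> 0 <= g w.
Proof.
move=> cg hg w hw; rewrite -[w]mulr1 -expi0.
apply: (@right_limit_ge0 (fun e => g (w * expi e))).
  apply: continuous_comp; last exact: cg.
  by apply: (cvgM (cvg_cst _)); exact: continuous_expi.
have h := near_notin L (fun y => near_expi_neq y hw).
near=> e; apply: hg; first by rewrite normrM hw norm_expi mulr1.
by near: e.
Unshelve. all: by end_near. Qed.

(** Otherwise an interval of length d would be negligible. *)
Lemma ae_near0 (Q : R -> Prop) : {ae (@lebesgue_measure R), forall t, Q t} ->
  forall d, 0 < d -> exists2 t, 0 < t < d & Q t.
Proof.
move=> hQ d d0; apply: contrapT => nt.
have hsub : [set` `]0, d[] `<=` ~` Q.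
  by move=> t /=; rewrite in_itv /= => td Qt; apply: nt; exists t.
case: hQ => B [mB B0 sB].
pose I : set R := [set` `]0, d[].
have : (@lebesgue_measure R I <= @lebesgue_measure R B)%E.
  by apply: le_measure; rewrite ?inE; [exact: measurable_itv|exact: mB|exact:
    subset_trans hsub sB].
rewrite B0 /I lebesgue_measure_itv /= lte_fin d0 -EFinB subr0 lee_fin leNgt d0.
by [].
Qed.

(** Parameters t with Q t accumulate at 0, but a nonzero polynomial does not
    vanish at expi t for small positive t. *)
Lemma poly_ae_eq0 (Q : R -> Prop) F : {ae (@lebesgue_measure R), forall t, Q t} ->
  (forall t, Q t -> F.[expi t] = 0) -> F = 0.
Proof.
move=> hQ hF; apply/eqP; apply: contraT => F0.
have [d /= d0 hd] := near_poly_expi_neq0 F0.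
have [t /andP[t0 td] /hF Ft] := ae_near0 hQ d0.
have := hd t; rewrite /= sub0r normrN gtr0_norm // Ft eqxx => /(_ td t0).
by [].
Qed.

End Circle.

(** * Derivatives along the circle and the phasar derivative *)

Section Curves.
Variable R : realType.
Local Notation C := (Cx R).
Implicit Types (z w : C) (P Q M N F : {poly C}) (r t u e : R) (f g : R -> C).

Definition ii : C := Complex 0 1.

Lemma iiE t : ii * toC t = Complex 0 t.
Proof. by rewrite /ii /toC; congr Complex; rewrite /=; ring. Qed.

Definition cderiv f t (a : C) : Prop :=
  is_derive t (1 : R) (fun u => re (f u)) (re a) /\
  is_derive t (1 : R) (fun u => im (f u)) (im a).

Lemma reM z w : re (z * w) = re z * re w - im z * im w.
Proof. by case: z; case: w. Qed.
Lemma imM z w : im (z * w) = re z * im w + im z * re w.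
Proof. by case: z => a b; case: w => c d. Qed.
Lemma reD z w : re (z + w) = re z + re w. Proof. by case: z; case: w. Qed.
Lemma imD z w : im (z + w) = im z + im w. Proof. by case: z; case: w. Qed.
Lemma reim_inj z w : re z = re w -> im z = im w -> z = w.
Proof. by case: z => a b; case: w => c d /= -> ->. Qed.

Lemma unit_re_im z : `|z| = 1 -> 0 < re z -> -1 < im z < 1.
Proof.
move=> /normsq_circle h r0; rewrite -ltr_norml -(expr_lt1 (n := 2)) //
  real_normK ?num_real //.
by rewrite -h ltrDr exprn_gt0.
Qed.

Lemma expi_asin z : `|z| = 1 -> 0 < re z -> expi (asin (im z)) = z.
Proof.
move=> z1 r0; have /andP[h1 h2] := unit_re_im z1 r0.
have hI : -1 <= im z <= 1 by rewrite !ltW.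
apply: reim_inj; rewrite /re /im /= -/(re z) -/(im z); last by rewrite asinK //
  in_itv /= hI.
rewrite cos_asin // (_ : 1 - _ = re z ^+ 2); last by rewrite -(normsq_circle
  z1) addrK.
by rewrite sqrtr_sqr gtr0_norm.
Qed.

Lemma cderiv_cst z t : cderiv (fun=> z) t 0.
Proof. by split; exact: is_derive_cst. Qed.

Lemma cderivD f g t a b : cderiv f t a -> cderiv g t b ->
  cderiv (fun u => f u + g u) t (a + b).
Proof.
move=> [f1 f2] [g1 g2]; split; rewrite (reD, imD).
  rewrite (_ : (fun u => _) = (fun u => re (f u)) + (fun u => re (g u))).
    exact: is_deriveD.
  by apply/funext => u; rewrite reD.
rewrite (_ : (fun u => _) = (fun u => im (f u)) + (fun u => im (g u))).
  exact: is_deriveD.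
by apply/funext => u; rewrite imD.
Qed.

Lemma cderivM f g t a b : cderiv f t a -> cderiv g t b ->
  cderiv (fun u => f u * g u) t (f t * b + g t * a).
Proof.
move=> [f1 f2] [g1 g2]; split.
  rewrite (_ : (fun u => _) = (fun u => re (f u)) * (fun u => re (g u)) -
     (fun u => im (f u)) * (fun u => im (g u))); last first.
    by apply/funext => u; rewrite reM.
  apply: (is_derive_eq (is_deriveB (is_deriveM f1 g1) (is_deriveM f2 g2))).
  rewrite reD !reM /GRing.scale /=; ring.
rewrite (_ : (fun u => _) = (fun u => re (f u)) * (fun u => im (g u)) +
     (fun u => im (f u)) * (fun u => re (g u))); last first.
  by apply/funext => u; rewrite imM.
apply: (is_derive_eq (is_deriveD (is_deriveM f1 g2) (is_deriveM f2 g1))).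
rewrite imD !imM /GRing.scale /=; ring.
Qed.

Lemma cderiv_expi_comp (psi : R -> R) t r : is_derive t (1 : R) psi r ->
  cderiv (fun u => expi (psi u)) t (ii * toC r * expi (psi t)).
Proof.
move=> hpsi; rewrite iiE; split; rewrite /re /im /=.
  have := is_derive1_comp (is_derive_cos (psi t)) hpsi.
  by move=> h; apply: (is_derive_eq h); rewrite ?/GRing.scale /=; ring.
have := is_derive1_comp (is_derive_sin (psi t)) hpsi.
by move=> h; apply: (is_derive_eq h); rewrite ?/GRing.scale /=; ring.
Qed.

Lemma cderiv_expi t : cderiv (@expi R) t (ii * expi t).
Proof.
have := cderiv_expi_comp (is_derive_id t (1 : R)).
by rewrite toC1 mulr1.
Qed.

Lemma cderiv_eq f t a b : cderiv f t a -> a = b -> cderiv f t b.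
Proof. by move=> h <-. Qed.

Lemma cderiv_poly P t :
  cderiv (fun u => P.[expi u]) t (ii * expi t * P^`().[expi t]).
Proof.
elim/poly_ind: P => [|P c IH].
  rewrite (_ : (fun u => _) = fun=> 0); last by apply/funext => u; rewrite horner0.
  by rewrite deriv0 horner0 mulr0; exact: cderiv_cst.
rewrite (_ : (fun u => _) = fun u => P.[expi u] * expi u + c); last first.
  by apply/funext => u; rewrite hornerMXaddC.
apply: cderiv_eq; first exact: cderivD (cderivM IH (cderiv_expi t)) (cderiv_cst c t).
rewrite derivD derivC derivM derivX mulr1 !addr0 hornerD hornerMX; ring.
Qed.

Lemma cderiv_unique f g t a b : (\forall u \near t, f u = g u) ->
  cderiv f t a -> cderiv g t b -> a = b.
Proof.
move=> fg [f1 f2] [g1 g2]; apply: reim_inj.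
  have h : is_derive t (1 : R) (fun u => re (g u)) (re a).
    by apply: near_eq_is_derive f1; apply: filterS fg => u ->.
  exact: etrans (esym (@derive_val _ _ _ _ _ _ _ h)) (@derive_val _ _ _ _ _ _ _ g1).
have h : is_derive t (1 : R) (fun u => im (g u)) (im a).
  by apply: near_eq_is_derive f2; apply: filterS fg => u ->.
exact: etrans (esym (@derive_val _ _ _ _ _ _ _ h)) (@derive_val _ _ _ _ _ _ _ g2).
Qed.

Lemma cderiv_ex f t : derivable (fun u => re (f u)) t 1 ->
  derivable (fun u => im (f u)) t 1 -> exists a, cderiv f t a.
Proof.
move=> h1 h2; exists (Complex ('D_1 (fun u => re (f u)) t) ('D_1 (fun u => im
  (f u)) t)).
by split; [exact: (DeriveDef h1 erefl)|exact: (DeriveDef h2 erefl)].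
Qed.

Lemma cderiv_derivable f t a : cderiv f t a ->
  derivable (fun u => re (f u)) t 1 /\ derivable (fun u => im (f u)) t 1.
Proof. by move=> [[h1 _] [h2 _]]; split; [exact: h1|exact: h2]. Qed.

Lemma cderiv_continuous f t a : cderiv f t a -> {for t, continuous (fun u => re
  (f u))}.
Proof.
by move=> /cderiv_derivable[h _]; apply: differentiable_continuous;
  apply/derivable1_diffP.
Qed.

(** Differentiability of the inverse is clear from its components; its
    derivative then follows from the product rule for f * f^-1 = 1. *)
Lemma cderivV f t a : (forall u, f u != 0) -> cderiv f t a ->
  cderiv (fun u => (f u)^-1) t (- a / f t ^+ 2).
Proof.
move=> f0 hf; have [f1 f2] := cderiv_derivable hf.
pose d := (fun u => re (f u)) * (fun u => re (f u)) +
     (fun u => im (f u)) * (fun u => im (f u)).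
have dE u : d u = re (f u) ^+ 2 + im (f u) ^+ 2 by rewrite !expr2.
have d0 : d t != 0.
  rewrite dE; apply: contraNneq (f0 t) => h; have : toC (normsq (f t)) = 0 by
    rewrite /normsq h.
  by rewrite normsqE => /eqP; rewrite sqrf_eq0 normr_eq0.
have dd : derivable (fun u => (d u)^-1) t 1.
  apply: derivableV; first exact: d0.
  exact: (derivableD (derivableM f1 f1) (derivableM f2 f2)).
have [||b hb] := @cderiv_ex (fun u => (f u)^-1) t.
- rewrite (_ : (fun u => _) = (fun u => re (f u)) * (fun u => (d u)^-1)).
    exact: (derivableM f1 dd).
  by apply/funext => u /=; rewrite fctE dE; case: (f u) => x y.
- rewrite (_ : (fun u => _) = - ((fun u => im (f u)) * (fun u => (d u)^-1))).
    exact: (derivableN (derivableM f2 dd)).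
  by apply/funext => u /=; rewrite !fctE dE; case: (f u) => x y.
apply: (cderiv_eq hb).
have := cderiv_unique _ (cderivM hf hb) (cderiv_cst 1 t).
have h1 : \forall u \near t, f u * (f u)^-1 = 1 by apply: (@filterE _ _
  (nbhs_filter t)) => u; rewrite mulfV.
move=> /(_ h1) h2.
have eb : f t * b = - ((f t)^-1 * a) by apply/eqP; rewrite -addr_eq0 h2.
by rewrite -[LHS](mulKf (f0 t)) eb expr2 invfM; ring.
Qed.

Section Phasar.
Variables (f : C -> C) (N M : {poly C}) (sigma eta : C) (r : R).
Hypothesis M0 : forall z, `|z| = 1 -> M.[z] != 0.
Hypothesis hf : forall z, `|z| = 1 -> f z = N.[z] / M.[z].
Hypothesis hn : forall z, `|z| = 1 -> `|N.[z]| = `|M.[z]|.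
Hypothesis sigma1 : `|sigma| = 1.
Hypothesis hval : N.[sigma] = eta * M.[sigma].

Let f1 z : `|z| = 1 -> `|f z| = 1.
Proof. by move=> z1; rewrite hf // normf_div hn // divff // normr_eq0 M0. Qed.

Let ii0 : ii != 0.
Proof. by rewrite eq_complex /= oner_eq0 andbF. Qed.

(** Near sigma one has N (expi u) = M (expi u) * expi (psi u), where psi is
    the chosen argument; this is differentiated in u. *)
Lemma phasar_derivativeE : has_phasar_derivative f sigma r ->
  sigma * (N^`().[sigma] - eta * M^`().[sigma]) = toC r * eta * M.[sigma].
Proof.
move=> [t [psi [es hpsi dpsi]]].
have hN : \forall u \near t, N.[expi u] = M.[expi u] * expi (psi u).
  apply: filterS hpsi => u [_]; rewrite f1 ?norm_expi // mul1r => <-.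
  by rewrite hf ?norm_expi // mulrC mulfVK // M0 ?norm_expi.
have := cderiv_unique hN (cderiv_poly N t) (cderivM (cderiv_poly M t)
  (cderiv_expi_comp dpsi)).
have ee : eta = expi (psi t).
  have := nbhs_singleton hN; rewrite -es hval => e.
  by apply: (mulIf (M0 sigma1)); rewrite e mulrC.
rewrite -ee -!es => h; apply: (mulfI ii0).
transitivity (ii * sigma * N^`().[sigma] - eta * (ii * sigma * M^`().[sigma]));
  first by ring.
by rewrite h; ring.
Qed.

(** With g = f / eta, which is 1 at sigma, a local argument of f is that of
    eta plus asin (im g), and its derivative is the imaginary part of that of
    g. *)
Lemma phasar_derivative_of :
  sigma * (N^`().[sigma] - eta * M^`().[sigma]) = toC r * eta * M.[sigma] ->
  has_phasar_derivative f sigma r.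
Proof.
move=> hd; have [t es] := circle_expi sigma1.
have Ms := M0 sigma1.
have e1 : `|eta| = 1.
  have : `|N.[sigma]| = `|eta| * `|M.[sigma]| by rewrite hval normrM.
  rewrite hn // -[LHS]mul1r => /mulIf -> //.
  by rewrite normr_eq0.
have e0 := circle_neq0 e1.
have [th eth] := circle_expi e1.
pose g u := N.[expi u] * (M.[expi u])^-1 * eta^-1.
have gE u : g u = f (expi u) * eta^-1 by rewrite /g hf ?norm_expi.
have g1 u : `|g u| = 1 by rewrite gE normrM f1 ?norm_expi // normfV e1 invr1 mulr1.
have gt : g t = 1 by rewrite /g -es hval mulfK // mulfV.
have dg : cderiv g t (ii * toC r).
  have hV := cderivV (fun u => M0 (norm_expi u)) (cderiv_poly M t).
  apply: (cderiv_eq (cderivM (cderivM (cderiv_poly N t) hV) (cderiv_cst eta^-1 t))).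
  rewrite -!es mulr0 add0r; apply: (mulfI e0); rewrite (mulVKf e0).
  rewrite hval expr2 invfM.
  have -> : eta * M.[sigma] * (- (ii * sigma * M^`().[sigma]) * (M.[sigma]^-1 /
    M.[sigma])) =
     - (eta * (ii * sigma * M^`().[sigma])) * M.[sigma]^-1 * (M.[sigma] /
         M.[sigma]) by ring.
  rewrite mulfV // mulr1.
  transitivity (ii * (sigma * (N^`().[sigma] - eta * M^`().[sigma])) /
    M.[sigma]); first by ring.
  rewrite hd mulrA mulfK //; ring.
exists t, (fun u => th + asin (im (g u))); split => //.
- have cg := cderiv_continuous dg.
  have rg : \forall u \near t, 0 < re (g u).
    apply: (@cvgr_gt _ _ _ (nbhs_filter t) _ _ cg).
    by rewrite gt /re /=.
  apply: filterS rg => u gu; split; first by rewrite -normr_eq0 f1 ?norm_expi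
    // oner_eq0.
  rewrite f1 ?norm_expi // mul1r expiD -eth.
  rewrite (expi_asin (g1 u) gu).
  by rewrite gE mulrC mulfVK.
- have [_ di] := dg.
  have ei : im (g t) = 0 by rewrite gt.
  have da : is_derive (im (g t)) (1 : R) asin 1.
    have h : -1 < im (g t) < 1 by rewrite ei ltrN10 ltr01.
    apply: (is_derive_eq (is_derive1_asin h)).
    by rewrite ei expr0n /= subr0 sqrtr1 invr1.
  have dc := is_derive1_comp da di.
  have := is_deriveD (is_derive_cst th t (1 : R)) dc.
  move=> h; apply: (is_derive_eq h).
  by rewrite iiE /im /GRing.scale /= add0r ?mulr1 ?mul1r.
Qed.

End Phasar.

(** Divided by z ^+ n, F is real and nonnegative on the circle, so that a zero
    on the circle is a minimum. *)
Lemma circle_min_deriv0 F n (q : C -> R) sigma :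
  (forall z, `|z| = 1 -> F.[z] = z ^+ n * toC (q z)) ->
  (forall z, `|z| = 1 -> 0 <= q z) ->
  `|sigma| = 1 -> F.[sigma] = 0 -> F^`().[sigma] = 0.
Proof.
move=> hF q0 s1 Fs; have [t es] := circle_expi s1.
pose G := 'X^n : {poly C}.
have GE u : G.[expi u] != 0 by rewrite hornerXn expf_neq0 // circle_neq0 // norm_expi.
pose m u := F.[expi u] * (G.[expi u])^-1.
have mE u : m u = toC (q (expi u)).
  by rewrite /m hF ?norm_expi // mulrC hornerXn mulKf // -hornerXn GE.
have dm u : cderiv m u (F.[expi u] * (- (ii * expi u * G^`().[expi u]) /
  G.[expi u] ^+ 2) +
   G.[expi u]^-1 * (ii * expi u * F^`().[expi u])).
  exact: cderivM (cderiv_poly F u) (cderivV GE (cderiv_poly G u)).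
have := dm t; rewrite -es Fs mul0r add0r => dmt.
have q_t : re (m t) = 0 by rewrite /m -es Fs mul0r.
have d0 : cderiv m t 0.
  split; last first.
    rewrite (_ : (fun u => _) = cst 0); first exact: is_derive_cst.
    by apply/funext => u; rewrite mE.
  apply: (@derive1_at_min _ _ (t - 1) (t + 1)).
  - by rewrite lerD2l; lra.
  - by move=> u _; exact: (cderiv_derivable (dm u)).1.
  - by rewrite in_itv /=; apply/andP; split; lra.
  - by move=> u _; rewrite q_t mE /re /= q0 ?norm_expi.
have := cderiv_unique (@filterE _ _ (nbhs_filter t) _ (fun u => erefl (m u))) dmt d0.
have ii0 : ii != 0 by rewrite eq_complex /= oner_eq0 andbF.
move/eqP; rewrite !mulf_eq0 invr_eq0 es (negPf (GE t)) (negPf ii0) /=.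
by rewrite (negPf (circle_neq0 (norm_expi t))) => /eqP.
Qed.

End Curves.

(** * Winding numbers of loops in the circle *)

Section Winding.
Variable R : realType.
Local Notation C := (Cx R).
Implicit Types (t u e : R) (f g : R -> C) (K : R * R -> C).

Lemma continuous_sum (I : Type) (s : seq I) (F : I -> R -> R) :
  (forall i, continuous (F i)) -> continuous (fun t => \sum_(i <- s) F i t).
Proof.
move=> cF; elim: s => [|i s IH] t.
  by rewrite (_ : (fun t => _) = fun=> 0); [exact: cst_continuous|apply/funext
    => u; rewrite big_nil].
rewrite (_ : (fun t => _) = fun t => F i t + \sum_(j <- s) F j t).
  exact: (cvgD (cF i t) (IH t)).
by apply/funext => u; rewrite big_cons.
Qed.

Definition mesh (N j : nat) : R := 2 * pi * (j%:R / N%:R).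

(** A quotient of consecutive values of f, when f has values in the circle. *)
Definition turn f (N j : nat) : C := f (mesh N j.+1) * (f (mesh N j))^*.

(** The total change of argument of f over N equal steps, provided that each
    single step turns by less than a right angle. *)
Definition winding f (N : nat) : R := \sum_(j <- iota 0 N) asin (im (turn f N j)).

Lemma re_gt0 (z : C) : `|1 - z| < 1 -> 0 < re z.
Proof.
move=> h; have : toC `|re (1 - z)| < 1 by apply: le_lt_trans h; exact: Re_norm_le.
rewrite -toC1 lt_toC (_ : re (1 - z) = 1 - re z); last by case: z {h}.
by move=> h1; have := ler_norm (1 - re z); lra.
Qed.

Lemma asin_sin_small t : 0 <= t <= pi / 2 -> asin (sin t) = t.
Proof.
move=> /andP[t0 t1]; apply: sinK; rewrite in_itv /= t1 andbT.
by rewrite (le_trans _ t0) // oppr_le0 divr_ge0 // pi_ge0.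
Qed.

Lemma expi_mul_nat (m : nat) t : (expi t : C) ^+ m = expi (m%:R * t).
Proof.
elim: m => [|m IH]; first by rewrite mul0r expi0.
by rewrite exprS IH -expiD -natr1 mulrDl mul1r addrC.
Qed.

Lemma winding_power (c : C) (m N : nat) : `|c| = 1 -> (0 < N)%N -> (4 * m <= N)%N ->
  winding (fun t => c * expi t ^+ m) N = 2 * pi * m%:R.
Proof.
move=> c1 N0 mN; have N0' : (0 : R) < N%:R by rewrite ltr0n.
have eturn j : turn (fun t => c * expi t ^+ m) N j = expi (2 * pi * (m%:R / N%:R)).
  rewrite /turn rmorphM /= mulrACA circle_mulJ // mul1r !expi_mul_nat conj_expi
    -expiD.
  congr expi; rewrite /mesh -natr1; ring.
rewrite /winding (eq_bigr (fun=> 2 * pi * (m%:R / N%:R))).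
  rewrite big_const_seq count_predT size_iota iter_addr_0 -[LHS]mulr_natr.
  by rewrite -mulrA mulfVK ?gt_eqF.
move=> j _; rewrite eturn /im /= asin_sin_small //.
have p0 := pi_gt0 R.
apply/andP; split; first by rewrite mulr_ge0 ?divr_ge0 // mulr_ge0 // ltW.
have hm : m%:R / N%:R <= 4^-1 :> R.
  rewrite ler_pdivrMr // -ler_pdivrMl ?invr_gt0 // invrK -natrM ler_nat //.
have p2 : 0 <= 2 * pi :> R by rewrite mulr_ge0 // ltW.
by apply: le_trans (ler_wpM2l p2 hm) _; lra.
Qed.

Definition clamp t : R := Num.max 0 (Num.min 1 t).

Lemma clamp_itv t : 0 <= clamp t <= 1.
Proof. by rewrite /clamp le_max lexx /= ge_max ler01 ge_min lexx. Qed.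

Lemma clamp_id t : 0 <= t <= 1 -> clamp t = t.
Proof. by move=> /andP[t0 t1]; rewrite /clamp min_r // max_r. Qed.

Lemma continuous_clamp : continuous clamp.
Proof.
apply: (@max_fun_continuous _ R R (fun=> 0)); first exact: cst_continuous.
apply: (@min_fun_continuous _ R R (fun=> 1)); first exact: cst_continuous.
by move=> t; exact: cvg_id.
Qed.

(** A homotopy of loops in the circle with time in [0, 1], extended to all
    times by clamping so that continuity holds on the whole plane. *)
Definition loop_homotopy K : Prop :=
  [/\ continuous K, forall x, `|K x| = 1,
      forall t, K (t, 2 * pi) = K (t, 0)
    & forall t u, K (t, u) = K (clamp t, u)].

(** Uniform continuity in the angle, from compactness of a rectangle. *)
Lemma loop_homotopy_uniform K : loop_homotopy K ->
  exists2 d, 0 < d & forall t u u', 0 <= u <= 2 * pi -> `|u - u'| < d ->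
    `|K (t, u') - K (t, u)| < 1.
Proof.
move=> [cK K1 Kper Kclamp].
pose A : set (R * R) := `[0, 1] `*` `[0, 2 * pi].
have cA : compact A by apply: compact_setX; exact: segment_compact.
have /compact_near_coveringP nA := cA.
pose P d (x : R * R) := forall u', `|x.2 - u'| < d -> `|K (x.1, u') - K x| < 1.
have hP : \forall d \near (0 : R)^'+, A `<=` P d.
  apply: nA => x _.
  have h2 : (0 : C) < 2^-1 by rewrite invr_gt0 ltr0n.
  have := @cvgr_dist_lt _ _ _ (nbhs x) (nbhs_filter x) K (K x) (cK x) _ h2.
  move=> /nbhs_ballP[r /= r0 hr].
  have r2 : 0 < r / 2 by rewrite divr_gt0.
  exists (ball x (r / 2), [set d | d < r / 2]) => /=.
    split; first exact: nbhsx_ballx.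
    exact: nbhs_right_lt.
  move=> [y d] /= [[y1 y2] dr] u' hu'.
  have hy : ball x r y.
    by split; [apply: lt_trans y1 _|apply: lt_trans y2 _]; lra.
  have hyu : ball x r (y.1, u').
    split => /=; first by apply: lt_trans y1 _; lra.
    have y2' : `|x.2 - y.2| < r / 2 := y2.
    rewrite /ball /=.
    have := ler_normD (x.2 - y.2) (y.2 - u').
    rewrite addrA subrK => h; apply: le_lt_trans h _.
    by have := lt_trans hu' dr; lra.
  have e1 := hr _ hy; have e2 := hr _ hyu.
  rewrite (_ : K _ - K y = (K x - K y) - (K x - K (y.1, u'))); last by ring.
  apply: le_lt_trans (ler_normB _ _) _.
  rewrite (_ : 1 = 2^-1 + 2^-1); first exact: ltrD.
  by rewrite -mulr2n -[LHS](mulVf (x := 2)) ?pnatr_eq0 // mulr_natr.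
have [d [d0 hd]] := @filter_ex _ _ (at_right_proper_filter _) _ (filterI
  (nbhs_right_gt 0) hP).
exists d => // t u u' hu huu; rewrite !(Kclamp t).
apply: (hd (clamp t, u)) => //; split; rewrite /= in_itv /= ?hu //.
exact: clamp_itv.
Qed.

(** On a mesh that is fine enough for all times at once, the total change of
    argument depends continuously on time. It is always a multiple of 2 pi,
    hence constant. *)
Lemma winding_homotopy K : loop_homotopy K -> exists N0, forall N, (N0 < N)%N ->
  winding (fun u => K (0, u)) N = winding (fun u => K (1, u)) N.
Proof.
move=> hK; have [d d0 hd] := loop_homotopy_uniform hK.
have [cK K1 Kper Kclamp] := hK.
have p0 := pi_gt0 R.
exists (Num.trunc (2 * pi / d)) => N hN.
have N0 : (0 : R) < N%:R by rewrite ltr0n (leq_ltn_trans _ hN).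
have hNd : 2 * pi / N%:R < d.
  rewrite ltr_pdivrMr // [d * _]mulrC -ltr_pdivrMr //.
  apply: lt_le_trans (truncnS_gt (2 * pi / d)) _.
  by rewrite ler_nat.
pose q j t := turn (fun u => K (t, u)) N j.
have q1 j t : `|q j t| = 1 by rewrite normrM norm_conjC !K1 mulr1.
have qre j t : (j < N)%N -> 0 < re (q j t).
  move=> jN; apply: re_gt0.
  have hm : 0 <= mesh N j <= 2 * pi.
    have hj0 : 0 <= j%:R / N%:R :> R by rewrite divr_ge0.
    have hj1 : j%:R / N%:R <= 1 :> R by rewrite ler_pdivrMr // mul1r ler_nat ltnW.
    by rewrite /mesh; apply/andP; split; nra.
  have := hd t _ (mesh N j.+1) hm.
  have -> : mesh N j - mesh N j.+1 = - (2 * pi / N%:R) by rewrite /mesh -natr1; ring.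
  rewrite normrN gtr0_norm ?divr_gt0 ?mulr_gt0 // => /(_ hNd).
  have -> : 1 - q j t = (K (t, mesh N j) - K (t, mesh N j.+1)) * (K (t, mesh N j))^*.
    by rewrite mulrBl circle_mulJ.
  by rewrite normrM norm_conjC K1 mulr1 distrC.
pose W t := winding (fun u => K (t, u)) N.
have cW : continuous W.
  rewrite /W /winding.
  have -> : (fun t => \sum_(j <- iota 0 N) asin (im (turn (fun u => K (t, u)) N j))) =
    (fun t => \sum_(j <- iota 0 N) (if (j < N)%N then asin (im (q j t)) else 0)).
    apply/funext => t; rewrite big_seq [RHS]big_seq; apply: eq_bigr => j.
    by rewrite mem_iota add0n => /andP[_ ->].
  apply: continuous_sum => j; case: ltnP => [jN|_]; last exact: cst_continuous.
  move=> t; apply: (@continuous_comp _ _ _ (fun t => im (q j t)) asin).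
    apply: continuous_comp; last exact: continuous_Im.
    have cKt u : {for t, continuous (fun t => K (t, u))}.
      apply: (@continuous_comp _ _ _ (fun t => (t, u)) K); last exact: cK.
      exact: (@cvg_pair _ _ _ (nbhs t) (nbhs t) (nbhs u) _ _ _ _ _ cvg_id
        (cvg_cst u)).
    apply: (cvgM (cKt _)).
    by apply: (@continuous_comp _ _ _ _ (fun z : C => z^*)); [exact: cKt|exact:
      continuous_conj].
  by apply: continuous_asin; apply: unit_re_im; [exact: q1|exact: qre].
have eW t : expi (W t) = 1.
  have h m : (m <= N)%N -> expi (\sum_(j <- iota 0 m) asin (im (q j t))) =
      K (t, mesh N m) * (K (t, mesh N 0))^*.
    elim: m => [|m IH] hm; first by rewrite big_nil expi0 circle_mulJ.
    rewrite -[m.+1]addn1 iotaD big_cat /= big_seq1 add0n expiD IH 1?ltnW //.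
    rewrite expi_asin ?q1 ?qre // /q /turn addn1.
    rewrite mulrC -mulrA [X in _ * X]mulrA [_^* * _]mulrC circle_mulJ // mul1r.
    by [].
  rewrite /W /winding (h N (leqnn N)) /mesh mul0r mulr0 divff ?gt_eqF // mulr1 Kper.
  by rewrite circle_mulJ.
apply: contrapT => /eqP nW.
(* Otherwise W takes a value W 0 + s with 0 < |s| <= 1, and expi s = 1. *)
pose D := W 1 - W 0.
have D0 : D != 0 by rewrite subr_eq0 eq_sym.
have [s [s0 s1 hs]] : exists s, [/\ s != 0, `|s| <= 1 & exists2 t, t \in `[0,
  1] & W t = W 0 + s].
  have ivt s : Num.min (W 0) (W 1) <= W 0 + s <= Num.max (W 0) (W 1) ->
      exists2 t, t \in `[0, 1] & W t = W 0 + s.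
    by apply: IVT => //; exact: continuous_subspaceT.
  have [D1|D1] := leP `|D| 1.
    exists D; split => //; apply: ivt.
    by rewrite /D addrC subrK le_max ge_min !lexx !orbT.
  have [Dp|Dn] := ltP 0 D.
    exists 1; split; rewrite ?oner_neq0 ?normr1 //; apply: ivt.
    rewrite gtr0_norm // in D1; rewrite ge_min le_max.
    by apply/andP; split; apply/orP; [left|right]; rewrite /D in D1; lra.
  exists (-1); split; rewrite ?oppr_eq0 ?oner_neq0 ?normrN ?normr1 //; apply: ivt.
  rewrite ler0_norm // in D1; rewrite ge_min le_max.
  by apply/andP; split; apply/orP; [right|left]; rewrite /D in D1; lra.
case: hs => t _ ht.
have : expi s = 1 :> C by have := eW t; rewrite ht expiD eW mul1r.
case=> cs _; have cs' : cos `|s| = cos 0.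
  by rewrite cos0 -cs; case: (ger0P s) => // _; rewrite cosN.
have i0 : (0 : R) \in `[0, pi] by rewrite in_itv /= lexx ltW.
have i1 : `|s| \in `[0, pi].
  by rewrite in_itv /= normr_ge0 /= (le_trans s1) // (le_trans _ (pi_ge2 R)) // ler1n.
have /normr0_eq0 s00 := cos_inj i1 i0 cs'.
by rewrite s00 eqxx in s0.
Qed.

(** The total change of argument of c * z ^+ m on a fine mesh is 2 pi m, and
    both homotopies preserve it. *)
Lemma loop_degree_unique K1 K2 (c1 c2 : C) (m n : nat) :
  loop_homotopy K1 -> loop_homotopy K2 -> `|c1| = 1 -> `|c2| = 1 ->
  (forall u, K1 (0, u) = c1 * expi u ^+ m) -> (forall u, K2 (1, u) = c2 * expi
    u ^+ n) ->
  (forall u, K1 (1, u) = K2 (0, u)) -> m = n.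
Proof.
move=> h1 h2 n1 n2 e1 e2 e12.
have [N1 hN1] := winding_homotopy h1; have [N2 hN2] := winding_homotopy h2.
pose N := (N1 + N2 + 4 * m + 4 * n).+1.
have l1 : (N1 < N)%N by rewrite ltnS -!addnA leq_addr.
have l2 : (N2 < N)%N by rewrite ltnS [(N1 + N2)%N]addnC -!addnA leq_addr.
have l3 : (4 * m <= N)%N by rewrite leqW // addnAC leq_addl.
have l4 : (4 * n <= N)%N by rewrite leqW // leq_addl.
have w1 : winding (fun u => K1 (0, u)) N = 2 * pi * m%:R.
  by rewrite (_ : (fun u => _) = fun u => c1 * expi u ^+ m); [exact:
    winding_power|exact/funext].
have w2 : winding (fun u => K2 (1, u)) N = 2 * pi * n%:R.
  by rewrite (_ : (fun u => _) = fun u => c2 * expi u ^+ n); [exact: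
    winding_power|exact/funext].
have : 2 * pi * m%:R = 2 * pi * n%:R :> R.
  rewrite -w1 -w2 (hN1 _ l1) -(hN2 _ l2); congr winding; exact/funext.
have h0 : 2 * pi != 0 :> R by rewrite mulf_neq0 ?pnatr_eq0 // gt_eqF // pi_gt0.
by move=> /(mulfI h0) /eqP; rewrite eqr_nat => /eqP.
Qed.

End Winding.

(** * Rational inner functions as quotients of polynomials *)

Section Representation.
Variable R : realType.
Local Notation C := (Cx R).
Implicit Types (z w u : C) (P Q M N D E : {poly C}) (f : C -> C).

Lemma left_limit_unique (g : R -> C) (a b : C) :
  g r @[r --> 1^'-] --> a -> g r @[r --> 1^'-] --> b -> a = b.
Proof.
move=> ga gb.
have FF : ProperFilter (g r @[r --> 1^'-]) by apply: fmap_proper_filter; exact: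
  at_left_proper_filter.
by apply: (cvg_unique _ ga gb); exact: norm_hausdorff.
Qed.

Lemma ae_imply (P Q : R -> Prop) : (forall t, P t -> Q t) ->
  {ae (@lebesgue_measure R), forall t, P t} -> {ae (@lebesgue_measure R),
    forall t, Q t}.
Proof.
move=> PQ [B [mB B0 sB]]; exists B; split => // t nQ.
by apply: sB => Pt; exact/nQ/PQ.
Qed.

Lemma bounded_quotient N M (b : R) : 0 <= b -> M != 0 ->
  (forall z, `|z| < 1 -> M.[z] != 0 -> `|N.[z] / M.[z]| <= toC b) ->
  forall z, `|z| <= 1 -> `|N.[z]| <= toC b * `|M.[z]|.
Proof.
move=> b0 M0 hb z hz.
have bC : 0 <= toC b by rewrite toC_ge0.
rewrite -(ler_pXn2r (n := 2)) // -?topredE //= ?normr_ge0 ?mulr_ge0 //.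
rewrite exprMn -!normsqE expr2 -!toCM le_toC -subr_ge0.
apply: (@disc_closure_ge0 _ (fun z => b * b * normsq M.[z] - normsq N.[z]) M) => //.
  move=> x; have c P : {for x, continuous (fun z => normsq P.[z])}.
    by apply: continuous_comp; [exact: continuous_poly|exact: continuous_normsq].
  exact: (cvgB (cvgM (cvg_cst (b * b)) (c M)) (c N)).
move=> x hx Mx; rewrite subr_ge0 -le_toC !toCM !normsqE -expr2 -exprMn.
rewrite ler_pXn2r // -?topredE //= ?normr_ge0 ?mulr_ge0 //.
by have := hb x hx Mx; rewrite normf_div ler_pdivrMr // normr_gt0.
Qed.

(** At a zero of M in the closed disc the bound would force N to vanish as
    well. *)
Lemma no_pole N M (b : R) : 0 <= b -> coprimep N M -> M != 0 ->
  (forall z, `|z| < 1 -> M.[z] != 0 -> `|N.[z] / M.[z]| <= toC b) ->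
  forall z, `|z| <= 1 -> M.[z] != 0.
Proof.
move=> b0 cop M0 hb z hz; apply/eqP => Mz.
have := bounded_quotient b0 M0 hb hz; rewrite Mz normr0 mulr0 normr_le0.
by apply/negP; apply: (coprimep_root (p := M)); [rewrite coprimep_sym|apply/rootP].
Qed.

Lemma continuous_quotient N M z : M.[z] != 0 ->
  {for z, continuous (fun w => N.[w] / M.[w])}.
Proof.
move=> Mz; apply: (cvgM (@continuous_poly _ N z)).
by apply: cvgV => //; exact: continuous_poly.
Qed.

Lemma radial_limit f N M t : (forall z, M.[z] != 0 -> f z = N.[z] / M.[z]) ->
  M.[expi t] != 0 ->
  f (toC r * expi t) @[r --> 1^'-] --> N.[expi t] / M.[expi t].
Proof.
move=> hf Mt.
have ct : {for (1 : R), continuous (fun r : R => toC r * expi t)}.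
  exact: (cvgM (@continuous_toC R 1) (cvg_cst _)).
have e1 : toC 1 * expi t = expi t :> C by rewrite toC1 mul1r.
have c2 : {for toC 1 * expi t, continuous (fun w => N.[w] / M.[w])}.
  by rewrite e1; exact: continuous_quotient.
have h : (fun r : R => N.[toC r * expi t] / M.[toC r * expi t]) r @[r --> (1 : R)] -->
    N.[toC 1 * expi t] / M.[toC 1 * expi t] := continuous_comp ct c2.
rewrite e1 in h.
have c3 : {for toC 1 * expi t, continuous (fun w => M.[w])} by exact: continuous_poly.
have hc : (fun r : R => M.[toC r * expi t]) r @[r --> (1 : R)] --> M.[toC 1 * expi t]
  := continuous_comp ct c3.
rewrite e1 in hc.
have hM : \forall r \near (1 : R), M.[toC r * expi t] != 0.
  exact: (@cvgr_neq0 _ _ _ (nbhs (1 : R)) _ _ _ hc).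
apply: (@cvg_trans _ ((fun r : R => N.[toC r * expi t] / M.[toC r * expi t]) r
  @[r --> 1^'-])).
  apply: near_eq_cvg; apply: (@cvg_within _ (nbhs (1 : R))).
  by apply: filterS hM => r hr; rewrite hf.
by apply: cvg_trans h; apply: cvg_app; exact: cvg_within.
Qed.

Lemma max_size N M n : maxn (size N).-1 (size M).-1 = n ->
  (size N <= n.+1)%N /\ (size M <= n.+1)%N.
Proof.
move=> <-; split; apply: leq_trans (leqSpred _) _; rewrite ltnS.
  exact: leq_maxl.
exact: leq_maxr.
Qed.

(** On the circle |N| = |M| amounts to the polynomial identity N * star n N =
    star n M * M. Since N / M is reduced of degree n, the reflection of M is a
    scalar multiple of N. *)
Lemma unimodular_rep N M n : coprimep N M -> M != 0 ->
  maxn (size N).-1 (size M).-1 = n ->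
  {ae (@lebesgue_measure R), forall t, `|N.[expi t]| = `|M.[expi t]|} ->
  exists2 u, `|u| = 1 & N = u *: star n M.
Proof.
move=> cop M0 smax hae; have [sN sM] := max_size smax.
have e : N * star n N = star n M * M.
  apply/eqP; rewrite -subr_eq0; apply/eqP; apply: (poly_ae_eq0 hae) => t ht.
  rewrite hornerD hornerN !hornerM !star_circle ?norm_expi //.
  rewrite mulrCA -mulrA -[X in _ - _ * X]mulrC -!normCK ht subrr //.
have N'0 : star n N != 0.
  apply: contraNneq M0 => h; move: e; rewrite h mulr0 => /esym /eqP.
  rewrite mulf_eq0 => /orP[/eqP h2|/eqP -> //].
  by rewrite -(starK sM) h2 star0.
have [q q0 [e1 e2]] := proportional cop smax (size_star _ _) (size_star _ _) N'0 e.
have q1 : `|q| = 1.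
  have : star n (star n N) = N by exact: starK.
  rewrite e2 starZ e1 scalerA => eN.
  have N0 : N != 0.
    by apply: contraNneq N'0 => ->; rewrite star0.
  have : (q^* * q - 1) *: N = 0 by rewrite scalerBl scale1r eN subrr.
  move/eqP; rewrite scaler_eq0 (negPf N0) orbF subr_eq0 mulrC -normCK.
  by rewrite pexpr_eq1 // => /eqP.
exists q^-1; first by rewrite normfV q1 invr1.
by rewrite e1 scalerA mulVf // scale1r.
Qed.

Lemma inner_rep f N M n : inner f -> reduced_quotient f N M ->
  maxn (size N).-1 (size M).-1 = n ->
  (forall z, `|z| <= 1 -> M.[z] != 0) /\ exists2 u, `|u| = 1 & N = u *: star n M.
Proof.
move=> [_ fb hae] [cop M0 hf] smax.
have nM : forall z, `|z| <= 1 -> M.[z] != 0.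
  apply: (@no_pole N M 1 ler01 cop M0) => z hz Mz.
  by rewrite -hf // toC1; exact: fb.
split => //; apply: (unimodular_rep cop M0 smax).
apply: ae_imply hae => t [l hl fl].
have Mt : M.[expi t] != 0 by rewrite nM // norm_expi.
have el := left_limit_unique fl (radial_limit hf Mt).
have h : `|N.[expi t] / M.[expi t]| = 1 by rewrite -el; exact: hl.
move: h; rewrite normf_div => h.
by rewrite -[LHS](divfK (x := `|M.[expi t]|)) ?normr_eq0 // h mul1r.
Qed.

Lemma Gamma_bound (s p : C) : Gamma (s, p) -> `|s| <= 2 /\ `|p| <= 1.
Proof.
move=> [z [w [hz hw [-> ->]]]]; split.
  by rewrite (le_trans (ler_normD _ _)) // (_ : 2 = 1 + 1) // lerD.
by rewrite normrM mulr_ile1.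
Qed.

Lemma bGamma_bound (s p : C) : bGamma (s, p) ->
  [/\ `|p| = 1, s = s^* * p & `|s| <= 2].
Proof. by move=> [z [w [hz hw [-> ->]]]]; exact: bGamma_char. Qed.

(** The zeros of M lie outside the closed disc, and their mirror images
    inside. *)
Lemma coprime_star n M : (size M <= n.+1)%N ->
  (forall z, `|z| <= 1 -> M.[z] != 0) -> coprimep M (star n M).
Proof.
move=> sM nM; apply/Pdiv.ClosedField.coprimepP => x /rootP Mx.
have x1 : 1 < `|x|.
  by rewrite real_ltNge ?normr_real ?rpred1 //; apply/negP => /nM; rewrite Mx eqxx.
have x0 : x != 0 by rewrite -normr_gt0 (lt_trans ltr01).
rewrite horner_star // mulf_neq0 ?expf_neq0 // conjC_eq0 nM //.
by rewrite normfV norm_conjC invf_le1 ?(lt_trans ltr01) // ltW.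
Qed.

(** Let s = A / B and p = P / D be reduced. The relation s = conj s * p on the
    circle is the polynomial identity A * star j B * D = star j A * P * B.
    Here B is coprime to A and to its own reflection, so B divides D, and s =
    E / D for some E. The relation then says that E is a multiple of its
    reflection, which also bounds its degree by that of p. *)
Lemma Gamma_inner_rep h : rational_Gamma_inner h ->
  exists m u D E P, [/\ triple m u D E P, coprimep P D,
    forall z, `|z| <= 1 -> D.[z] != 0,
    forall z, `|z| <= 1 -> h z = (E.[z] / D.[z], P.[z] / D.[z]) &
    forall z, `|z| <= 1 -> `|E.[z]| <= 2 * `|D.[z]| ].
Proof.
move=> [[_ _ hG hae] [A [B [copA B0 hA]]] [P [D [copP D0 hP]]]].
have hGb z : `|z| < 1 -> `|(h z).1| <= 2 /\ `|(h z).2| <= 1.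
  by move=> hz; have := hG z hz; case: (h z) => s p; exact: Gamma_bound.
have bA z : `|z| < 1 -> B.[z] != 0 -> `|A.[z] / B.[z]| <= toC 2.
  by move=> hz Bz; rewrite -hA // toC2; have [] := hGb z hz.
have bP z : `|z| < 1 -> D.[z] != 0 -> `|P.[z] / D.[z]| <= toC 1.
  by move=> hz Dz; rewrite -hP // toC1; have [] := hGb z hz.
have nB : forall z, `|z| <= 1 -> B.[z] != 0 := @no_pole A B 2 (ler0n _ _) copA B0 bA.
have nD : forall z, `|z| <= 1 -> D.[z] != 0 := @no_pole P D 1 ler01 copP D0 bP.
have hae' : {ae (@lebesgue_measure R), forall t,
    bGamma (A.[expi t] / B.[expi t], P.[expi t] / D.[expi t])}.
  apply: ae_imply hae => t [[l1 l2] hl hlim].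
  have le1 : `|expi t : C| <= 1 by rewrite norm_expi.
  have e1 := radial_limit hA (nB _ le1).
  have e2 := radial_limit hP (nD _ le1).
  have h1 : (h (toC r * expi t)).1 @[r --> 1^'-] --> l1 := cvg_comp _ _ hlim
    (@cvg_fst _ _ _ _ (nbhs_filter l2)).
  have h2 : (h (toC r * expi t)).2 @[r --> 1^'-] --> l2 := cvg_comp _ _ hlim
    (@cvg_snd _ _ _ _ (nbhs_filter l1)).
  by rewrite -(left_limit_unique h1 e1) -(left_limit_unique h2 e2).
pose m := maxn (size P).-1 (size D).-1; have smax : maxn (size P).-1 (size
  D).-1 = m by [].
have [sP sD] := max_size smax.
have [u u1 eP] : exists2 u, `|u| = 1 & P = u *: star m D.
  apply: (unimodular_rep copP D0 smax); apply: ae_imply hae' => t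
    /bGamma_bound[h1 _ _].
  have Dt : D.[expi t] != 0 by rewrite nD ?norm_expi.
  move: h1; rewrite normf_div => h1.
  by rewrite -[LHS](divfK (x := `|D.[expi t]|)) ?normr_eq0 // h1 mul1r.
pose j := maxn (size A).-1 (size B).-1; have [sA sB] := @max_size A B j erefl.
have eAB : A * star j B * D = star j A * P * B.
  apply/eqP; rewrite -subr_eq0; apply/eqP; apply: (poly_ae_eq0 hae') => t
    /bGamma_bound[_ h2 _].
  have Dt : D.[expi t] != 0 by rewrite nD ?norm_expi.
  have Bt : B.[expi t] != 0 by rewrite nB ?norm_expi.
  rewrite hornerD hornerN !hornerM !star_circle ?norm_expi //.
  have -> : A.[expi t] = (A.[expi t] / B.[expi t]) * B.[expi t] by rewrite divfK.
  have -> : P.[expi t] = (P.[expi t] / D.[expi t]) * D.[expi t] by rewrite divfK.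
  rewrite [in X in X - _]h2 rmorphM /=; ring.
have [K eD] : exists K, D = K * B.
  apply/dvdpP.
  have c1 : coprimep B (A * star j B).
    by rewrite coprimepMr coprimep_sym copA coprime_star.
  by rewrite -(Gauss_dvdpr _ c1) eAB dvdp_mull.
pose E := K * A.
have hE z : `|z| <= 1 -> A.[z] / B.[z] = E.[z] / D.[z].
  move=> hz; have := nD z hz; rewrite eD /E !hornerM mulf_eq0 negb_or => /andP[Kz Bz].
  by rewrite invfM mulrACA divff // mul1r.
have hEcirc z : `|z| = 1 -> E.[z] = u * z ^+ m * (E.[z])^*.
  move=> hz; have hz1 : `|z| <= 1 by rewrite hz.
  have Dz := nD z hz1; have DJ : (D.[z])^* != 0 by rewrite conjC_eq0.
  have := nB z hz1 => Bz; have BJ : (B.[z])^* != 0 by rewrite conjC_eq0.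
  have h1 : A.[z] / B.[z] = (A.[z] / B.[z])^* * (P.[z] / D.[z]).
    have := congr1 (fun F => F.[z]) eAB; rewrite !hornerM !star_circle // => h1.
    have zj : z ^+ j != 0 by rewrite expf_neq0 // circle_neq0.
    apply: (mulIf (_ : B.[z] * D.[z] * (B.[z])^* * z ^+ j != 0)); first by
      rewrite !mulf_neq0.
    transitivity (A.[z] * (z ^+ j * (B.[z])^*) * D.[z] * (B.[z] / B.[z]));
      first by ring.
    rewrite h1 divff // mulr1 rmorphM fmorphV /=.
    transitivity (z ^+ j * (A.[z])^* * P.[z] * B.[z] * ((B.[z])^* / (B.[z])^*)
      * (D.[z] / D.[z])).
      by rewrite !divff // !mulr1.
    ring.
  have := h1; rewrite !hE // eP hornerZ star_circle // rmorphM fmorphV /= => h3.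
  rewrite -[LHS](divfK Dz) h3.
  transitivity (u * z ^+ m * (E.[z])^* * ((D.[z])^* / (D.[z])^*) * (D.[z] /
    D.[z])); first by ring.
  by rewrite !divff // !mulr1.
(* J is large enough to reflect E before its degree is known to be at most m. *)
pose J := maxn (size E).-1 m.
have sEJ : (size E <= J.+1)%N.
  by rewrite (leq_trans (leqSpred _)) // ltnS leq_maxl.
have mJ : (m <= J)%N by rewrite leq_maxr.
have eEJ : 'X^(J - m) * E = u *: star J E.
  apply/eqP; rewrite -subr_eq0; apply/eqP; apply: poly_circle_eq0 => z hz.
  rewrite hornerD hornerN hornerM hornerXn hornerZ star_circle // {1}(hEcirc z hz).
  have -> : z ^+ J = z ^+ (J - m) * z ^+ m by rewrite -exprD subnK.
  by move: (z ^+ (J - m)) (z ^+ m) => x y; ring.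
have sE : (size E <= m.+1)%N.
  have [->|E0] := eqVneq E 0; first by rewrite size_poly0.
  have : (size ('X^(J - m) * E)%R <= J.+1)%N.
    by rewrite eEJ (leq_trans (size_scale_leq _ _)) // size_star.
  rewrite mulrC size_mulXn // -leq_subRL; last by rewrite leqW // leq_subr.
  by rewrite subSn ?leq_subr // subKn.
exists m, u, D, E, P; split => //.
- split => //; apply/eqP; rewrite -subr_eq0; apply/eqP; apply: poly_circle_eq0
    => z hz.
  by rewrite hornerD hornerN hornerZ star_circle // {1}(hEcirc z hz) mulrA subrr.
- move=> z hz; rewrite -hE // -hA ?nB // -hP ?nD //.
  by case: (h z).
- rewrite -toC2; apply: (@bounded_quotient E D 2 (ler0n _ _) D0) => z hz Dz.
  by have hz1 := ltW hz; rewrite -hE //; apply: (bA z hz); exact: nB.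
Qed.

End Representation.

(** * The degree of a rational map into the symmetrized bidisc *)

Section Degree.
Variable R : realType.
Local Notation C := (Cx R).
Implicit Types (z w u : C) (P Q M N D E : {poly C}) (f : C -> C) (t : R).

(** On the circle, p (z) / z ^+ m for p = u *: star m D / D, but with D taken
    at t * z. If D has no zero in the closed disc, t = 1 is thus deformed to t
    = 0, where the value is constant. *)
Definition shrunk (u : C) D t z : C :=
  u * ((D.[toC t * z])^* / D.[toC t * z]).

Lemma shrink_le1 t z : 0 <= t <= 1 -> `|z| = 1 -> `|toC t * z| <= 1.
Proof.
move=> /andP[t0 t1] hz; rewrite normrM hz mulr1 norm_toC ger0_norm //.
by rewrite -toC1 le_toC.
Qed.

Lemma shrunk_norm u D t z : `|u| = 1 -> (forall z, `|z| <= 1 -> D.[z] != 0) ->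
  0 <= t <= 1 -> `|z| = 1 -> `|shrunk u D t z| = 1.
Proof.
move=> hu hD ht hz; rewrite /shrunk normrM hu mul1r normf_div norm_conjC divff //.
by rewrite normr_eq0 hD // shrink_le1.
Qed.

Lemma shrunk1 m u D P z : (size D <= m.+1)%N -> P = u *: star m D -> `|z| = 1 ->
  z ^+ m * shrunk u D 1 z = P.[z] / D.[z].
Proof.
move=> sD -> hz; rewrite /shrunk toC1 mul1r hornerZ star_circle //.
by rewrite !mulrA; congr (_ / _); rewrite -!mulrA mulrCA.
Qed.

Lemma shrunk0 u D z : shrunk u D 0 z = u * ((D.[0])^* / D.[0]).
Proof. by rewrite /shrunk toC0 mul0r. Qed.

Lemma continuous_shrunk (T : topologicalType) u D (a : T -> R) (b : T -> C) (x : T) :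
  {for x, continuous a} -> {for x, continuous b} -> D.[toC (a x) * b x] != 0 ->
  {for x, continuous (fun y => shrunk u D (a y) (b y))}.
Proof.
move=> ca cb Dx.
have c1 : {for x, continuous (fun y => toC (a y) * b y)}.
  have c0 : {for x, continuous (fun y => toC (a y))}.
    by apply: continuous_comp; [exact: ca|exact: continuous_toC].
  exact: (cvgM c0 cb).
have c2 : {for x, continuous (fun y => D.[toC (a y) * b y])}.
  by apply: (@continuous_comp _ _ _ _ (fun z => D.[z])); [exact: c1|exact:
    continuous_poly].
have c3 : {for x, continuous (fun y => (D.[toC (a y) * b y])^*)}.
  by apply: (@continuous_comp _ _ _ _ (fun z : C => z^*)); [exact: c2|exact:
    continuous_conj].
exact: (cvgM (cvg_cst u) (cvgM c3 (cvgV Dx c2))).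
Qed.

Lemma continuous_exprn (T : topologicalType) (b : T -> C) (x : T) m :
  {for x, continuous b} -> {for x, continuous (fun y => b y ^+ m)}.
Proof.
move=> cb; rewrite (_ : (fun y => _) = fun y => ('X^m : {poly C}).[b y]).
  by apply: (@continuous_comp _ _ _ _ (fun z => ('X^m : {poly C}).[z]));
    [exact: cb|exact: continuous_poly].
by apply/funext => y; rewrite hornerXn.
Qed.

Lemma expi_2pi : expi (2 * pi) = 1 :> C.
Proof. by rewrite mulr_natl mulr2n /expi cosDpi sinDpi cospi sinpi opprK oppr0. Qed.

(** The second component p is deformed to a multiple of z ^+ m by shrinking
    the argument of D, and to z ^+ n by the second component of the given
    homotopy. *)
Lemma Gamma_degree_unique m n (h : C -> C * C) u D E P :
  triple m u D E P -> (forall z, `|z| <= 1 -> D.[z] != 0) ->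
  (forall z, `|z| <= 1 -> h z = (E.[z] / D.[z], P.[z] / D.[z])) ->
  Gamma_degree h n -> m = n.
Proof.
move=> [[sD sE sP] u1 eP eE] hD hh [H [cH Hb H0 H1]].
pose K1 (x : R * R) : C := expi x.2 ^+ m * shrunk u D (clamp x.1) (expi x.2).
pose K2 (x : R * R) : C := (H (clamp x.1, expi x.2)).2.
have cexp : continuous (fun x : R * R => (expi x.2 : C)).
  by move=> x; apply: continuous_comp; [exact: cvg_snd|exact: continuous_expi].
have ccl : continuous (fun x : R * R => clamp x.1).
  by move=> x; apply: continuous_comp; [exact: cvg_fst|exact: continuous_clamp].
have hK1 : loop_homotopy K1.
  split.
  - move=> x; have c1 := continuous_exprn (m := m) (cexp x).
    have c2 : {for x, continuous (fun y : R * R => shrunk u D (clamp y.1) (expi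
      y.2))}.
      apply: continuous_shrunk; [exact: ccl|exact: cexp|].
      by rewrite hD // shrink_le1 ?clamp_itv ?norm_expi.
    exact: (cvgM c1 c2).
  - move=> x; rewrite normrM normrX norm_expi expr1n mul1r shrunk_norm ?clamp_itv //.
    exact: norm_expi.
  - by move=> t; rewrite /K1 /= expi_2pi expi0.
  - by move=> t v; rewrite /K1 /= (clamp_id (clamp_itv t)).
have hK2 : loop_homotopy K2.
  split.
  - pose A := [set x : R * C | 0 <= x.1 <= 1 /\ circle x.2].
    pose g (x : R * R) : R * C := (clamp x.1, expi x.2).
    have cg : continuous g.
      by move=> x; apply: (@cvg_pair _ _ _ (nbhs x) (nbhs (clamp x.1)) (nbhs
        (expi x.2 : C))); [exact: ccl|exact: cexp].
    have gA x : A (g x) by split; [exact: clamp_itv|exact: norm_expi].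
    move=> x; apply: (@continuous_comp _ _ _ (H \o g) (fun y : C * C => y.2));
      last exact: cvg_snd.
    move/subspace_continuousP: cH => /(_ (g x) (gA x)) cHx.
    have gx : g y @[y --> x] --> within A (nbhs (g x)).
      move=> U hU.
      apply: (@filterS _ (nbhs x) (nbhs_filter x) (g @^-1` [set y | A y -> U
        y])); last exact: (cg x _ hU).
      by move=> y hy; exact: (hy (gA y)).
    exact: (cvg_comp _ _ gx cHx).
  - move=> x; have hb := Hb _ _ (clamp_itv x.1) (norm_expi x.2).
    by rewrite /K2; move: hb; case: (H _) => s p /bGamma_bound[].
  - by move=> t; rewrite /K2 /= expi_2pi expi0.
  - by move=> t v; rewrite /K2 /= (clamp_id (clamp_itv t)).
have i0 : 0 <= (0 : R) <= 1 by rewrite lexx ler01.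
have i1 : 0 <= (1 : R) <= 1 by rewrite ler01 lexx.
apply: (loop_degree_unique hK1 hK2 (c1 := u * ((D.[0])^* / D.[0])) (c2 := 1)).
- rewrite -(shrunk0 u D 1); apply: shrunk_norm => //; exact: normr1.
- exact: normr1.
- by move=> v; rewrite /K1 /= (clamp_id i0) shrunk0 mulrC.
- by move=> v; rewrite /K2 /= (clamp_id i1) H1 ?mul1r // /circle /= norm_expi.
- move=> v; rewrite /K1 /K2 /= (clamp_id i0) (clamp_id i1) H0; last exact: norm_expi.
  by rewrite (shrunk1 sD eP (norm_expi v)) hh ?norm_expi.
Qed.

Lemma bGamma_of (s p : C) : `|p| = 1 -> s = s^* * p -> `|s| <= 2 -> bGamma (s, p).
Proof.
by move=> h1 h2 h3; have [z [w [hz hw -> ->]]] := bGammaP h1 h2 h3; exists z, w.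
Qed.

Lemma circle_boundary n u D E P z : triple n u D E P -> D.[z] != 0 -> `|z| = 1 ->
  let s := E.[z] / D.[z] in let p := P.[z] / D.[z] in `|p| = 1 /\ s = s^* * p.
Proof.
move=> [[sD sE sP] u1 eP eE] Dz hz /=.
have DJ : (D.[z])^* != 0 by rewrite conjC_eq0.
rewrite eP {1}eE !hornerZ !star_circle //; split.
  rewrite normf_div !normrM normrX hz expr1n u1 !mul1r norm_conjC divff //.
  by rewrite normr_eq0.
rewrite rmorphM fmorphV /=; move: (z ^+ n) => y.
transitivity (u * (y * (E.[z])^*) / D.[z] * ((D.[z])^* / (D.[z])^*)); last by ring.
by rewrite divff // mulr1.
Qed.

Lemma continuous_affine (a b : R) : continuous (fun t : R => a * t + b).
Proof. move=> t; exact: (cvgD (cvgM (cvg_cst a) cvg_id) (cvg_cst b)). Qed.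

Lemma continuous_ramp (a b : R) : continuous (fun t : R => Num.max 0 (a * t + b)).
Proof.
apply: (@max_fun_continuous _ R R (fun=> 0)); first exact: cst_continuous.
exact: continuous_affine.
Qed.

(** The homotopy has three stages: s is contracted to 0, then p is deformed to
    z ^+ n while s = 0, then s grows from 0 to z ^+ n + 1. It stays in the
    distinguished boundary since s = conj s * p is preserved by real scaling
    of s. *)
Lemma Gamma_degree_of n (h : C -> C * C) u D E P :
  triple n u D E P -> (forall z, `|z| <= 1 -> D.[z] != 0) ->
  (forall z, `|z| <= 1 -> h z = (E.[z] / D.[z], P.[z] / D.[z])) ->
  (forall z, `|z| = 1 -> `|E.[z]| <= 2 * `|D.[z]|) ->
  Gamma_degree h n.
Proof.
move=> ht hD hh hE; have [[sD sE sP] u1 eP eE] := ht.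
have i0 : 0 <= (0 : R) <= 1 by rewrite lexx ler01.
(* The deformation of p ends at expi th * z ^+ n, so it is rotated back on the way. *)
have [th eth] : exists th, u * ((D.[0])^* / D.[0]) = expi th.
  by apply: circle_expi; rewrite -(shrunk0 u D 1); apply: shrunk_norm => //;
    exact: normr1.
pose tau (t : R) := clamp (-3 * t + 2).
pose s1 (x : R * C) : C := toC (Num.max 0 (-3 * x.1 + 1)) * (E.[x.2] / D.[x.2]).
pose s2 (x : R * C) : C := toC (Num.max 0 (3 * x.1 + -2)) * (x.2 ^+ n + 1).
pose q (x : R * C) : C := shrunk u D (tau x.1) x.2 * expi ((tau x.1 - 1) * th).
exists (fun x => (s1 x + s2 x, x.2 ^+ n * q x)).
have q1 t z : circle z -> `|z ^+ n * q (t, z)| = 1.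
  move=> hz; rewrite normrM normrX (hz : `|z| = 1) expr1n mul1r /q normrM
    norm_expi mulr1.
  by rewrite shrunk_norm // clamp_itv.
have clamp1 t : 1 <= t -> clamp t = 1.
  by move=> t1; rewrite /clamp min_l // max_r.
have clamp0 t : t <= 0 -> clamp t = 0.
  by move=> t0; rewrite /clamp min_r ?(le_trans t0) // max_l.
have qs t z : circle z -> t <= 3^-1 -> z ^+ n * q (t, z) = P.[z] / D.[z].
  move=> hz ht3; rewrite /q /= /tau clamp1; last by lra.
  by rewrite subrr mul0r expi0 mulr1 (shrunk1 sD eP hz).
have qe t z : circle z -> 2 / 3 <= t -> z ^+ n * q (t, z) = z ^+ n.
  move=> hz ht3; rewrite /q /= /tau clamp0; last by lra.
  by rewrite shrunk0 eth -expiD sub0r mulN1r subrr expi0 mulr1.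
split.
- apply: continuous_in_subspaceT => x; rewrite inE => -[/= ht01 hz].
  have hx2 : `|x.2| <= 1 by rewrite (hz : `|x.2| = 1).
  have c2 : {for x, continuous (fun y : R * C => y.2)} by exact: cvg_snd.
  have c1 : {for x, continuous (fun y : R * C => y.1)} by exact: cvg_fst.
  have cq : {for x, continuous (fun y : R * C => E.[y.2] / D.[y.2])}.
    apply: (@continuous_comp _ _ _ (fun y : R * C => y.2) (fun z => E.[z] /
      D.[z])); first exact: c2.
    exact: (@continuous_quotient _ E D x.2 (hD _ hx2)).
  have cr a b : {for x, continuous (fun y : R * C => toC (Num.max 0 (a * y.1 + b)))}.
    apply: (@continuous_comp _ _ _ (fun y : R * C => Num.max 0 (a * y.1 + b))
      (@toC R)); last exact: continuous_toC.
    apply: (@continuous_comp _ _ _ (fun y : R * C => y.1) (fun t => Num.max 0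
      (a * t + b))); first exact: c1.
    exact: continuous_ramp.
  have cn := continuous_exprn (m := n) c2.
  have ctau : {for x, continuous (fun y : R * C => tau y.1)}.
    apply: (@continuous_comp _ _ _ (fun y : R * C => y.1) tau); first exact: c1.
    have ca : continuous (fun t : R => -3 * t + 2) := @continuous_affine (-3) 2.
    exact: (continuous_comp (ca x.1) (@continuous_clamp R _)).
  have ce : {for x, continuous (fun y : R * C => (expi ((tau y.1 - 1) * th) : C))}.
    apply: (@continuous_comp _ _ _ (fun y : R * C => (tau y.1 - 1) * th) (@expi
      R)); last exact: continuous_expi.
    exact: (cvgM (cvgB ctau (cvg_cst _)) (cvg_cst _)).
  have cs : {for x, continuous (fun y : R * C => shrunk u D (tau y.1) y.2)}.
    apply: continuous_shrunk; [exact: ctau|exact: c2|].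
    by rewrite hD // shrink_le1 ?clamp_itv.
  have cfst : {for x, continuous (fun y : R * C => s1 y + s2 y)}.
    exact: (cvgD (cvgM (cr (-3) 1) cq) (cvgM (cr 3 (-2)) (cvgD cn (cvg_cst (1 :
      C))))).
  have csnd : {for x, continuous (fun y : R * C => y.2 ^+ n * q y)}.
    exact: (cvgM cn (cvgM cs ce)).
  exact: (@cvg_pair _ _ _ (nbhs x) (nbhs (s1 x + s2 x)) (nbhs (x.2 ^+ n * q x))
    _ _ _ _ _ cfst csnd).
- move=> t z ht01 hz; have hz1 : `|z| = 1 := hz.
  have Dz : D.[z] != 0 by rewrite hD // hz1.
  have [p1 sp] := circle_boundary ht Dz hz1.
  apply: bGamma_of; first exact: q1.
    have [t3|t3] := leP t 3^-1.
      rewrite qs // /s1 /s2 /= [Num.max _ (3 * t + -2)]max_l; last by lra.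
      rewrite toC0 mul0r addr0 rmorphM /= (conj_Creal (toC_real _)).
      by rewrite [in LHS]sp mulrA.
    rewrite /s1 /= [Num.max _ (-3 * t + 1)]max_l; last by lra.
    rewrite toC0 mul0r add0r.
    have [t4|t4] := leP (2 / 3) t.
      rewrite qe // /s2 /= rmorphM /= (conj_Creal (toC_real _)) -mulrA; congr (_ * _).
      rewrite rmorphD rmorph1 mulrDl mul1r rmorphXn /= -exprMn [_^* * _]mulrC
        circle_mulJ //.
      by rewrite expr1n addrC.
    rewrite /s2 /= [Num.max _ (3 * t + -2)]max_l; last by lra.
    by rewrite toC0 mul0r conjC0 mul0r.
  have hr (a : R) (y : C) : 0 <= a <= 1 -> `|y| <= 2 -> `|toC a * y| <= 2.
    move=> /andP[a0 a1] hy; rewrite normrM norm_toC (ger0_norm a0).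
    have ha : toC a <= 1 by rewrite -toC1 le_toC.
    by have := ler_wpM2r (normr_ge0 y) ha; rewrite mul1r => h1; exact: le_trans h1 hy.
  have [t3|t3] := leP t 3^-1.
    rewrite /s1 /s2 /= [Num.max _ (3 * t + -2)]max_l; last by lra.
    rewrite toC0 mul0r addr0; apply: hr.
      by rewrite le_max lexx /= ge_max ler01 /=; lra.
    by rewrite normf_div ler_pdivrMr ?normr_gt0 // hE.
  rewrite /s1 /s2 /= [Num.max _ (-3 * t + 1)]max_l; last by lra.
  rewrite toC0 mul0r add0r; apply: hr.
    by rewrite le_max lexx /= ge_max ler01 /=; lra.
  rewrite (le_trans (ler_normD _ _)) // normrX hz1 expr1n normr1.
  by rewrite -[in leRHS]toC2 -!toC1 -toCD le_toC; lra.
- move=> z hz; have hz1 : `|z| = 1 := hz.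
  rewrite hh ?hz1 //; congr pair; last by apply: qs => //; rewrite invr_ge0 ler0n.
  rewrite /s1 /s2 /= !mulr0 !add0r max_r ?ler01 // max_l; last by lra.
  by rewrite toC1 toC0 mul1r mul0r addr0.
- move=> z hz; congr pair; last by apply: qe => //; lra.
  rewrite /s1 /s2 /= !mulr1 max_l; last by lra.
  rewrite toC0 mul0r add0r max_r; last by lra.
  by rewrite (_ : 3 + -2 = 1 :> R) ?toC1 ?mul1r //; lra.
Qed.

End Degree.

(** * Solutions of the Blaschke interpolation problem *)

Section Blaschke.
Variable R : realType.
Local Notation C := (Cx R).
Implicit Types (z w u : C) (P Q M N D E : {poly C}) (f : C -> C) (t : R).

Lemma reduce_quotient N M : M != 0 -> exists N' M' K,
  [/\ coprimep N' M', M' != 0, N = K * N' & M = K * M'].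
Proof.
move=> M0; pose g := gcdp N M.
have g0 : g != 0 by rewrite gcdp_eq0 negb_and M0 orbT.
have eN : N = g * (N %/ g) by rewrite mulrC divpK // dvdp_gcdl.
have eM : M = g * (M %/ g) by rewrite mulrC divpK // dvdp_gcdr.
exists (N %/ g), (M %/ g), g; split => //.
  by apply: coprimep_div_gcd; rewrite M0 orbT.
by apply: contraNneq M0 => h; rewrite eM h mulr0.
Qed.

Lemma holomorphic_quotient f N M : (forall z, `|z| <= 1 -> M.[z] != 0) ->
  (forall z, M.[z] != 0 -> f z = N.[z] / M.[z]) -> holomorphic_on_disc f.
Proof.
move=> M0 hf z hz; have Mz : M.[z] != 0 by apply: M0; exact: ltW.
have hq := @derivable_quotient _ N M z Mz.
have hM : \forall w \near z, N.[w] / M.[w] = f w.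
  have h : \forall w \near nbhs z, M.[w] != 0.
    exact: (@cvgr_neq0 _ _ _ (nbhs z) _ _ _ (@continuous_poly R M z)).
  by apply: filterS h => w hw; rewrite hf.
have [] := near_eq_is_derive hM (DeriveDef hq erefl).
by [].
Qed.

Lemma circle_abs n u N M z : (size M <= n.+1)%N -> `|u| = 1 -> N = u *: star n M ->
  `|z| = 1 -> `|N.[z]| = `|M.[z]|.
Proof.
move=> sM u1 -> hz; rewrite hornerZ star_circle // !normrM normrX u1 hz expr1n !mul1r.
exact: norm_conjC.
Qed.

Variables (n k : nat) (hk : (k <= n)%N).
Variables (sigma eta : 'I_n -> C) (rho : 'I_k -> R).
Hypothesis hdata : Blaschke_data sigma eta rho.

Let rhoC j := toC (rho j).
Local Notation interp := (interp hk sigma eta rhoC).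
Local Notation solution := (Blaschke_solution hk sigma eta rho).

Lemma data_inj : injective sigma. Proof. by case: hdata. Qed.
Lemma data_circle (j : 'I_n) : (j < k)%N -> `|sigma j| = 1 /\ `|eta j| = 1.
Proof. by case: hdata => _ h _ _; exact: h. Qed.
Lemma data_disc (j : 'I_n) : (k <= j)%N -> `|sigma j| < 1 /\ `|eta j| < 1.
Proof. by case: hdata => _ _ h _; exact: h. Qed.
Lemma data_le1 j : `|sigma j| <= 1. Proof. exact: (node_le1 data_circle
  data_disc). Qed.
Lemma data_bdry (j : 'I_k) : `|sigma (widen_ord hk j)| = 1 /\ `|eta (widen_ord
  hk j)| = 1.
Proof. by apply: data_circle => /=. Qed.

Lemma solution_intro f N M u : coprimep N M ->
  (size N <= n.+1)%N -> (size M <= n.+1)%N -> `|u| = 1 -> N = u *: star n M ->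
  (forall z, `|z| < 1 -> `|N.[z]| <= `|M.[z]|) -> interp N M ->
  (forall z, M.[z] != 0 -> f z = N.[z] / M.[z]) -> solution f.
Proof.
move=> cop sN sM u1 eN hNM [hv hd] hf.
have M0 z : `|z| <= 1 -> M.[z] != 0.
  move=> hz; apply/eqP => Mz; have Nz : N.[z] = 0.
    have [z1|z1] := eqVneq `|z| 1.
      by apply: normr0_eq0; rewrite (circle_abs sM u1 eN z1) Mz normr0.
    have zlt : `|z| < 1 by rewrite lt_neqAle z1 hz.
    by have := hNM z zlt; rewrite Mz normr0 normr_le0 => /eqP.
  by have := coprimep_root cop (introT rootP Nz); rewrite Mz eqxx.
have M00 : M != 0.
  by apply/eqP => h; have := M0 0; rewrite normr0 h horner0 eqxx => /(_ ler01).
have hn z : `|z| = 1 -> `|N.[z]| = `|M.[z]| by exact: (circle_abs sM u1 eN).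
have M1 z : `|z| = 1 -> M.[z] != 0 by move=> hz; rewrite M0 // hz.
split.
- split; first exact: holomorphic_quotient M0 hf.
    move=> z hz; have Mz : M.[z] != 0 by rewrite M0 // ltW.
    by rewrite /cdisc /= hf // normf_div ler_pdivrMr ?normr_gt0 // mul1r hNM.
  apply: (@ae_imply R (fun=> True)); last by exists set0; split => // t; apply.
  move=> t _; exists (N.[expi t] / M.[expi t]).
    by rewrite /circle /= normf_div hn ?norm_expi // divff // normr_eq0 M1 ?norm_expi.
  by apply: radial_limit => //; rewrite M1 // norm_expi.
- exists N, M; split => //.
  have Nn : N`_n != 0.
    rewrite eN coefZ coef_star leqnn subnn mulf_neq0 ?(circle_neq0 u1) //.
    by rewrite conjC_eq0 -horner_coef0 M0 // normr0.
  have -> : size N = n.+1.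
    by apply/eqP; rewrite eqn_leq sN /= ltnNge; apply: contra Nn => h; rewrite
      nth_default.
  by apply/maxn_idPl; rewrite /= -ltnS (leq_trans _ sM) // -ltnS prednK
    ?size_poly_gt0 // leqnSn.
- by move=> j; rewrite hf ?M0 ?data_le1 // hv mulfK // M0 // data_le1.
- move=> j; have [s1 e1] := data_bdry j.
  apply: (@phasar_derivative_of R f N M _ (eta (widen_ord hk j)) (rho j)) => //.
  by move=> z hz; rewrite hf // M1.
Qed.

Lemma solution_rep f : solution f -> exists N M u,
  [/\ [/\ coprimep N M, maxn (size N).-1 (size M).-1 = n, `|u| = 1 & N = u *:
    star n M],
      forall z, `|z| <= 1 -> M.[z] != 0,
      forall z, `|z| < 1 -> `|N.[z]| <= `|M.[z]|, interp N M &
      forall z, M.[z] != 0 -> f z = N.[z] / M.[z]].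
Proof.
move=> [hin [N [M [hq smax]]] hv hp].
have [M0 [u u1 eN]] := inner_rep hin hq smax.
have [_ hb _] := hin.
have [cop M00 hf] := hq; have [sN sM] := max_size smax.
have hn z : `|z| = 1 -> `|N.[z]| = `|M.[z]| by exact: (circle_abs sM u1 eN).
have val j : N.[sigma j] = eta j * M.[sigma j].
  by rewrite -hv hf ?M0 ?data_le1 // divfK // M0 // data_le1.
exists N, M, u; split => //.
- move=> z hz; have Mz : M.[z] != 0 by rewrite M0 // ltW.
  by have := hb z hz; rewrite /cdisc /= hf // normf_div ler_pdivrMr ?normr_gt0
    // mul1r.
- split => // j /=; have [s1 e1] := data_bdry j.
  apply: (@phasar_derivativeE R f N M) => //.
  + by move=> z hz; rewrite M0 // hz.
  + by move=> z hz; rewrite hf // M0 // hz.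
Qed.

(** The given fraction is an expansion of the reduced one, which has degree n
    already, so the two differ by a scalar factor only. *)
Lemma solution_rep_of f N2 M2 : solution f ->
  (size N2 <= n.+1)%N -> (size M2 <= n.+1)%N -> M2 != 0 ->
  (forall z, M2.[z] != 0 -> f z = N2.[z] / M2.[z]) ->
  [/\ exists2 u, `|u| = 1 & N2 = u *: star n M2,
      forall z, `|z| <= 1 -> M2.[z] != 0,
      forall z, `|z| < 1 -> `|N2.[z]| <= `|M2.[z]| & interp N2 M2].
Proof.
move=> /solution_rep[N [M [u [[cop smax u1 eN] M0 hNM hi hf]]]] sN sM M20 hf2.
have e : N * M2 = N2 * M.
  apply: (mulIf M20); apply/eqP; rewrite -subr_eq0; apply/eqP; apply:
    poly_circle_eq0 => z hz.
  have Mz : M.[z] != 0 by rewrite M0 // hz.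
  rewrite hornerD hornerN !hornerM; have [->|M2z] := eqVneq M2.[z] 0.
    by rewrite !mulr0 subrr.
  have := hf2 _ M2z; rewrite hf // => h.
  have -> : N.[z] = N2.[z] / M2.[z] * M.[z] by rewrite -h divfK.
  transitivity ((N2.[z] * M.[z] * (M2.[z] / M2.[z]) - N2.[z] * M.[z]) *
    M2.[z]); first by ring.
  by rewrite divff // mulr1 subrr mul0r.
have [q q0 [e1 e2]] := proportional cop smax sN sM M20 e.
split.
- exists (u * (q / q^*)); first by rewrite normrM u1 mul1r normf_div norm_conjC
    divff // normr_eq0.
  by rewrite e1 e2 starZ eN !scalerA -mulrA divfK ?conjC_eq0 // mulrC.
- by move=> z hz; rewrite e2 hornerZ mulf_neq0 // M0.
- by move=> z hz; rewrite e1 e2 !hornerZ !normrM ler_wpM2l // hNM.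
- have := interp_lin q 0 hi hi; rewrite !scale0r !addr0 -e1 -e2.
  by [].
Qed.

End Blaschke.

(** * From a royal interpolant to the parametrization *)

Section Forward.
Variable R : realType.
Local Notation C := (Cx R).
Implicit Types (z w u : C) (P Q M N D E : {poly C}) (f : C -> C) (t : R).
Variables (n k : nat) (hk : (k <= n)%N).
Variables (sigma eta : 'I_n -> C) (rho : 'I_k -> R).
Hypothesis hdata : Blaschke_data sigma eta rho.
Variable tau : C.
Hypothesis htau : circle tau.
Hypothesis tau_sigma : forall j : 'I_k, tau <> sigma (widen_ord hk j).

Let rhoC j := toC (rho j).
Local Notation interp := (interp hk sigma eta rhoC).
Local Notation solution := (Blaschke_solution hk sigma eta rho).

Lemma away_tau : away sigma tau.
Proof.
move=> j; have t1 : `|tau| = 1 := htau; split; apply/eqP => e.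
  case: (ltnP j k) => jk; last by have [] := data_disc hdata jk; rewrite -e t1 ltxx.
  by case: (tau_sigma (j := Ordinal jk)); rewrite e; congr sigma; exact: val_inj.
have s1 : `|sigma j| = 1.
  by have := congr1 Num.norm e; rewrite normrM norm_conjC t1 mulr1 normr1.
case: (ltnP j k) => jk; last by have [] := data_disc hdata jk; rewrite s1 ltxx.
case: (tau_sigma (j := Ordinal jk)).
have -> : widen_ord hk (Ordinal jk) = j by exact: val_inj.
by rewrite -[LHS]mul1r -(circle_mulJ s1) -mulrA e mulr1.
Qed.

(** On the circle the royal polynomial is u * z ^+ n times 4 |D|^2 - |E|^2,
    which is nonnegative. *)
Lemma royal_deriv0 u D E P z : triple n u D E P ->
  (forall z, `|z| = 1 -> `|E.[z]| <= 2 * `|D.[z]|) ->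
  `|z| = 1 -> (royal_poly D E P).[z] = 0 -> (royal_poly D E P)^`().[z] = 0.
Proof.
move=> [[sD sE sP] u1 eP eE] hED z1 Rz.
have u0 := circle_neq0 u1.
pose F := u^-1 *: royal_poly D E P.
pose q (x : C) : R := 4 * normsq D.[x] - normsq E.[x].
suff h : F^`().[z] = 0.
  move: h; rewrite /F derivZ hornerZ => /eqP; rewrite mulf_eq0 invr_eq0 (negPf u0) /=.
  by move/eqP.
apply: (@circle_min_deriv0 R F n q z) => //.
- move=> x x1; rewrite /F /royal_poly hornerZ hornerD hornerN hornerZ !hornerM.
  rewrite eP {1}eE !hornerZ !star_circle //.
  rewrite toCD toCN toCM !normsqE !normCK (_ : toC 4 = 4); last exact: rmorph_nat.
  transitivity (u^-1 * u * (x ^+ n * (4 * (D.[x] * (D.[x])^*) - E.[x] * (E.[x])^*))).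
    by move: (x ^+ n) => y; ring.
  by rewrite mulVf // mul1r.
- move=> x x1; rewrite subr_ge0 -le_toC toCM !normsqE (_ : toC 4 = 2 ^+ 2);
    last first.
    by rewrite expr2 -natrM; exact: rmorph_nat.
  by rewrite -exprMn ler_pXn2r // -?topredE //= ?normr_ge0 ?mulr_ge0 ?hED // ler0n.
- by rewrite /F hornerZ Rz mulr0.
Qed.

(** The prescribed phasar derivative gives p' at a node on the circle, and the
    double zero of the royal polynomial gives s' in terms of p'. *)
Lemma royal_pencil_interp u D E P (h : C -> C * C) : triple n u D E P ->
  (forall z, `|z| <= 1 -> D.[z] != 0) ->
  (forall z, `|z| <= 1 -> h z = (E.[z] / D.[z], P.[z] / D.[z])) ->
  (forall z, `|z| = 1 -> `|E.[z]| <= 2 * `|D.[z]|) ->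
  royal_solution hk sigma eta rho h ->
  pencil_interp hk sigma eta rhoC D E P.
Proof.
move=> ht hD hh hED [_ _ hv hp]; have [[sD sE sP] u1 eP eE] := ht.
have val j : E.[sigma j] = - (2 * eta j) * D.[sigma j] /\
             P.[sigma j] = eta j ^+ 2 * D.[sigma j].
  have := hv j; rewrite hh ?(data_le1 hdata) // => -[<- <-].
  by rewrite !divfK // hD // (data_le1 hdata).
have der (j : 'I_k) : let i := widen_ord hk j in
  sigma i * (P^`().[sigma i] - eta i ^+ 2 * D^`().[sigma i]) =
    2 * rhoC j * eta i ^+ 2 * D.[sigma i] /\
  eta i * E^`().[sigma i] = - (eta i ^+ 2 * D^`().[sigma i] + P^`().[sigma i]).
  move=> i; have [s1 e1] : `|sigma i| = 1 /\ `|eta i| = 1 := data_bdry hk hdata j.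
  have [vE vP] := val i.
  have Ds : D.[sigma i] != 0 by rewrite hD // s1.
  split.
    rewrite -toC2 -toCM.
    apply: (@phasar_derivativeE R (fun z => (h z).2) P D) => //.
    - by move=> z hz; rewrite hD // hz.
    - by move=> z hz; rewrite hh // hz.
    - by move=> z hz; exact: (circle_abs sD u1 eP).
    - exact: hp.
  have := @royal_deriv0 u D E P (sigma i) ht hED s1.
  rewrite /royal_poly !(derivD, derivN, derivZ, derivM) !(hornerD, hornerN,
    hornerZ, hornerM).
  rewrite vE vP => hR.
  have e0 : 4 * (D.[sigma i] * (eta i ^+ 2 * D.[sigma i])) -
     - (2 * eta i) * D.[sigma i] * (- (2 * eta i) * D.[sigma i]) = 0 by ring.
  have {}hR := hR e0.
  have four0 : (4 : C) != 0 by rewrite pnatr_eq0.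
  apply/eqP; rewrite -addr_eq0; apply/eqP; apply: (mulfI (mulf_neq0 four0 Ds)).
  by rewrite mulr0 -[RHS]hR; ring.
split; split=> j.
- by have [vE vP] := val j; rewrite hornerN hornerZ vE; ring.
- move=> /=; have [] := der j; have [vE vP] := val (widen_ord hk j).
  have [s1 e1] := data_bdry hk hdata j; have e0 := circle_neq0 e1.
  move: vE vP e0; set e := eta _; set s := sigma _ => vE vP e0 d1 d2.
  rewrite !(derivN, derivZ, hornerN, hornerZ); apply: (mulfI e0).
  transitivity (s * (- (e * E^`().[s]) - 2 * e ^+ 2 * D^`().[s])); first by ring.
  rewrite d2.
  transitivity (s * (P^`().[s] - e ^+ 2 * D^`().[s])); first by ring.
  by rewrite d1; ring.
- by have [vE vP] := val j; rewrite hornerN hornerZ vE vP; ring.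
- move=> /=; have [] := der j; have [vE vP] := val (widen_ord hk j).
  move: vE vP; set e := eta _; set s := sigma _ => vE vP d1 d2.
  rewrite !(derivN, derivZ, hornerN, hornerZ) vE.
  transitivity (s * (2 * P^`().[s] + (e * E^`().[s]))); first by ring.
  rewrite d2.
  transitivity (s * (P^`().[s] - e ^+ 2 * D^`().[s])); first by ring.
  by rewrite d1; ring.
Qed.

(** For w on the circle, (2 w p - s) / (2 - w s) is a solution unless w = -
    conj (eta j) for a node on the circle, as these are the only w for which
    numerator and denominator have a common zero. The change of parameter
    determined by the values s0, p0 of s, p at tau normalises this family. Any
    other solution agrees with the member of the family that has the same
    value at tau, by uniqueness. *)
Lemma blaschke_of_royal (h : C -> C * C) : royal_solution hk sigma eta rho h ->
  ~ (h @` (@disc R) `<=` @royal R) ->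
  Blaschke_solvable hk sigma eta rho /\
   exists a b c d : {poly C},
     normalised_parametrization hk sigma eta rho tau a b c d /\
     exists s0 p0 : C,
       [/\ `|s0| < 2, `|p0| = 1, s0 = s0^* * p0
         & s0 *: a - 2 *: b + (2 * p0) *: c - s0 *: d = 0].
Proof.
move=> hsol hroyal; have [hrat hdeg _ _] := hsol.
have [m [u [D [E [P [ht copPD hD hh hED]]]]]] := Gamma_inner_rep hrat.
have emn : m = n := Gamma_degree_unique ht hD hh hdeg.
rewrite {m}emn in ht.
have [[sD sE sP] u1 eP eE] := ht.
have hED1 z : `|z| = 1 -> `|E.[z]| <= 2 * `|D.[z]| by move=> hz; rewrite hED // hz.
have hpi := royal_pencil_interp ht hD hh hED1 hsol.
have hinj := data_inj hdata; have hcirc := data_circle hdata; have hdisc :=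
  data_disc hdata.
(* If it vanished, then s^2 = 4 p and h would map into the royal variety. *)
have R0 : royal_poly D E P != 0.
  apply/eqP => hR; apply: hroyal => _ [z hz <-].
  have z1 : `|z| <= 1 := ltW hz; have Dz := hD z z1.
  exists (E.[z] / D.[z] / 2); rewrite hh //.
  have h2 : (2 : C) != 0 by rewrite pnatr_eq0.
  have e1 : 2 * (E.[z] / D.[z] / 2) = E.[z] / D.[z] by rewrite mulrC divfK.
  congr pair; first by rewrite e1.
  apply: (mulfI (mulf_neq0 h2 h2)).
  transitivity ((2 * (E.[z] / D.[z] / 2)) ^+ 2); last by ring.
  rewrite e1; have := congr1 (fun F => F.[z]) hR.
  rewrite /royal_poly hornerD hornerN hornerZ !hornerM horner0 => /eqP; rewrite
    subr_eq0 => /eqP e.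
  transitivity (4 * (D.[z] * P.[z]) / (D.[z] * D.[z])).
    rewrite invfM; transitivity (4 * P.[z] * (D.[z] / D.[z]) / D.[z]); last by ring.
    by rewrite divff // mulr1; ring.
  by rewrite e expr2 invfM; ring.
have t1 : `|tau| = 1 := htau.
have Dt : D.[tau] != 0 by rewrite hD // t1.
have awt := away_tau.
pose s0 := E.[tau] / D.[tau]; pose p0 := P.[tau] / D.[tau].
have [p01 s0E] : `|p0| = 1 /\ s0 = s0^* * p0 := circle_boundary ht Dt t1.
have Rt : (royal_poly D E P).[tau] != 0.
  by apply: contra_neq R0; exact: (royal_poly_eq0 hinj hcirc hdisc ht hpi awt).
have Et : E.[tau] = s0 * D.[tau] by rewrite divfK.
have Pt : P.[tau] = p0 * D.[tau] by rewrite divfK.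
have s0_lt : `|s0| < 2.
  rewrite lt_neqAle; apply/andP; split; last first.
    by rewrite normf_div ler_pdivrMr ?normr_gt0 // hED1.
  apply: contra Rt => /eqP n2.
  have ss : s0 * s0 = 4 * p0.
    rewrite {2}s0E mulrA -normCK n2; congr (_ * _).
    by rewrite expr2 -natrM.
  apply/eqP; rewrite /royal_poly hornerD hornerN hornerZ !hornerM Et Pt.
  transitivity ((4 * p0 - s0 * s0) * D.[tau] ^+ 2); first by ring.
  by rewrite ss subrr mul0r.
have disc0 := discr_neq0 s0_lt p01.
pose kap := (D.[tau] * (4 * p0 - s0 ^+ 2))^-1.
have kap0 : kap != 0 by rewrite invr_eq0 mulf_neq0.
pose a := par_a s0 kap E P; pose b := par_b s0 p0 kap E P.
pose c := par_c s0 kap D E; pose d := par_d s0 p0 kap D E.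
have sz2 (x y : C) (F G : {poly C}) : (size F <= n.+1)%N -> (size G <= n.+1)%N ->
    (size (kap *: (x *: F - y *: G))%R <= n.+1)%N.
  move=> sF sG; rewrite (leq_trans (size_scale_leq _ _)) //.
  rewrite (leq_trans (size_polyD _ _)) // geq_max size_polyN.
  by rewrite !(leq_trans (size_scale_leq _ _)).
have a_tau : a.[tau] = 1.
  rewrite /a /par_a !(hornerD, hornerN, hornerZ) Et Pt.
  by rewrite (_ : _ - _ = D.[tau] * (4 * p0 - s0 ^+ 2)) ?mulVf ?mulf_neq0 //; ring.
have d_tau : d.[tau] = 1.
  rewrite /d /par_d !(hornerD, hornerN, hornerZ) Et.
  by rewrite (_ : _ - _ = D.[tau] * (4 * p0 - s0 ^+ 2)) ?mulVf ?mulf_neq0 //; ring.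
have b_tau : b.[tau] = 0 by rewrite /b /par_b !(hornerD, hornerN, hornerZ) Et
  Pt; ring.
have c_tau : c.[tau] = 0 by rewrite /c /par_c !(hornerD, hornerN, hornerZ) Et; ring.
have numE zeta w z : w * (s0 * zeta + 2 * p0) = 2 * zeta + s0 ->
    a.[z] * zeta + b.[z] = kap * (s0 * zeta + 2 * p0) * (pencilN E P w).[z].
  move=> hw; transitivity ((zeta *: a + b).[z]); first by rewrite hornerD
    (hornerZ zeta) mulrC.
  by rewrite (par_num kap E P hw) (hornerZ (kap * _)).
have denE zeta w z : w * (s0 * zeta + 2 * p0) = 2 * zeta + s0 ->
    c.[z] * zeta + d.[z] = kap * (s0 * zeta + 2 * p0) * (pencilM D E w).[z].
  move=> hw; transitivity ((zeta *: c + d).[z]); first by rewrite hornerD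
    (hornerZ zeta) mulrC.
  by rewrite (par_den kap D E hw) (hornerZ (kap * _)).
have lam0 zeta : `|zeta| = 1 -> kap * (s0 * zeta + 2 * p0) != 0.
  by move=> z1; rewrite mulf_neq0 // (s0_mobius_neq0 s0_lt p01).
have lfE zeta w z : `|zeta| = 1 -> w * (s0 * zeta + 2 * p0) = 2 * zeta + s0 ->
    linear_fractional a b c d zeta z = (pencilN E P w).[z] / (pencilM D E w).[z].
  move=> z1 hw; rewrite /linear_fractional (numE _ _ _ hw) (denE _ _ _ hw).
  by rewrite -mulf_div divff ?mul1r // lam0.
have hdis z w : `|z| < 1 -> `|w| = 1 -> `|(pencilN E P w).[z]| <= `|(pencilM D
  E w).[z]|.
  move=> hz hw; have z1 : `|z| <= 1 := ltW hz; have Dz := hD z z1.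
  have [[_ _ hG _] _ _] := hrat; have := hG z hz; rewrite hh // => -[x [y [hx
    hy [ex ey]]]].
  have := Gamma_pencil_le hx hy hw; rewrite -ex -ey => hle.
  rewrite !(hornerD, hornerN, hornerZ).
  have -> : 2 * w * P.[z] - E.[z] = (2 * w * (P.[z] / D.[z]) - E.[z] / D.[z]) * D.[z].
    transitivity (2 * w * (P.[z] / D.[z] * D.[z]) - E.[z] / D.[z] * D.[z]);
      last by ring.
    by rewrite !divfK.
  have -> : 2 * D.[z] - w * E.[z] = (2 - w * (E.[z] / D.[z])) * D.[z].
    transitivity (2 * D.[z] - w * (E.[z] / D.[z] * D.[z])); last by ring.
    by rewrite divfK.
  by rewrite !normrM ler_wpM2r.
have Dsig j : D.[sigma j] != 0 by rewrite hD // (data_le1 hdata).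
have good w : `|w| = 1 -> (forall j : 'I_k, w != - (eta (widen_ord hk j))^*) ->
    forall f, (forall z, (pencilM D E w).[z] != 0 ->
      f z = (pencilN E P w).[z] / (pencilM D E w).[z]) -> solution f.
  move=> hw hne f hf.
  apply: (@solution_intro R n k hk sigma eta rho hdata f (pencilN E P w)
    (pencilM D E w) (u * w)) => //.
  - apply/Pdiv.ClosedField.coprimepP => x /rootP Nx; apply/eqP => Mx.
    have [j [_ jk ew]] := common_zero hinj hcirc hdisc ht hpi R0 Dsig hw Nx Mx.
    have := hne (Ordinal jk); rewrite (_ : widen_ord _ _ = j) ?ew ?eqxx //.
    exact: val_inj.
  - exact: size_pencilN.
  - exact: size_pencilM.
  - by rewrite normrM u1 hw mulr1.
  - exact: star_pencil.
  - by move=> z hz; exact: hdis.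
  - exact: pencil_interpW.
(* The parameters that correspond to w = - conj (eta j). *)
pose exc := [seq (2 * - (eta (widen_ord hk j))^* * p0 - s0) / (2 - - (eta
  (widen_ord hk j))^* * s0)
              | j <- enum 'I_k].
have generic zeta : `|zeta| = 1 -> zeta \notin exc ->
    solution (linear_fractional a b c d zeta).
  move=> z1 hz; have [w hw ew] := pencil_of_param s0_lt p01 s0E z1.
  apply: (good w hw) => [j|z _]; last exact: lfE.
  apply: contra hz => /eqP ej; apply/mapP; exists j; first by rewrite mem_enum.
  rewrite -ej; have n0 := two_sub_neq0 s0_lt hw.
  apply: (mulIf n0); rewrite divfK //; apply/eqP; rewrite -subr_eq0; apply/eqP.
  transitivity (2 * zeta + s0 - w * (s0 * zeta + 2 * p0)); first by ring.
  by rewrite ew subrr.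
split.
  have [e he] := @filter_ex _ _ (at_right_proper_filter _) _
    (near_notin exc (fun y => near_expi_neq y (normr1 C))).
  exists (linear_fractional a b c d (1 * expi e)); apply: generic => //.
  by rewrite mul1r norm_expi.
exists a, b, c, d; split; last first.
  by exists s0, p0; split => //; exact: par_relation.
split.
- by split; exact: sz2.
- by exists exc; [rewrite size_map size_enum_ord|exact: generic].
- by [].
- move=> phi /solution_rep[//|N1 [M1 [v [[cop smax v1 eN1] M10 hNM hi1 hf1]]]].
  have [sN1 sM1] := max_size smax.
  have Mt : M1.[tau] != 0 by rewrite M10 // t1.
  have z1 : `|N1.[tau] / M1.[tau]| = 1.
    by rewrite normf_div (circle_abs sM1 v1 eN1 t1) divff // normr_eq0.
  exists (N1.[tau] / M1.[tau]) => //.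
  set zeta := N1.[tau] / M1.[tau] in z1 *.
  have [w hw ew] := pencil_of_param s0_lt p01 s0E z1.
  have eN := numE _ _ tau ew; have eM := denE _ _ tau ew.
  rewrite a_tau b_tau mul1r addr0 in eN; rewrite c_tau d_tau mul0r add0r in eM.
  have eval : N1.[tau] * (pencilM D E w).[tau] = (pencilN E P w).[tau] * M1.[tau].
    apply: (mulfI (lam0 _ z1)).
    transitivity (N1.[tau] * (kap * (s0 * zeta + 2 * p0) * (pencilM D E
      w).[tau])); first by ring.
    rewrite -eM mulr1 mulrA -eN /zeta divfK //.
  have sNw := size_pencilN w sE sP; have sMw := size_pencilM w sD sE.
  have uw1 : `|u * w| = 1 by rewrite normrM u1 hw mulr1.
  have Mw0 : pencilM D E w != 0.
    apply/eqP => h0; move: eM; rewrite h0 horner0 mulr0 => /eqP.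
    by rewrite oner_eq0.
  have e12 := interp_unique hinj hcirc hdisc v1 uw1 sN1 sM1 sNw sMw eN1
    (star_pencil ht hw)
    hi1 (pencil_interpW w hpi) awt eval.
  have [q q0 [e1 e2]] := proportional cop smax sNw sMw Mw0 e12.
  move=> z hz; rewrite (lfE _ _ _ z1 ew) e1 e2 !hornerZ -mulf_div divff // mul1r.
  by rewrite hf1 // M10.
Qed.

End Forward.

(** * From the parametrization to a royal interpolant *)

Section Backward.
Variable R : realType.
Local Notation C := (Cx R).
Implicit Types (z w u : C) (P Q M N D E : {poly C}) (f : C -> C) (t : R).

Lemma circle_notin (s : seq C) : exists2 w, `|w| = 1 & w \notin s.
Proof.
have [e he] := @filter_ex _ _ (at_right_proper_filter _) _
    (near_notin s (fun y => near_expi_neq y (normr1 C))).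
by exists (1 * expi e); rewrite // mul1r norm_expi.
Qed.

Lemma disc_poly_neq0 (F : {poly C}) : F != 0 -> exists2 z, `|z| < 1 & F.[z] != 0.
Proof.
move=> F0; have h10 : (1 : C) != 0 by rewrite oner_eq0.
have h := near_poly_neq0 F0 (fun y => near_segment_neq y h10).
have hlt : \forall e \near (0 : R)^'+, (0 : R) < e < 1.
  by near=> e; apply/andP; split; [|near: e; exact: nbhs_right_lt].
have [e [/andP[e0 e1] he]] := @filter_ex R _ (at_right_proper_filter _) _
  (filterI hlt h).
exists (segment 0 1 e); last exact: he.
by rewrite /segment add0r subr0 mulr1 norm_toC gtr0_norm // -toC1 lt_toC.
Unshelve. all: by end_near. Qed.

(** If |E| > 2 |D| at a point of the disc, then |E| = 2 |D| at some point of
    the segment from tau to it; there 2 D - w E vanishes for some w on the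
    circle. *)
Lemma pencil_bound D E (tau : C) : `|tau| = 1 -> `|E.[tau]| < 2 * `|D.[tau]| ->
  (forall w z, `|w| = 1 -> `|z| < 1 -> (pencilM D E w).[z] != 0) ->
  forall z, `|z| < 1 -> `|E.[z]| <= 2 * `|D.[z]|.
Proof.
move=> t1 ht hM z hz.
pose g (e : R) : R := 4 * normsq D.[segment tau z e] - normsq E.[segment tau z e].
have gE e : toC (g e) = (2 * `|D.[segment tau z e]|) ^+ 2 - `|E.[segment tau z
  e]| ^+ 2.
  rewrite /g toCD toCN toCM !normsqE exprMn; congr (_ * _ - _).
  by rewrite expr2 -natrM; exact: rmorph_nat.
have g0 : 0 < g 0.
  rewrite -toC_gt0 gE /segment toC0 mul0r addr0 subr_gt0.
  by rewrite ltr_pXn2r // -?topredE //= ?normr_ge0 ?mulr_ge0.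
suff g1 : 0 <= g 1.
  have s1 : segment tau z 1 = z by rewrite /segment toC1 mul1r addrC subrK.
  move: g1; rewrite -toC_ge0 gE s1 subr_ge0.
  by rewrite ler_pXn2r ?nnegrE ?mulr_ge0 ?normr_ge0.
rewrite leNgt; apply/negP => g1.
have cg : continuous g.
  move=> e; have cs : {for e, continuous (fun e => segment tau z e)}.
    exact: (cvgD (cvg_cst tau) (cvgM (@continuous_toC R e) (cvg_cst (z - tau)))).
  have c P : {for e, continuous (fun e => normsq P.[segment tau z e])}.
    apply: (@continuous_comp _ _ _ (fun e => P.[segment tau z e]) (@normsq R)).
      apply: (@continuous_comp _ _ _ (fun e => segment tau z e) (fun x => P.[x])).
        exact: cs.
      exact: continuous_poly.
    exact: continuous_normsq.
  exact: (cvgB (cvgM (cvg_cst (4 : R)) (c D)) (c E)).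
have [|c] := @IVT R g 0 1 0 ler01 (continuous_subspaceT cg).
  by rewrite ge_min le_max (ltW g0) (ltW g1) !orbT.
rewrite in_itv /= => /andP[c0 c1] gc.
have cpos : 0 < c.
  have cn0 : c != 0 by apply/eqP => e0; move: g0; have := gc; rewrite e0 => ->;
    rewrite ltxx.
  by rewrite lt_def cn0 c0.
set x := segment tau z c in gE gc.
have hx : `|x| < 1.
  rewrite /x /segment (_ : _ + _ = toC (1 - c) * tau + toC c * z); last first.
    by rewrite toCD toCN toC1; ring.
  apply: le_lt_trans (ler_normD _ _) _; rewrite !normrM !norm_toC t1 mulr1.
  have c1' : 0 <= 1 - c by rewrite subr_ge0.
  rewrite (ger0_norm c0) (ger0_norm c1').
  have -> : (1 : C) = toC (1 - c) + toC c * 1 by rewrite toCD toCN toC1; ring.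
  by rewrite ltrD2l ltr_pM2l // toC_gt0.
have eDE : `|E.[x]| = 2 * `|D.[x]|.
  have : (2 * `|D.[x]|) ^+ 2 == `|E.[x]| ^+ 2.
    by rewrite -subr_eq0 -/x -gE gc toC0.
  rewrite eqrXn2 ?mulr_ge0 // => /eqP ->.
  by [].
have [Dx|Dx] := eqVneq D.[x] 0.
  have Ex : E.[x] = 0 by apply: normr0_eq0; rewrite eDE Dx normr0 mulr0.
  have := hM 1 x (normr1 _) hx; rewrite !(hornerD, hornerN, hornerZ) Dx Ex.
  by rewrite !mulr0 subrr eqxx.
have Ex : E.[x] != 0 by rewrite -normr_eq0 eDE mulf_neq0 ?normr_eq0 ?pnatr_eq0.
have w1 : `|2 * D.[x] / E.[x]| = 1.
  by rewrite normf_div eDE normrM normr_nat divff // mulf_neq0 ?normr_eq0 ?pnatr_eq0.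
have := hM _ x w1 hx; rewrite !(hornerD, hornerN, hornerZ) divfK // subrr eqxx.
by [].
Qed.

Variables (n k : nat) (hk : (k <= n)%N).
Variables (sigma eta : 'I_n -> C) (rho : 'I_k -> R).
Hypothesis hdata : Blaschke_data sigma eta rho.
Let rhoC j := toC (rho j).
Local Notation interp := (interp hk sigma eta rhoC).
Local Notation solution := (Blaschke_solution hk sigma eta rho).

(** The inequalities for the pencil put (s, p) in the symmetrized bidisc for z
    in the disc, and the reflection conditions put it in the distinguished
    boundary for z on the circle. *)
Lemma royal_of_triple u D E P : triple n u D E P ->
  pencil_interp hk sigma eta rhoC D E P -> royal_poly D E P != 0 ->
  (forall z, `|z| <= 1 -> D.[z] != 0) ->
  (forall z, `|z| <= 1 -> `|E.[z]| <= 2 * `|D.[z]|) ->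
  (forall w z, `|w| = 1 -> `|z| < 1 ->
     `|(pencilN E P w).[z]| <= `|(pencilM D E w).[z]|) ->
  exists2 h : C -> C * C,
     royal_solution hk sigma eta rho h & ~ (h @` (@disc R) `<=` @royal R).
Proof.
move=> ht hpi R0 hD hED hdis; have [[sD sE sP] u1 eP eE] := ht.
have D00 : D != 0.
  by apply/eqP => h; have := hD 0; rewrite normr0 h horner0 eqxx => /(_ ler01).
have [A [B [K1 [copA B0 eA eB]]]] := reduce_quotient E D00.
have [Q [M [K2 [copQ M0 eQ eM]]]] := reduce_quotient P D00.
have hB z : `|z| <= 1 -> B.[z] != 0.
  by move=> /hD; rewrite eB hornerM mulf_eq0 negb_or => /andP[].
have hM z : `|z| <= 1 -> M.[z] != 0.
  by move=> /hD; rewrite eM hornerM mulf_eq0 negb_or => /andP[].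
pose h z : C * C := (A.[z] / B.[z], Q.[z] / M.[z]).
have hh z : `|z| <= 1 -> h z = (E.[z] / D.[z], P.[z] / D.[z]).
  move=> hz; have Dz := hD z hz; rewrite /h; congr pair.
    rewrite eA eB !hornerM -mulf_div divff ?mul1r //.
    by move: Dz; rewrite eB hornerM mulf_eq0 negb_or => /andP[].
  rewrite eQ eM !hornerM -mulf_div divff ?mul1r //.
  by move: Dz; rewrite eM hornerM mulf_eq0 negb_or => /andP[].
have hval j : h (sigma j) = (- (2 * eta j), eta j ^+ 2).
  have s1 := data_le1 hdata j; have [vE vP] := pencil_interp_val hpi j.
  by rewrite hh // vE vP !mulfK ?hD // mulNr.
have hb z : `|z| = 1 -> bGamma (h z).
  move=> z1; have Dz : D.[z] != 0 by rewrite hD // z1.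
  have [p1 sp] := circle_boundary ht Dz z1.
  rewrite hh ?z1 //; apply: bGamma_of => //.
  by rewrite normf_div ler_pdivrMr ?normr_gt0 // hED // z1.
exists h; last first.
  move=> hroyal; have [z hz Rz] := disc_poly_neq0 R0.
  have z1 : `|z| <= 1 := ltW hz; have Dz := hD z z1.
  have [|y] := hroyal (h z); first by exists z.
  rewrite hh // => -[es ep]; move/eqP: Rz; apply.
  rewrite /royal_poly hornerD hornerN hornerZ !hornerM.
  transitivity (4 * (D.[z] * (P.[z] / D.[z] * D.[z])) - (E.[z] / D.[z] * D.[z])
    * (E.[z] / D.[z] * D.[z])).
    by rewrite !divfK.
  by rewrite es ep; ring.
split.
- split; last 2 first.
  + by exists A, B; split.
  + by exists Q, M; split.
  split.
  + exact: (@holomorphic_quotient R _ A B).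
  + exact: (@holomorphic_quotient R _ Q M).
  + move=> z hz; have z1 : `|z| <= 1 := ltW hz; have Dz := hD z z1; rewrite hh //.
    have [||x [y [hx hy -> ->]]] := @pencil_le_GammaP C (E.[z] / D.[z]) (P.[z]
      / D.[z]).
    * by rewrite normf_div ler_pdivrMr ?normr_gt0 // hED.
    * move=> w w1; have D0 : 0 < `|D.[z]| by rewrite normr_gt0.
      rewrite -(ler_pM2r D0) -!normrM.
      have -> : (2 * w * (P.[z] / D.[z]) - E.[z] / D.[z]) * D.[z] = (pencilN E
        P w).[z].
        rewrite /pencilN !(hornerD, hornerN, hornerZ).
        transitivity (2 * w * (P.[z] / D.[z] * D.[z]) - E.[z] / D.[z] * D.[z]);
          first by ring.
        by rewrite !divfK.
      have -> : (2 - w * (E.[z] / D.[z])) * D.[z] = (pencilM D E w).[z].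
        rewrite /pencilM !(hornerD, hornerN, hornerZ).
        transitivity (2 * D.[z] - w * (E.[z] / D.[z] * D.[z])); first by ring.
        by rewrite divfK.
      exact: hdis.
    * by exists x, y.
  + apply: (@ae_imply R (fun=> True)); last by exists set0; split => // t; apply.
    move=> t _; exists (h (expi t)); first by apply: hb; exact: norm_expi.
    have le1 : `|expi t : C| <= 1 by rewrite norm_expi.
    have c1 := @radial_limit R (fun z => (h z).1) A B t (fun z _ => erefl) (hB _ le1).
    have c2 := @radial_limit R (fun z => (h z).2) Q M t (fun z _ => erefl) (hM _ le1).
    exact: (@cvg_pair _ _ _ _ (nbhs (h (expi t)).1) (nbhs (h (expi t)).2) _ _ _
      _ _ c1 c2).
- apply: (Gamma_degree_of ht hD hh) => z z1; by rewrite hED // z1.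
- exact: hval.
- move=> j; have [s1 e1] := data_bdry hk hdata j.
  apply: (@phasar_derivative_of R _ P D _ (eta (widen_ord hk j) ^+ 2)) => //.
  + by move=> z z1; rewrite hD // z1.
  + by move=> z z1; rewrite hh // z1.
  + by move=> z z1; exact: (circle_abs sD u1 eP).
  + by have [] := pencil_interp_val hpi (widen_ord hk j).
  + have [vE vP] := pencil_interp_val hpi (widen_ord hk j).
    have [[_ d1] [_ d2]] := hpi; move: (d1 j) (d2 j) => /= {}d1 {}d2.
    move: vE vP d1 d2; set e := eta _; set s := sigma _ => vE vP.
    rewrite !(derivN, derivZ, hornerN, hornerZ) vE toCM toC2 => d1 d2.
    apply: (mulfI (_ : (2 : C) != 0)); first by rewrite pnatr_eq0.
    transitivity (s * (2 * P^`().[s] - e * - E^`().[s]) +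
       e * (s * (- E^`().[s] - e * (2 * D^`().[s])))); first by ring.
    by rewrite d1 d2 /rhoC; ring.
Qed.

Variable tau : C.
Hypothesis htau : circle tau.

(** The solutions at almost all parameters force a and d, b and c to be
    reflections of each other. So s = E / D and p = P / D, with D, E, P
    recovered from a, b, c, d, satisfy the reflection conditions, and the
    members of the pencil at almost all w are solutions. As the royal
    polynomial has no other zeros than the nodes and their mirror images, no
    member vanishes in the open disc. Starting from |s| < 2 at tau, this
    bounds |s| by 2 in the disc. *)
Lemma royal_of_blaschke (a b c d : {poly C}) (s0 p0 : C) :
  normalised_parametrization hk sigma eta rho tau a b c d ->
  `|s0| < 2 -> `|p0| = 1 -> s0 = s0^* * p0 ->
  s0 *: a - 2 *: b + (2 * p0) *: c - s0 *: d = 0 ->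
  exists2 h : C -> C * C,
     royal_solution hk sigma eta rho h & ~ (h @` (@disc R) `<=` @royal R).
Proof.
move=> [[sa sb sc sd] [exc sexc hexc] [at1 dt1 bt0 ct0] _] s0_lt p01 s0E hrel.
have t1 : `|tau| = 1 := htau; have tau0 := circle_neq0 t1.
have hinj := data_inj hdata; have hcirc := data_circle hdata; have hdisc :=
  data_disc hdata.
pose num z : {poly C} := z *: a + b; pose den z : {poly C} := z *: c + d.
have szl (z : C) (F G : {poly C}) : (size F <= n.+1)%N -> (size G <= n.+1)%N ->
    (size (z *: F + G)%R <= n.+1)%N.
  move=> sF sG; rewrite (leq_trans (size_polyD _ _)) // geq_max sG andbT.
  by rewrite (leq_trans (size_scale_leq _ _)).
have num_tau z : (num z).[tau] = z by rewrite /num hornerD hornerZ at1 bt0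
  mulr1 addr0.
have den_tau z : (den z).[tau] = 1 by rewrite /den hornerD hornerZ ct0 dt1
  mulr0 add0r.
have den0 z : den z != 0.
  by apply/eqP => h; have := den_tau z; rewrite h horner0 => /esym/eqP; rewrite
    oner_eq0.
have hgood z : `|z| = 1 -> z \notin exc -> [/\ exists2 u, `|u| = 1 & num z = u
  *: star n (den z),
      forall x, `|x| <= 1 -> (den z).[x] != 0,
      forall x, `|x| < 1 -> `|(num z).[x]| <= `|(den z).[x]| & interp (num z)
        (den z)].
  move=> z1 hz; apply: (solution_rep_of hdata (hexc z z1 hz)); rewrite ?szl // => x _.
  by rewrite /linear_fractional /num /den !hornerD !hornerZ [z * _]mulrC [z *
    c.[x]]mulrC.
(* The unimodular factor in num z = v *: star n (den z) is determined by the
  values at tau. *)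
pose t := (tau ^+ n)^-1.
have tn0 : tau ^+ n != 0 by rewrite expf_neq0.
have tt1 : `|t| = 1 by rewrite normfV normrX t1 expr1n invr1.
have num_star z : `|z| = 1 -> z \notin exc -> num z = t *: star n c + z *: (t
  *: star n d).
  move=> z1 hz; have [[v v1 ev] _ _ _] := hgood z z1 hz.
  have hv : v = z * t.
    have := congr1 (fun F => F.[tau]) ev.
    rewrite num_tau hornerZ star_circle ?szl // den_tau conjC1 mulr1 => ->.
    by rewrite /t mulfK.
  rewrite ev hv /den starD starZ scalerDr !scalerA mulrAC (circle_mulJ z1) mul1r.
  by [].
have [z1 hz1 gz1] := circle_notin exc.
have [z2 hz2] := circle_notin (z1 :: exc).
rewrite inE negb_or => /andP[z12 gz2].
have e1 := num_star _ hz1 gz1; have e2 := num_star _ hz2 gz2.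
have ea : a = t *: star n d.
  have z120 : z2 - z1 != 0 by rewrite subr_eq0.
  have h : (z2 - z1) *: (a - t *: star n d) = 0.
    have -> : (z2 - z1) *: (a - t *: star n d) = (num z2 - (t *: star n c + z2
      *: (t *: star n d)))
        - (num z1 - (t *: star n c + z1 *: (t *: star n d))).
      by apply/polyP => i; rewrite /num !(coefD, coefN, coefZ); ring.
    by rewrite e1 e2 !subrr.
  by apply/eqP; rewrite -subr_eq0; move/eqP: h; rewrite scaler_eq0 (negPf z120).
have eb : b = t *: star n c.
  by apply: (addrI (z1 *: a)); rewrite -/(num z1) e1 -ea addrC.
pose D := inv_D s0 c d; pose E := inv_E s0 p0 c d; pose P := inv_P s0 p0 a b.
have ht : triple n (p0 * t) D E P := inv_triple p01 s0E tt1 sa sb sc sd ea eb hrel.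
have [[sD sE sP] u1 eP eE] := ht.
(* The images of the exceptional parameters under the change of parameter. *)
pose bad := [seq (2 * z + s0) / (s0 * z + 2 * p0) | z <- exc].
have hw w : `|w| = 1 -> w \notin bad -> [/\ interp (pencilN E P w) (pencilM D E w),
    forall x, `|x| <= 1 -> (pencilM D E w).[x] != 0 &
    forall x, `|x| < 1 -> `|(pencilN E P w).[x]| <= `|(pencilM D E w).[x]|].
  move=> w1 wb; have [z zc ez] := param_of_pencil s0_lt p01 s0E w1.
  have hz : z \notin exc.
    apply: contra wb => hz; apply/mapP; exists z => //.
    have n0 := s0_mobius_neq0 s0_lt p01 zc.
    by rewrite -ez mulfK.
  have [_ h2 h3 h4] := hgood z zc hz.
  have lam0 : 2 * (2 - w * s0) != 0.
    by rewrite mulf_neq0 ?pnatr_eq0 // two_sub_neq0.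
  have eN : pencilN E P w = (2 * (2 - w * s0)) *: num z := inv_num ez hrel.
  have eM : pencilM D E w = (2 * (2 - w * s0)) *: den z := inv_den c d ez.
  rewrite eN eM; split.
  - by have := interp_lin (2 * (2 - w * s0)) 0 h4 h4; rewrite !scale0r !addr0.
  - by move=> x hx; rewrite hornerZ mulf_neq0 // h2.
  - by move=> x hx; rewrite !hornerZ !normrM ler_wpM2l // h3.
have Dt : D.[tau] = 2.
  by rewrite /D /inv_D !(hornerD, hornerN, hornerZ) dt1 ct0; ring.
have Et : E.[tau] = 2 * s0.
  by rewrite /E /inv_E !(hornerD, hornerN, hornerZ) dt1 ct0; ring.
have Pt : P.[tau] = 2 * p0.
  by rewrite /P /inv_P !(hornerD, hornerN, hornerZ) at1 bt0; ring.
clearbody D E P.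
have [w1 hw1 gw1] := circle_notin bad.
have [w2 hw2] := circle_notin (w1 :: bad).
rewrite inE negb_or => /andP[w12 gw2].
have [i1 n1 _] := hw w1 hw1 gw1; have [i2 _ _] := hw w2 hw2 gw2.
(* The conditions hold for two members of the pencil, hence for its generators. *)
have hpi : pencil_interp hk sigma eta rhoC D E P.
  have w120 : w2 - w1 != 0 by rewrite subr_eq0.
  pose x := (w2 - w1)^-1.
  have hx : x * w2 = 1 + x * w1.
    have h1 : x * (w2 - w1) = 1 by rewrite mulVf.
    by rewrite -[1]h1; ring.
  split.
    have := interp_lin (1 + w1 * x) (- (w1 * x)) i1 i2.
    have -> : (1 + w1 * x) *: pencilN E P w1 + - (w1 * x) *: pencilN E P w2 = - E.
      apply/polyP => i; rewrite !(coefD, coefN, coefZ).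
      transitivity (- E`_i + 2 * w1 * P`_i * (1 + x * w1 - x * w2)); first by ring.
      by rewrite hx subrr mulr0 addr0.
    have -> : (1 + w1 * x) *: pencilM D E w1 + - (w1 * x) *: pencilM D E w2 = 2 *: D.
      apply/polyP => i; rewrite !(coefD, coefN, coefZ).
      transitivity (2 * D`_i - w1 * E`_i * (1 + x * w1 - x * w2)); first by ring.
      by rewrite hx subrr mulr0 subr0.
    by [].
  have := interp_lin (- x) x i1 i2.
  have -> : - x *: pencilN E P w1 + x *: pencilN E P w2 = 2 *: P.
    apply/polyP => i; rewrite !(coefD, coefN, coefZ).
    transitivity (2 * P`_i * (x * w2 - x * w1)); first by ring.
    by rewrite hx addrK mulr1.
  have -> : - x *: pencilM D E w1 + x *: pencilM D E w2 = - E.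
    apply/polyP => i; rewrite !(coefD, coefN, coefZ).
    transitivity (- E`_i * (x * w2 - x * w1)); first by ring.
    by rewrite hx addrK mulr1.
  by [].
have R0 : royal_poly D E P != 0.
  apply/eqP => /(congr1 (fun F => F.[tau])).
  rewrite /royal_poly hornerD hornerN hornerZ !hornerM Dt Et Pt horner0 => h.
  have /eqP := discr_neq0 s0_lt p01; apply; apply: (mulfI (_ : (4 : C) != 0)).
    by rewrite pnatr_eq0.
  by rewrite mulr0 -[RHS]h; ring.
have Dsig j : D.[sigma j] != 0.
  have := n1 _ (data_le1 hdata j); apply: contraNneq => Dj.
  have [vE _] := pencil_interp_val hpi j.
  by rewrite !(hornerD, hornerN, hornerZ) vE Dj; apply/eqP; ring.
have hdis w x : `|w| = 1 -> `|x| < 1 -> `|(pencilN E P w).[x]| <= `|(pencilM D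
  E w).[x]|.
  move=> w0 hx.
  pose g (v : C) : R := normsq (pencilM D E v).[x] - normsq (pencilN E P v).[x].
  have gE v : toC (g v) = `|(pencilM D E v).[x]| ^+ 2 - `|(pencilN E P v).[x]| ^+ 2.
    by rewrite /g toCD toCN !normsqE.
  suff : 0 <= g w.
    rewrite -toC_ge0 gE subr_ge0.
    by rewrite ler_pXn2r ?nnegrE ?normr_ge0.
  apply: (@circle_closure_ge0 R g bad) => // [|v v1 vb].
    move=> v; rewrite /g.
    have cM : {for v, continuous (fun v => normsq (pencilM D E v).[x])}.
      apply: (@continuous_comp _ _ _ (fun v => (pencilM D E v).[x]) (@normsq
        R)); last exact: continuous_normsq.
      rewrite (_ : (fun v => _) = fun v => ((2 * D.[x])%:P - E.[x] *: 'X).[v]);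
        first exact: continuous_poly.
      by apply/funext => y; rewrite !(hornerD, hornerN, hornerZ, hornerX,
        hornerC); ring.
    have cN : {for v, continuous (fun v => normsq (pencilN E P v).[x])}.
      apply: (@continuous_comp _ _ _ (fun v => (pencilN E P v).[x]) (@normsq
        R)); last exact: continuous_normsq.
      rewrite (_ : (fun v => _) = fun v => ((2 * P.[x]) *: 'X -
        (E.[x])%:P).[v]); first exact: continuous_poly.
      by apply/funext => y; rewrite !(hornerD, hornerN, hornerZ, hornerX,
        hornerC); ring.
    exact: (cvgB cM cN).
  have [_ _ h3] := hw v v1 vb.
  by rewrite -toC_ge0 gE subr_ge0 ler_pXn2r ?nnegrE ?normr_ge0 // h3.
have Mdisc w x : `|w| = 1 -> `|x| < 1 -> (pencilM D E w).[x] != 0.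
  move=> w0 hx; apply/eqP => Mx.
  have Nx : (pencilN E P w).[x] = 0.
    by have := hdis w x w0 hx; rewrite Mx normr0 normr_le0 => /eqP.
  have [j [hj jk _]] := common_zero hinj hcirc hdisc ht hpi R0 Dsig w0 Nx Mx.
  have [s1 _] := hcirc j jk.
  case: hj => [ex|ex]; first by move: hx; rewrite ex s1 ltxx.
  have := congr1 Num.norm ex; rewrite normrM norm_conjC s1 mul1r normr1 => x1.
  by move: hx; rewrite x1 ltxx.
have hEDdisc : forall x, `|x| < 1 -> `|E.[x]| <= 2 * `|D.[x]|.
  apply: (pencil_bound t1 _ Mdisc).
  by rewrite Dt Et normrM !normr_nat ltr_pM2l ?ltr0n.
have hED x : `|x| <= 1 -> `|E.[x]| <= 2 * `|D.[x]|.
  move=> hx; rewrite -toC2; apply: (@bounded_quotient R E D 2) => //.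
    by apply/eqP => h; move: Dt; rewrite h horner0 => /esym/eqP; rewrite pnatr_eq0.
  by move=> y hy Dy; rewrite toC2 normf_div ler_pdivrMr ?normr_gt0 // hEDdisc.
have hD x : `|x| <= 1 -> D.[x] != 0.
  move=> hx; apply/eqP => Dx.
  have Ex : E.[x] = 0.
    by have := hED x hx; rewrite Dx normr0 mulr0 normr_le0 => /eqP.
  have := n1 x hx; rewrite !(hornerD, hornerN, hornerZ) Dx Ex !mulr0 subrr eqxx.
  by [].
exact: (royal_of_triple ht hpi R0 hD hED hdis).
Qed.

End Backward.

(** * The equivalence *)

Unset Implicit Arguments.

Theorem theorem1p5 (R : realType) (n k : nat) (hn : (1 <= n)%N)
    (hk : (k <= n)%N) (sigma eta : 'I_n -> Cx R) (rho : 'I_k -> R)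
    (hdata : Blaschke_data sigma eta rho)
    (tau : Cx R) (htau : circle tau)
    (htau_sigma : forall j : 'I_k, tau <> sigma (widen_ord hk j)) :
  (exists2 h : Cx R -> Cx R * Cx R,
     royal_solution hk sigma eta rho h & ~ (h @` (@disc R) `<=` @royal R))
  <->
  (Blaschke_solvable hk sigma eta rho /\
   exists a b c d : {poly Cx R},
     normalised_parametrization hk sigma eta rho tau a b c d /\
     exists s0 p0 : Cx R,
       [/\ `|s0| < 2, `|p0| = 1, s0 = s0^* * p0
         & s0 *: a - 2 *: b + (2 * p0) *: c - s0 *: d = 0]).
Proof.
split=> [[h hsol hroyal]|].
  exact: (blaschke_of_royal hdata htau htau_sigma hsol hroyal).
move=> [_ [a [b [c [d [hpar [s0 [p0 [s0_lt p01 s0E hrel]]]]]]]]].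
exact: (royal_of_blaschke hdata htau hpar s0_lt p01 s0E hrel).
Qed.
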